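(* Suppose that $\mathcal{P}$, $\mathcal{P}'$ are polynomial functors of degrees $d,d'$ respectively. If $n>d+d'$ then for all $j$ \[ H^j\left(\mathbb{P}^{n-1},\mathcal{P}(\Omega)\otimes\mathcal{P}'(\Omega)\right)\cong\bigoplus_{j_1+j_2=j}H^{j_1}\left(\mathbb{P}^{n-1},\mathcal{P}(\Omega)\right) \otimes H^{j_2}\left(\mathbb{P}^{n-1},\mathcal{P}'(\Omega)\right). \]
   Context: $\mathbf{k}$ is an algebraically closed field. A polynomial functor of degree $d$ is a functor $\mathcal{P}$ from finite dimensional $\mathbf{k}$-vector spaces to itself such that the maps $\operatorname{Hom}(V,W)\to\operatorname{Hom}(\mathcal{P}(V),\mathcal{P}(W))$ are polynomial and $\mathcal{P}(c\cdot\mathrm{id}_V)=c^d\cdot\mathrm{id}_{\mathcal{P}(V)}$ for all $c\in\mathbf{k}$. Such functors apply to vector bundles. $\Omega$ is the cotangent sheaf of $\mathbb{P}^{n-1}$ over $\mathbf{k}$. *)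

(* Defs.v *)
From HB Require Import structures.
From mathcomp Require Import all_boot all_order all_algebra fraction.
From mathcomp Require Import generic_quotient boolp mxtens freeg mpoly ring.

Set Implicit Arguments.
Unset Strict Implicit.
Unset Printing Implicit Defensive.

Import GRing.Theory VectorInternalTheory passmx.
Local Open Scope ring_scope.
Local Open Scope quotient_scope.

Section PropSubmodule.
Variables (R : nzRingType) (U : lmodType R) (P : U -> Prop).
Hypothesis P_closed : P 0 /\ forall a x y, P x -> P y -> P (a *: x + y).

Fact prop_submod_closed : submod_closed (fun x => `[< P x >]).
Proof.
case: P_closed => P0 PD; split=> [|a x y /asboolP Px /asboolP Py].
  exact/asboolP.
by apply/asboolP/PD.
Qed.

Definition prop_submod : submodClosed U :=
  HB.pack (fun x => `[< P x >])
    (GRing.isSubmodClosed.Build R U (fun x => `[< P x >]) prop_submod_closed).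

Lemma prop_submodP x : reflect (P x) (x \in prop_submod).
Proof. exact: asboolP. Qed.

End PropSubmodule.

Fact submod_opp (R : nzRingType) (U : lmodType R) (B : submodClosed U) x :
  x \in B -> - x \in B.
Proof. by move=> xB; rewrite -scaleN1r rpredZ. Qed.

Section Submodule.
Variables (R : nzRingType) (U : lmodType R) (Z : submodClosed U).

Definition submodule : Type := {x : U | x \in Z}.

HB.instance Definition _ := [isSub of submodule for @sval _ _].
HB.instance Definition _ := [Choice of submodule by <:].
HB.instance Definition _ := [SubChoice_isSubLmodule of submodule by <:].

End Submodule.

Section QuotientModule.
Variables (R : nzRingType) (U : lmodType R) (B : submodClosed U).

Definition submod_equiv (x y : U) : bool := x - y \in B.

Lemma submod_equiv_is_equiv : equiv_class_of submod_equiv.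
Proof.
split=> [x|x y|y x z]; rewrite /submod_equiv ?subrr ?rpred0 //.
  by apply/idP/idP=> /submod_opp; rewrite opprB.
by move=> xy yz; rewrite -[x](subrK y) -addrA rpredD.
Qed.

Canonical submod_equiv_equiv := EquivRelPack submod_equiv_is_equiv.

Definition quotmod : Type := {eq_quot submod_equiv}.

HB.instance Definition _ := Choice.on quotmod.
HB.instance Definition _ : EqQuotient U submod_equiv quotmod :=
  EqQuotient.on quotmod.

Definition quotmod0 : quotmod := \pi_quotmod 0.
Definition quotmod_opp (x : quotmod) : quotmod := \pi_quotmod (- repr x).
Definition quotmod_add (x y : quotmod) : quotmod :=
  \pi_quotmod (repr x + repr y).
Definition quotmod_scale (a : R) (x : quotmod) : quotmod :=
  \pi_quotmod (a *: repr x).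

Lemma quotmodP (x y : U) :
  reflect (\pi_quotmod x = \pi_quotmod y) (x - y \in B).
Proof. by apply: (iffP idP) => [?|/eqmodP //]; apply/eqmodP. Qed.

Lemma quotmod_repr (x : U) : repr (\pi_quotmod x) - x \in B.
Proof. by apply/quotmodP; rewrite reprK. Qed.

Lemma quotmod_oppE x : quotmod_opp (\pi_quotmod x) = \pi_quotmod (- x).
Proof. by apply/quotmodP; rewrite -opprD submod_opp ?quotmod_repr. Qed.

Lemma quotmod_addE x y : quotmod_add (\pi_quotmod x) (\pi_quotmod y) = \pi_quotmod (x + y).
Proof. by apply/quotmodP; rewrite opprD addrACA rpredD ?quotmod_repr. Qed.

Lemma quotmod_scaleE a x : quotmod_scale a (\pi_quotmod x) = \pi_quotmod (a *: x).
Proof. by apply/quotmodP; rewrite -scalerBr rpredZ ?quotmod_repr. Qed.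

Lemma quotmodW (x : quotmod) : exists u, x = \pi_quotmod u.
Proof. by exists (repr x); rewrite reprK. Qed.

Fact quotmod_addA : associative quotmod_add.
Proof.
move=> x y z; have [u ->] := quotmodW x; have [v ->] := quotmodW y.
have [w ->] := quotmodW z.
by rewrite (quotmod_addE v w) (quotmod_addE u v) !quotmod_addE addrA.
Qed.
Fact quotmod_addC : commutative quotmod_add.
Proof. move=> x y; have [u ->] := quotmodW x; have [v ->] := quotmodW y.
by rewrite !quotmod_addE addrC. Qed.
Fact quotmod_add0 : left_id quotmod0 quotmod_add.
Proof. by move=> x; have [u ->] := quotmodW x; rewrite quotmod_addE add0r. Qed.
Fact quotmod_addN : left_inverse quotmod0 quotmod_opp quotmod_add.
Proof. by move=> x; have [u ->] := quotmodW x; rewrite quotmod_oppE quotmod_addE addNr. Qed.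

HB.instance Definition _ := GRing.isZmodule.Build quotmod
  quotmod_addA quotmod_addC quotmod_add0 quotmod_addN.

Fact quotmod_scaleA a b x :
  quotmod_scale a (quotmod_scale b x) = quotmod_scale (a * b) x.
Proof. by have [u ->] := quotmodW x; rewrite (quotmod_scaleE b u) !quotmod_scaleE scalerA. Qed.
Fact quotmod_scale1 : left_id 1 quotmod_scale.
Proof. by move=> x; have [u ->] := quotmodW x; rewrite quotmod_scaleE scale1r. Qed.
Fact quotmod_scaleDr : right_distributive quotmod_scale +%R.
Proof.
move=> a x y; have [u ->] := quotmodW x; have [v ->] := quotmodW y.
by rewrite [_ + _]quotmod_addE !quotmod_scaleE scalerDr -quotmod_addE.
Qed.
Fact quotmod_scaleDl x : {morph quotmod_scale^~ x : a b / a + b}.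
Proof.
move=> a b; have [u ->] := quotmodW x.
by rewrite !quotmod_scaleE scalerDl -quotmod_addE.
Qed.

HB.instance Definition _ := GRing.Zmodule_isLmodule.Build R quotmod
  quotmod_scaleA quotmod_scale1 quotmod_scaleDr quotmod_scaleDl.

Definition quotmod_pi (x : U) : quotmod := \pi_quotmod x.

Fact quotmod_pi_linear : linear quotmod_pi.
Proof. by move=> a x y; rewrite /quotmod_pi -quotmod_addE -quotmod_scaleE. Qed.

HB.instance Definition _ := GRing.isLinear.Build R U quotmod _ quotmod_pi
  quotmod_pi_linear.

End QuotientModule.

Section SubQuotient.
Variables (R : nzRingType) (U : lmodType R) (Z B : submodClosed U).

Fact subquot_rel_closed :
  (val (0 : submodule Z) \in B) /\
  forall a (x y : submodule Z),
    val x \in B -> val y \in B -> val (a *: x + y) \in B.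
Proof.
split=> [|a x y xB yB]; first exact: (rpred0 B).
by apply: (rpredD (_ : a *: val x \in B) yB); rewrite rpredZ.
Qed.

(* The quotient of Z by the trace of B on Z, hence Z / B when B is in Z. *)
Definition subquot : lmodType R := quotmod (prop_submod subquot_rel_closed).

End SubQuotient.

Section TensorProduct.
Variables (R : comNzRingType) (U V : lmodType R).

Notation free := {freeg (U * V)%type / R}.

Inductive bilinear_span : free -> Prop :=
| bilinear_span0 : bilinear_span 0
| bilinear_span_l a b u u' v x of bilinear_span x :
    bilinear_span (b *: (<< (a *: u + u', v) >> - a *: << (u, v) >>
                         - << (u', v) >>) + x)
| bilinear_span_r a b u v v' x of bilinear_span x :
    bilinear_span (b *: (<< (u, a *: v + v') >> - a *: << (u, v) >>
                         - << (u, v') >>) + x).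

Fact bilinear_span_closed : bilinear_span 0 /\
  forall c x y, bilinear_span x -> bilinear_span y -> bilinear_span (c *: x + y).
Proof.
split=> [|c x y xP yP]; first exact: bilinear_span0.
elim: xP => [|a b u u' v {}x _ IH|a b u v v' {}x _ IH].
- by rewrite scaler0 add0r.
- by rewrite scalerDr scalerA -addrA; apply: bilinear_span_l.
- by rewrite scalerDr scalerA -addrA; apply: bilinear_span_r.
Qed.

Definition tensor : lmodType R := quotmod (prop_submod bilinear_span_closed).

End TensorProduct.

Section DirectSum.
Variables (R : nzRingType) (I : finType) (V : I -> lmodType R).

Definition dsum : Type := {dffun forall i, V i}.

HB.instance Definition _ := Choice.on dsum.

Implicit Types f g h : dsum.

Definition dsum0 : dsum := [ffun i => 0 : V i].
Definition dsum_opp f : dsum := [ffun i => - f i : V i].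
Definition dsum_add f g : dsum := [ffun i => f i + g i : V i].
Definition dsum_scale a f : dsum := [ffun i => a *: f i : V i].

Fact dsum_addA : associative dsum_add.
Proof. by move=> f g h; apply/ffunP=> i; rewrite !ffunE addrA. Qed.
Fact dsum_addC : commutative dsum_add.
Proof. by move=> f g; apply/ffunP=> i; rewrite !ffunE addrC. Qed.
Fact dsum_add0 : left_id dsum0 dsum_add.
Proof. by move=> f; apply/ffunP=> i; rewrite !ffunE add0r. Qed.
Fact dsum_addN : left_inverse dsum0 dsum_opp dsum_add.
Proof. by move=> f; apply/ffunP=> i; rewrite !ffunE addNr. Qed.

HB.instance Definition _ := GRing.isZmodule.Build dsum
  dsum_addA dsum_addC dsum_add0 dsum_addN.

Fact dsum_scaleA a b f : dsum_scale a (dsum_scale b f) = dsum_scale (a * b) f.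
Proof. by apply/ffunP=> i; rewrite !ffunE scalerA. Qed.
Fact dsum_scale1 : left_id 1 dsum_scale.
Proof. by move=> f; apply/ffunP=> i; rewrite !ffunE scale1r. Qed.
Fact dsum_scaleDr : right_distributive dsum_scale +%R.
Proof. by move=> a f g; apply/ffunP=> i; rewrite !ffunE scalerDr. Qed.
Fact dsum_scaleDl f : {morph dsum_scale^~ f : a b / a + b}.
Proof. by move=> a b; apply/ffunP=> i; rewrite !ffunE scalerDl. Qed.

HB.instance Definition _ := GRing.Zmodule_isLmodule.Build R dsum
  dsum_scaleA dsum_scale1 dsum_scaleDr dsum_scaleDl.

End DirectSum.

Definition lmod_iso (R : nzRingType) (U V : lmodType R) : Prop :=
  exists f : {linear U -> V}, bijective f.

Section RestrictScalars.
Variables (R S : nzRingType) (f : {rmorphism R -> S}) (V : lmodType S).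

Definition restrict : Type := let _ := f in V.

HB.instance Definition _ := GRing.Zmodule.on restrict.

Definition restrict_scale (a : R) (v : restrict) : restrict := f a *: (v : V).

Fact restrict_scaleA a b v :
  restrict_scale a (restrict_scale b v) = restrict_scale (a * b) v.
Proof. by rewrite /restrict_scale scalerA rmorphM. Qed.
Fact restrict_scale1 : left_id 1 restrict_scale.
Proof. by move=> v; rewrite /restrict_scale rmorph1 scale1r. Qed.
Fact restrict_scaleDr : right_distributive restrict_scale +%R.
Proof. by move=> a v w; rewrite /restrict_scale scalerDr. Qed.
Fact restrict_scaleDl v : {morph restrict_scale^~ v : a b / a + b}.
Proof. by move=> a b; rewrite /restrict_scale rmorphD scalerDl. Qed.

HB.instance Definition _ := GRing.Zmodule_isLmodule.Build R restrict
  restrict_scaleA restrict_scale1 restrict_scaleDr restrict_scaleDl.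

End RestrictScalars.

Lemma digits_inj (B N : nat) (a b : nat -> nat) :
  (forall i, a i < B)%N -> (forall i, b i < B)%N ->
  (\sum_(i < N) a i * B ^ i = \sum_(i < N) b i * B ^ i)%N ->
  forall i, (i < N)%N -> a i = b i.
Proof.
elim: N a b => [//|N IH] a b aB bB; rewrite !big_ord_recl !expn0 !muln1.
have shift (c : nat -> nat) : (\sum_(i < N) c (bump 0 i) * B ^ bump 0 i =
    B * \sum_(i < N) c i.+1 * B ^ i)%N.
  rewrite big_distrr; apply: eq_bigr => i _.
  by rewrite /bump leq0n add1n expnS mulnCA.
rewrite !shift => E.
have B0 : (0 < B)%N by apply: leq_trans (aB 0%N).
have E0 : a 0%N = b 0%N.
  have := congr1 (modn^~ B) E.
  by rewrite /= ![(_ 0%N + _)%N]addnC ![(B * _)%N]mulnC !modnMDl !modn_small.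
move: E; rewrite E0 => /addnI /eqP; rewrite eqn_pmul2l // => /eqP E.
case=> [//|i] iN; apply: (IH (fun i => a i.+1) (fun i => b i.+1)) => //.
Qed.

Lemma meval_eq0 (k : closedFieldType) (N : nat) (p : {mpoly k[N]}) :
  (forall v, p.@[v] = 0) -> p = 0.
Proof.
move=> p0; pose B := (\max_(m <- msupp p) mdeg m).+1.
have mB m (i : 'I_N) : m \in msupp p -> (m i < B)%N.
  move=> mp; rewrite ltnS; apply: leq_trans (@leq_bigmax_seq _ _ _ mdeg m mp isT).
  by rewrite mdegE (bigD1 i) //= leq_addr.
pose w (m : 'X_{1..N}) := (\sum_(i < N) m i * B ^ i)%N.
have w_inj : {in msupp p &, injective w}.
  move=> m m' mp m'p E; apply/mnmP=> i.
  pose ext (m : 'X_{1..N}) j := if insub j is Some i then m i else 0%N.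
  have extE (m1 : 'X_{1..N}) (j : 'I_N) : ext m1 j = m1 j.
    by rewrite /ext insubT //= => lt; congr (m1 _); apply: val_inj.
  have extB (m1 : 'X_{1..N}) j : m1 \in msupp p -> (ext m1 j < B)%N.
    by move=> ?; rewrite /ext; case: insubP => // u _ _; apply: mB.
  rewrite -!extE; apply: (@digits_inj B N (ext m) (ext m')) => // [j|j|].
  - exact: extB.
  - exact: extB.
  - by under eq_bigr do rewrite extE; under [RHS]eq_bigr do rewrite extE.
pose q : {poly k} := \sum_(m <- msupp p) p@_m *: 'X^(w m).
have q0 : q = 0.
  apply/eqP; apply: contraT => /closed_nonrootP [t]; rewrite /root => /eqP [].
  rewrite -[RHS](p0 (fun i => t ^+ (B ^ i))) mevalE horner_sum.
  apply: eq_bigr => m _; rewrite hornerZ hornerXn /w; congr (_ * _).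
  by rewrite -prodrXr; apply: eq_bigr => i _; rewrite mulnC exprM.
apply/mpolyP=> m; rewrite mcoeff0.
case: (boolP (m \in msupp p)) => [mp|]; last exact: memN_msupp_eq0.
have := congr1 (fun q : {poly k} => q`_(w m)) q0.
rewrite coef0 coef_sum (bigD1_seq m) ?msupp_uniq //= coefZ coefXn eqxx mulr1.
rewrite big_seq_cond big1 ?addr0 // => m' /andP[m'p ne].
rewrite coefZ coefXn; case: eqP => [E|_]; last by rewrite mulr0.
by rewrite (w_inj _ _ m'p mp (esym E)) eqxx in ne.
Qed.

Lemma meval_inj (k : closedFieldType) (N : nat) (p q : {mpoly k[N]}) :
  (forall v, p.@[v] = q.@[v]) -> p = q.
Proof.
by move=> pq; apply/subr0_eq/meval_eq0 => v; rewrite mevalB pq subrr.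
Qed.

Section ProjectiveSpace.
Variables (k : fieldType) (n : nat).

(* The homogeneous coordinates of P^(n-1) are 'X_0, .., 'X_(n-1). *)
Definition ratfun : fieldType := {fraction {mpoly k[n]}}.

Definition coord (i : 'I_n) : ratfun := tofrac ('X_i : {mpoly k[n]}).

Definition ratconst : k -> ratfun := @tofrac {mpoly k[n]} \o @mpolyC n k.

HB.instance Definition _ := GRing.RMorphism.on ratconst.

(* For I nonempty, the ring of functions on the intersection U_I of the
   standard charts U_i = {x_i <> 0}, i in I: the degree 0 part of the
   localization of k[x_0, .., x_(n-1)] at the product of the x_i, i in I. *)
Definition regular (I : {set 'I_n}) (f : ratfun) : Prop :=
  exists (e : nat) (p : {mpoly k[n]}), p \is (e * #|I|).-homog /\
    f = tofrac p / (\prod_(i in I) coord i) ^+ e.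

Lemma coord_neq0 i : coord i != 0.
Proof. by rewrite tofrac_eq0 -msupp_eq0 msuppX. Qed.

Lemma prod_coord_neq0 (I : {set 'I_n}) : \prod_(i in I) coord i != 0.
Proof. by apply/prodf_neq0 => i _; apply: coord_neq0. Qed.

Lemma prod_coordE (I : {set 'I_n}) :
  \prod_(i in I) coord i = tofrac (\prod_(i in I) 'X_i).
Proof. by rewrite rmorph_prod. Qed.

Lemma homog_prod_coord (I : {set 'I_n}) :
  (\prod_(i in I) 'X_i : {mpoly k[n]}) \is #|I|.-homog.
Proof.
rewrite -sum1_card; elim/big_rec2: _ => [|i d p _ hp]; first exact: dhomog1.
by apply: dhomogM hp; rewrite dhomogX /= mdeg1.
Qed.

Lemma regular_const I c : regular I (ratconst c).
Proof.
exists 0%N, c%:MP; rewrite mul0n expr0 divr1; split=> //.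
by rewrite -[c%:MP]mulr1 mul_mpolyC dhomogZ ?dhomog1.
Qed.

Lemma regular0 I : regular I 0.
Proof. by rewrite -(rmorph0 ratconst); apply: regular_const. Qed.

Lemma regular1 I : regular I 1.
Proof. by rewrite -(rmorph1 ratconst); apply: regular_const. Qed.

Lemma regularM I f g : regular I f -> regular I g -> regular I (f * g).
Proof.
move=> [e [p [hp ->]]] [e' [q [hq ->]]]; exists (e + e')%N, (p * q).
by rewrite mulnDl dhomogM // rmorphM exprD invfM mulrACA.
Qed.

Lemma regularD I f g : regular I f -> regular I g -> regular I (f + g).
Proof.
move=> [e [p [hp ->]]] [e' [q [hq ->]]].
pose x : {mpoly k[n]} := \prod_(i in I) 'X_i.
have hx := homog_prod_coord I.
exists (e + e')%N, (p * x ^+ e' + q * x ^+ e); split.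
  rewrite mulnDl rpredD //; first by rewrite dhomogM // mulnC dhomogMn.
  by rewrite addnC dhomogM // mulnC dhomogMn.
have nz d : (\prod_(i in I) coord i) ^+ d != 0.
  by rewrite expf_neq0 // prod_coord_neq0.
rewrite rmorphD !rmorphM !rmorphXn /= -prod_coordE exprD.
by rewrite addf_div // nz.
Qed.

Lemma regularN I f : regular I f -> regular I (- f).
Proof.
by rewrite -mulN1r -(rmorph1 ratconst) -rmorphN; apply/regularM/regular_const.
Qed.

Lemma regular_sum I (J : Type) (r : seq J) (P : pred J) (F : J -> ratfun) :
  (forall j, P j -> regular I (F j)) -> regular I (\sum_(j <- r | P j) F j).
Proof.
move=> FP; elim/big_ind: _ => // [|x y]; first exact: regular0.
exact: regularD.
Qed.

Lemma regular_prod I (J : Type) (r : seq J) (P : pred J) (F : J -> ratfun) :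
  (forall j, P j -> regular I (F j)) -> regular I (\prod_(j <- r | P j) F j).
Proof.
move=> FP; elim/big_ind: _ => // [|x y]; first exact: regular1.
exact: regularM.
Qed.

Lemma regular_ratio (I : {set 'I_n}) i j :
  i \in I -> regular I (coord j / coord i).
Proof.
move=> iI; exists 1%N, ('X_j * \prod_(t in I :\ i) 'X_t); split.
  rewrite mul1n (cardsD1 i) iI dhomogM ?homog_prod_coord //.
  by rewrite dhomogX /= mdeg1.
rewrite expr1 rmorphM /= -prod_coordE [\prod_(t in I) _](big_setD1 i) //=.
by rewrite -/(coord j) -mulf_div divff ?mulr1 ?prod_coord_neq0.
Qed.

(* A vector bundle on P^(n-1), glued from trivial bundles over the charts U_i.
   Fibre coordinates are row vectors: s in the trivialization over U_i
   is s *m trans i j in the trivialization over U_j. *)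
Record vbundle := VBundle {
  vrank : nat;
  trans : 'I_n -> 'I_n -> 'M[ratfun]_vrank;
  trans_regular : forall i j a b, regular [set i; j] (trans i j a b);
  trans_id : forall i, trans i i = 1%:M;
  trans_comp : forall i j l, trans i j *m trans j l = trans i l
}.

Section Cohomology.
Variable E : vbundle.

(* A section over U_I is a rational section, given by its coordinates in all
   trivializations, that is regular in the trivializations over the U_i, i in I.
   Restriction from U_I to U_J, with I a subset of J, is then an inclusion. *)
Definition ratsection := {ffun 'I_n -> 'rV[ratfun]_(vrank E)}.

Definition is_section (I : {set 'I_n}) (s : ratsection) : Prop :=
  (forall i j, s j = s i *m trans E i j) /\
  (forall i, i \in I -> forall a, regular I (s i 0 a)).

(* Sheaf cohomology is computed by the alternating Cech complex of the affine
   cover (U_i), the sheaf of sections being quasi-coherent. In a cochain, a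
   (p+1)-subset I of the index set stands for the increasing sequence of its
   elements. *)
Definition cochain_space : lmodType k :=
  restrict ratconst {ffun {set 'I_n} -> ratsection}.

Definition is_cochain (p : nat) (c : cochain_space) : Prop :=
  forall I, is_section I (c I) /\ (#|I| <> p.+1 -> c I = 0).

Definition cech_d (c : cochain_space) : cochain_space :=
  [ffun J : {set 'I_n} =>
    \sum_(j in J) (-1) ^+ #|[set i in J | (i < j)%N]| *: c (J :\ j)].

Definition is_cocycle p c : Prop := is_cochain p c /\ cech_d c = 0.

Definition is_coboundary p c : Prop :=
  if p is q.+1 then exists b : cochain_space, is_cochain q b /\ c = cech_d b
  else c = 0.

Fact is_cochain_closed p : is_cochain p 0 /\
  forall a c c', is_cochain p c -> is_cochain p c' -> is_cochain p (a *: c + c').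
Proof.
split=> [I|a c c' hc hc' I].
  split=> [|_]; last by rewrite ffunE.
  by split=> [i j|i _ a]; rewrite !ffunE ?mul0mx // mxE; apply: regular0.
have [[cc rc] zc] := hc I; have [[cc' rc'] zc'] := hc' I.
have E1 : (a *: c + c') I = ratconst a *: c I + c' I by rewrite !ffunE.
rewrite E1; split=> [|hI]; last by rewrite zc // zc' // scaler0 addr0.
split=> [i j|i iI b]; rewrite !ffunE.
  by rewrite (cc i j) (cc' i j) mulmxDl scalemxAl.
rewrite !mxE; apply: regularD (rc' _ iI b).
by apply: regularM (rc _ iI b); apply: regular_const.
Qed.

Fact cech_d_linear a c c' : cech_d (a *: c + c') = a *: cech_d c + cech_d c'.
Proof.
apply/ffunP=> J.
have -> : (a *: cech_d c + cech_d c') J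
          = ratconst a *: cech_d c J + cech_d c' J by rewrite !ffunE.
rewrite !ffunE scaler_sumr -big_split; apply: eq_bigr => j _ /=.
have -> : (a *: c + c') (J :\ j) = ratconst a *: c (J :\ j) + c' (J :\ j).
  by rewrite !ffunE.
by rewrite scalerDr !scalerA mulrC.
Qed.

Fact cech_d0 : cech_d 0 = 0.
Proof.
apply: (addrI (cech_d 0)).
by rewrite -{1}[cech_d 0]scale1r -cech_d_linear scale1r !addr0.
Qed.

Fact is_cocycle_closed p : is_cocycle p 0 /\
  forall a c c', is_cocycle p c -> is_cocycle p c' -> is_cocycle p (a *: c + c').
Proof.
have [c0 cD] := is_cochain_closed p; split=> [|a c c' [hc dc] [hc' dc']].
  by split=> //; apply: cech_d0.
by split; [apply: cD | rewrite cech_d_linear dc dc' scaler0 addr0].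
Qed.

Fact is_coboundary_closed p : is_coboundary p 0 /\
  forall a c c',
    is_coboundary p c -> is_coboundary p c' -> is_coboundary p (a *: c + c').
Proof.
case: p => [|p] /=.
  by split=> // a c c' -> ->; rewrite scaler0 addr0.
have [c0 cD] := is_cochain_closed p; split.
  by exists 0; rewrite cech_d0.
move=> a _ _ [b [hb ->]] [b' [hb' ->]]; exists (a *: (b : cochain_space) + b').
by rewrite cech_d_linear; split=> //; apply: cD.
Qed.

Definition cohomology (p : nat) : lmodType k :=
  subquot (prop_submod (is_cocycle_closed p))
          (prop_submod (is_coboundary_closed p)).

End Cohomology.

End ProjectiveSpace.

Fact omega_field_identity1 (F : fieldType) (xi xj xa D1 D2 : F) :
  xi != 0 -> xj != 0 ->
  D2 = xj / xi * (xa / xi * D1 + D2 * (xi / xj)) - xa * xj / xi ^+ 2 * D1.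
Proof. by move=> hi hj; field; rewrite hi hj. Qed.

Fact omega_field_identity2 (F : fieldType) (xi xj xl xa : F) (ac ic jc : bool) :
  xi != 0 -> xj != 0 ->
  xj / xi * (xl / xj *+ ac - xa * xl / xj ^+ 2 *+ jc)
    - xa * xj / xi ^+ 2 * (xl / xj *+ ic - xi * xl / xj ^+ 2 *+ jc) =
  xl / xi *+ ac - xa * xl / xi ^+ 2 *+ ic.
Proof.
move=> hi hj; case: ac ic jc => [] [] [];
  by rewrite ?mulr0n ?mulr1n; field; rewrite ?hi ?hj.
Qed.

Section Cotangent.
Variables (k : fieldType) (n : nat).
Local Notation K := (ratfun k n).
Local Notation x := (@coord k n).

(* The cotangent bundle has the basis d(x_t / x_i), t <> i, over U_i, indexed
   by a : 'I_n.-1 via t = fintype.lift i a. The transition matrix expresses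
   d(x_t / x_i) in the d(x_s / x_j), see omega_trans_derivation. *)
Definition omega_trans (i j : 'I_n) : 'M[K]_n.-1 :=
  \matrix_(a, b)
    (x j / x i *+ (fintype.lift i a == fintype.lift j b)
     - x (fintype.lift i a) * x j / x i ^+ 2 *+ (i == fintype.lift j b)).

Lemma big_lift (j : 'I_n) (F : 'I_n -> K) :
  F j = 0 -> \sum_b F (fintype.lift j b) = \sum_t F t.
Proof.
move=> Fj; rewrite (bigD1 j) //= Fj add0r.
have inj : injective (fintype.lift j) by apply: lift_inj.
rewrite -(big_imset F (A := predT) (h := fintype.lift j)) /=; last by move=> ? ? _ _ /inj.
apply: eq_bigl => t; apply/imsetP/idP=> [[b _ ->]|tj].
  by rewrite eq_sym neq_lift.
have /unlift_some[b tE _] : j != t by rewrite eq_sym.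
by exists b.
Qed.

Lemma sum_mulrn (c : K) (i : 'I_n) (F : 'I_n -> K) :
  \sum_t c *+ (i == t) * F t = c * F i.
Proof.
rewrite (bigD1 i) //= eqxx mulr1n big1 ?addr0 // => t ti.
by rewrite eq_sym (negPf ti) mulr0n mul0r.
Qed.

(* Row a of the matrix applied to a function F vanishing at j. *)
Lemma sum_omega_trans (i j : 'I_n) a (F : 'I_n -> K) : F j = 0 ->
  \sum_b omega_trans i j a b * F (fintype.lift j b) =
  x j / x i * F (fintype.lift i a) - x (fintype.lift i a) * x j / x i ^+ 2 * F i.
Proof.
move=> Fj; under eq_bigr do rewrite mxE.
rewrite (big_lift (F := fun t => (x j / x i *+ (fintype.lift i a == t)
   - x (fintype.lift i a) * x j / x i ^+ 2 *+ (i == t)) * F t)) ?Fj ?mulr0 //.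
by under eq_bigr do rewrite mulrBl; rewrite sumrB !sum_mulrn.
Qed.

Lemma omega_trans_derivation (D : {additive K -> K}) :
  (forall f g, D (f * g) = f * D g + D f * g) ->
  forall i j a, D (x (fintype.lift i a) / x i) =
    \sum_b omega_trans i j a b * D (x (fintype.lift j b) / x j).
Proof.
move=> DM i j a; have x0 := @coord_neq0 k n.
have D1 : D 1 = 0.
  by have := DM 1 1; rewrite !mulr1 mul1r => /esym/(canRL (addrK _)); rewrite subrr.
rewrite (sum_omega_trans i a (F := fun t => D (x t / x j))) ?divff //.
have E : x (fintype.lift i a) / x j = x (fintype.lift i a) / x i * (x i / x j).
  by rewrite mulrA divfK ?x0.
rewrite E (DM (x (fintype.lift i a) / x i)).
exact: omega_field_identity1.
Qed.

Fact omega_trans_regular i j a b :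
  regular [set i; j] (omega_trans i j a b).
Proof.
rewrite mxE; have iI : i \in [set i; j] by rewrite !inE eqxx.
apply: regularD; last apply: regularN.
  by case: eqP => _; [apply: regular_ratio | apply: regular0].
case: eqP => _; last exact: regular0.
by rewrite mulr1n expr2 -mulf_div; apply: regularM; apply: regular_ratio.
Qed.

Fact omega_trans_id i : omega_trans i i = 1%:M.
Proof.
apply/matrixP=> a b; rewrite !mxE divff ?coord_neq0 //.
by rewrite (negPf (neq_lift i b)) mulr0n subr0 (inj_eq lift_inj).
Qed.

Fact omega_trans_comp i j l :
  omega_trans i j *m omega_trans j l = omega_trans i l.
Proof.
have x0 := @coord_neq0 k n.
apply/matrixP=> a c; rewrite !mxE.
pose F t : K := x l / x j *+ (t == fintype.lift l c)
   - x t * x l / x j ^+ 2 *+ (j == fintype.lift l c).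
under eq_bigr => b _ do rewrite [omega_trans j l b c]mxE -/(F (fintype.lift j b)).
rewrite sum_omega_trans /F; last first.
  by rewrite expr2 -mulf_div divff ?x0 // mul1r subrr.
exact: omega_field_identity2.
Qed.

Definition omega : vbundle k n :=
  VBundle omega_trans_regular omega_trans_id omega_trans_comp.

End Cotangent.

Section TensorBundle.
Variables (k : fieldType) (n : nat) (E F : vbundle k n).

Definition tensor_trans i j := trans E i j *t trans F i j.

Fact tensor_trans_regular i j a b : regular [set i; j] (tensor_trans i j a b).
Proof. by rewrite mxE; apply: regularM; apply: trans_regular. Qed.

Fact tensor_trans_id i : tensor_trans i i = 1%:M.
Proof.
apply/matrixP=> a b; rewrite /tensor_trans !trans_id.
case: (mxtens_indexP a) => a1 a2; case: (mxtens_indexP b) => b1 b2.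
rewrite tensmxE !mxE -natrM mulnb (inj_eq (can_inj (@mxtens_indexK _ _))).
by rewrite -pair_eqE.
Qed.

Fact tensor_trans_comp i j l :
  tensor_trans i j *m tensor_trans j l = tensor_trans i l.
Proof. by rewrite /tensor_trans tensmx_mul !trans_comp. Qed.

Definition tensor_bundle : vbundle k n :=
  VBundle tensor_trans_regular tensor_trans_id tensor_trans_comp.

End TensorBundle.

Section PolynomialFunctors.
Variable k : fieldType.

Definition polynomial_map (A B : vectType k) (f : A -> B) : Prop :=
  exists q : 'I_(dim B) -> {mpoly k[dim A]},
    forall a i, v2r (f a) 0 i = (q i).@[fun j => v2r a 0 j].

Record polyFunctor (d : nat) := PolyFunctor {
  pf_obj :> vectType k -> vectType k;
  pf_map : forall V W : vectType k, 'Hom(V, W) -> 'Hom(pf_obj V, pf_obj W);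
  pf_map_id : forall V : vectType k, pf_map (\1%VF : 'Hom(V, V)) = \1%VF;
  pf_map_comp : forall (U V W : vectType k) (g : 'Hom(V, W)) (f : 'Hom(U, V)),
    pf_map (g \o f)%VF = (pf_map g \o pf_map f)%VF;
  pf_map_polynomial : forall V W, polynomial_map (@pf_map V W);
  pf_map_homothety : forall (V : vectType k) (c : k),
    pf_map (c *: \1%VF : 'Hom(V, V)) = c ^+ d *: \1%VF
}.

End PolynomialFunctors.

Section Apply.
Variables (k : closedFieldType) (d : nat) (P : polyFunctor k d).

Section Matrices.
Variable m : nat.

Definition pf_rank : nat := \dim {: P 'rV[k]_m}.

(* The action of P on endomorphisms of k^m, in coordinates (row vectors). *)
Definition pf_mx (A : 'M[k]_m) : 'M[k]_pf_rank :=
  mxof (vbasis {: P 'rV[k]_m}) (vbasis {: P 'rV[k]_m})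
    (pf_map P (linfun (mulmxr A) : 'Hom('rV[k]_m, 'rV[k]_m))).

Fact pf_mx_polynomial : exists Q : 'M[{mpoly k[m * m]}]_pf_rank,
  forall A, pf_mx A = map_mx (meval (fun t => mxvec A 0 t)) Q.
Proof.
pose V : vectType k := 'rV[k]_m; pose e := vbasis {: P V}.
pose act (u : 'rV[k]_(m * m)) : 'Hom(V, V) := linfun (mulmxr (vec_mx u)).
have act_lin : linear (v2r \o act).
  move=> a u v; rewrite /= -linearP; congr v2r; apply/lfunP=> w.
  by rewrite add_lfunE scale_lfunE !lfunE /= linearP mulmxDr -scalemxAr.
pose actL : {linear 'rV[k]_(m * m) -> 'rV[k]_(dim 'Hom(V, V))} :=
  HB.pack (v2r \o act) (GRing.isLinear.Build _ _ _ _ _ act_lin).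
pose L := lin1_mx actL.
have out_lin : linear (mxvec \o mxof e e \o r2v : 'rV[k]_(dim 'Hom(P V, P V)) -> _).
  by move=> a u v; rewrite /= !linearP.
pose outL : {linear 'rV[k]_(dim 'Hom(P V, P V)) -> 'rV[k]_(pf_rank * pf_rank)} :=
  HB.pack (mxvec \o mxof e e \o r2v : 'rV[k]_(dim 'Hom(P V, P V)) -> _)
    (GRing.isLinear.Build _ _ _ _ _ out_lin).
pose M := lin1_mx outL.
have [q qP] := pf_map_polynomial P V V.
pose arg : (dim 'Hom(V, V)).-tuple {mpoly k[m * m]} :=
  [tuple \sum_t L t j *: 'X_t | j < _].
exists (\matrix_(a, b) \sum_i M i (mxvec_index a b) *: (q i \mPo arg)).
move=> A; apply/matrixP=> a b; rewrite [RHS]mxE [X in meval _ X]mxE -mxvecE.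
rewrite /pf_mx -[pf_map P _]v2rK -[mxvec _]/(outL _) -(mul_rV_lin1 outL) mxE.
rewrite raddf_sum /=.
apply: eq_bigr => i _; rewrite mevalZ mulrC comp_mpoly_meval; congr (_ * _).
rewrite qP; apply: meval_eq => j.
rewrite tnth_mktuple raddf_sum /=.
rewrite -[A in linfun (mulmxr A)]mxvecK -[v2r _]/(actL _) -(mul_rV_lin1 actL) mxE.
by apply: eq_bigr => t _; rewrite mevalZ mevalXU mulrC.
Qed.

Fact pf_mx1 : pf_mx 1%:M = 1%:M.
Proof.
rewrite /pf_mx; have -> : linfun (mulmxr 1%:M) = \1%VF :> 'Hom('rV[k]_m, 'rV[k]_m).
  by apply/lfunP=> u; rewrite lfunE id_lfunE /= mulmx1.
by rewrite pf_map_id mxof1 // (basis_free (vbasisP _)).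
Qed.

Fact pf_mxM A B : pf_mx (A *m B) = pf_mx A *m pf_mx B.
Proof.
rewrite /pf_mx -mxof_comp ?vbasisP // -pf_map_comp; congr (mxof _ _ (pf_map P _)).
by apply/lfunP=> u; rewrite comp_lfunE !lfunE /= mulmxA.
Qed.

Definition pf_mpoly : 'M[{mpoly k[m * m]}]_pf_rank :=
  projT1 (cid pf_mx_polynomial).

(* The extension of pf_mx to matrices over a k-algebra; the polynomials
   pf_mpoly are unique since k is infinite. *)
Definition pf_mx_ext (S : comNzRingType) (f : {rmorphism k -> S})
    (A : 'M[S]_m) : 'M[S]_pf_rank :=
  map_mx (mmap f (fun t => mxvec A 0 t)) pf_mpoly.

Lemma pf_mx_ext_map (S S' : comNzRingType) (f : {rmorphism k -> S})
    (f' : {rmorphism k -> S'}) (g : {rmorphism S -> S'}) A :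
  (forall c, g (f c) = f' c) ->
  map_mx g (pf_mx_ext f A) = pf_mx_ext f' (map_mx g A).
Proof.
move=> gf; apply/matrixP=> a b; rewrite !mxE rmorph_sum /mmap.
apply: eq_bigr => u _; rewrite rmorphM gf; congr (_ * _).
rewrite /mmap1 rmorph_prod; apply: eq_bigr => t _.
by rewrite rmorphXn -map_mxvec [in RHS]mxE.
Qed.

Lemma pf_mx_extE A : pf_mx_ext idfun A = pf_mx A.
Proof. by rewrite (projT2 (cid pf_mx_polynomial)). Qed.

Fact pf_mx_ext1 (S : comNzRingType) (f : {rmorphism k -> S}) :
  pf_mx_ext f 1%:M = 1%:M.
Proof.
rewrite -(map_mx1 f) -(pf_mx_ext_map (f := idfun) (f' := f) (g := f)) //.
by rewrite pf_mx_extE pf_mx1 map_mx1.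
Qed.

Lemma pf_mx_extM_section (S : comNzRingType) (f : {rmorphism k -> S})
    (g : {rmorphism S -> k}) A B : (forall c, g (f c) = c) ->
  map_mx g (pf_mx_ext f (A *m B)) = map_mx g (pf_mx_ext f A *m pf_mx_ext f B).
Proof.
move=> gf; rewrite map_mxM !(pf_mx_ext_map (f' := idfun)) // map_mxM.
by rewrite !pf_mx_extE pf_mxM.
Qed.

Fact pf_mx_extM (S : comNzRingType) (f : {rmorphism k -> S}) A B :
  pf_mx_ext f (A *m B) = pf_mx_ext f A *m pf_mx_ext f B.
Proof.
pose T := {mpoly k[m * m + m * m]}.
pose C : {rmorphism k -> T} := @mpolyC (m * m + m * m) k.
pose X : 'M[T]_m := vec_mx (\row_t 'X_(lshift _ t)).
pose Y : 'M[T]_m := vec_mx (\row_t 'X_(rshift _ t)).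
have XY : pf_mx_ext C (X *m Y) = pf_mx_ext C X *m pf_mx_ext C Y.
  apply/matrixP=> a b; apply: meval_inj => v.
  have := pf_mx_extM_section X Y (mevalC v : forall c, meval v (C c) = c).
  by move/matrixP/(_ a b); rewrite mxE [X in _ = X -> _]mxE.
pose h (t : 'I_(m * m + m * m)) : S := row_mx (mxvec A) (mxvec B) 0 t.
have XA : map_mx (mmap f h) X = A.
  rewrite map_vec_mx -[RHS]mxvecK; congr vec_mx; apply/rowP=> t.
  by rewrite !mxE mmapX mmap1U /h row_mxEl.
have YB : map_mx (mmap f h) Y = B.
  rewrite map_vec_mx -[RHS]mxvecK; congr vec_mx; apply/rowP=> t.
  by rewrite !mxE mmapX mmap1U /h row_mxEr.
have fC c : mmap f h (C c) = f c by rewrite mmapC.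
rewrite -XA -YB -map_mxM -!(pf_mx_ext_map (f := C)) // XY.
by rewrite map_mxM.
Qed.

End Matrices.

Variables (n : nat) (E : vbundle k n).

(* P(E) is glued from the trivial bundles with fibre P(k^r), r the rank of E. *)
Definition pf_trans i j := pf_mx_ext (@ratconst k n) (trans E i j).

Fact pf_trans_regular i j a b : regular [set i; j] (pf_trans i j a b).
Proof.
rewrite mxE; apply: regular_sum => u _; apply: regularM (regular_const _ _) _.
apply: regular_prod => t _; elim: (u t) => [|e IH]; first exact: regular1.
rewrite exprS; apply: regularM IH; case/mxvec_indexP: t => a' b'.
by rewrite mxvecE; apply: trans_regular.
Qed.

Fact pf_trans_id i : pf_trans i i = 1%:M.
Proof. by rewrite /pf_trans trans_id pf_mx_ext1. Qed.

Fact pf_trans_comp i j l : pf_trans i j *m pf_trans j l = pf_trans i l.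
Proof. by rewrite /pf_trans -pf_mx_extM trans_comp. Qed.

Definition pf_bundle : vbundle k n :=
  VBundle pf_trans_regular pf_trans_id pf_trans_comp.

End Apply.

(* Main.v *)
(* In the frames d log (x_t / x_i) the transition matrices of Omega are constant,
   hence so are those of P(Omega), while a torus acts on these frames through
   weights of degree at most d. The Cech complex therefore splits by Z^n-weights.
   When n > d, a nonzero weight has an index at which the corresponding summand
   can be contracted, so that only the summand of weight zero contributes. Its
   term at I is a subspace B(I) of a fixed space k^r, spanned by the weight
   vectors whose support is contained in I. The tensor product of two such
   bundles has B(I) = B1(I) (x) B2(I). The Kunneth formula computes the double
   complex B1(I) (x) B2(K); when n > d + d', it has the same cohomology as the
   double complex B1(I u K) (x) B2(K), because the supports of two weights leave
   out an index along which one can contract. Finally, the columns of the latter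
   are contractible, up to the augmentation B1(K) (x) B2(K). *)
From HB Require Import structures.
Require Import Defs.
From mathcomp Require Import all_boot all_order all_algebra fraction.
From mathcomp Require Import boolp mxtens freeg mpoly zify ring.

Set Implicit Arguments.
Unset Strict Implicit.
Unset Printing Implicit Defensive.

Import GRing.Theory.
Local Open Scope ring_scope.

(** * Alternating cochains and double complexes *)

(** The weight vectors depend on the chart: for [i] in [I] the space B(I) is a sum of members of a
    decomposition of k^r attached to [i], and in general another index of [I] gives another
    decomposition. So no single decomposition is used for the whole Cech complex. In a double
    complex one can fix [i] in [I] and keep its decomposition along the whole row of [I]; the middle
    complex is chosen so that its rows can be compared in this way with those of the product, while
    its columns lead to the diagonal spaces B1(K) (x) B2(K). Cochains are indexed by all subsets,
    with B(set0) = 0. An index of size p + 1 stands for Cech degree p, hence a pair of indices of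
    total size j + 2 for total degree j. No map between the two sides of the theorem is constructed.
    Each comparison moves a finite family of cocycles that is a basis modulo coboundaries, and at
    the end the two sides are seen to have bases of the same size. *)

Definition sgnb (V : zmodType) (b : bool) (x : V) : V := if b then - x else x.

Section Sign.
Variable V : zmodType.

Lemma sgnb0 b : sgnb b (0 : V) = 0.
Proof. by case: b; rewrite /= ?oppr0. Qed.

Lemma sgnbD b : {morph @sgnb V b : x y / x + y}.
Proof. by case: b => x y //=; rewrite opprD. Qed.

Lemma sgnb_sgnb a b (x : V) : sgnb a (sgnb b x) = sgnb (a (+) b) x.
Proof. by case: a b => [] [] //=; rewrite opprK. Qed.

Lemma sgnbK b : involutive (@sgnb V b).
Proof. by move=> x; rewrite sgnb_sgnb addbb. Qed.

Lemma sgnb_sum b (I : Type) (r : seq I) (P : pred I) (F : I -> V) :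
  sgnb b (\sum_(i <- r | P i) F i) = \sum_(i <- r | P i) sgnb b (F i).
Proof. by case: b => //=; rewrite sumrN. Qed.

Lemma sgnb_eq0 b (x : V) : (sgnb b x == 0) = (x == 0).
Proof. by case: b; rewrite /= ?oppr_eq0. Qed.

Lemma sgnb_map (V' : zmodType) (f : {additive V -> V'}) b x :
  f (sgnb b x) = sgnb b (f x).
Proof. by case: b; rewrite /= ?raddfN. Qed.

End Sign.

Lemma sgnbZ (R : nzRingType) (V : lmodType R) b (a : R) (x : V) :
  sgnb b (a *: x) = a *: sgnb b x.
Proof. by case: b; rewrite /= ?scalerN. Qed.

Lemma scaler_signn (R : nzRingType) (V : lmodType R) m (x : V) :
  (-1) ^+ m *: x = sgnb (odd m) x.
Proof. by rewrite -signr_odd scaler_sign. Qed.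

Section Coboundary.
Variables (n : nat) (V : zmodType).
Local Notation cochain := {ffun {set 'I_n} -> V}.
Implicit Types (c : cochain) (I J : {set 'I_n}) (v : 'I_n).

Definition rk (J : {set 'I_n}) (v : 'I_n) := odd #|[set i in J | (i < v)%N]|.

(** The empty set is an admissible index, so this is the differential of the augmented complex;
    vanishing at [set0] is imposed later by the systems of subspaces. [locked] keeps [ffunE] from
    unfolding it. *)
Definition cobd c : cochain :=
  locked [ffun J : {set 'I_n} => \sum_(j in J) sgnb (rk J j) (c (J :\ j))].

(** The cone homotopy with apex [v]. Its value at [J] comes from the larger set [v |: J], so it need
    not respect subspaces that grow with [J]; each later choice of [v] is made so that it does. *)
Definition contraction v c : cochain :=
  [ffun J : {set 'I_n} => if v \in J then 0 else sgnb (rk J v) (c (v |: J))].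

Lemma cobdE c J : cobd c J = \sum_(j in J) sgnb (rk J j) (c (J :\ j)).
Proof. by rewrite /cobd -lock ffunE. Qed.

Lemma rkU J v j : v \notin J -> rk (v |: J) j = (v < j)%N (+) rk J j.
Proof.
move=> vJ; rewrite /rk; case: (boolP (v < j)%N) => vj /=.
  have -> : [set i in v |: J | (i < j)%N] = v |: [set i in J | (i < j)%N].
    by apply/setP=> i; rewrite !inE; case: eqP => // ->.
  by rewrite cardsU1 !inE (negPf vJ).
congr (odd _); apply: eq_card => i; rewrite !inE; case: eqP => // ->.
by rewrite (negPf vj) (negPf vJ).
Qed.

Lemma rk_self J v : rk (v |: J) v = rk J v.
Proof.
congr (odd _); apply: eq_card => i; rewrite !inE.
by case: eqP => // ->; rewrite ltnn !andbF.
Qed.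

Lemma rkD J v j : v \in J -> rk J j = (v < j)%N (+) rk (J :\ v) j.
Proof. by move=> vJ; rewrite -{1}(setD1K vJ) rkU ?setD11. Qed.

Lemma cobdD : {morph cobd : c c' / c + c'}.
Proof.
move=> c c'; apply/ffunP=> J; rewrite [RHS]ffunE !cobdE -big_split /=.
by apply: eq_bigr => j _; rewrite ffunE sgnbD.
Qed.

Lemma cobd0 : cobd 0 = 0.
Proof. by apply: (addrI (cobd 0)); rewrite -cobdD !addr0. Qed.

Lemma cobdN : {morph cobd : c / - c}.
Proof.
by move=> c; apply: (addrI (cobd c)); rewrite -cobdD !subrr cobd0.
Qed.

Lemma cobdB : {morph cobd : c c' / c - c'}.
Proof. by move=> c c'; rewrite cobdD cobdN. Qed.

Lemma cobd_sum (I : Type) (r : seq I) (P : pred I) (F : I -> cochain) :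
  cobd (\sum_(i <- r | P i) F i) = \sum_(i <- r | P i) cobd (F i).
Proof. exact: (big_morph _ cobdD cobd0). Qed.

Lemma cobd_sgnb b c : cobd (sgnb b c) = sgnb b (cobd c).
Proof. by case: b; rewrite /= ?cobdN. Qed.

Lemma cobd_set0 c : cobd c set0 = 0.
Proof. by rewrite cobdE big_set0. Qed.

(** If [J] contains [v], only the face that removes [v] survives. Otherwise the face j = v of the
    second summand gives [c J], and the other terms cancel in pairs: exactly one of v < j and j < v
    holds, so exactly one of the two signs flips. *)
Lemma contractionP v c : cobd (contraction v c) + contraction v (cobd c) = c.
Proof.
apply/ffunP=> J; rewrite !(ffunE, cobdE); have [vJ|vJ] := boolP (v \in J).
  rewrite addr0 (bigD1 v) //= big1 => [|j /andP[jJ jv]].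
    by rewrite addr0 !ffunE setD11 setD1K // sgnb_sgnb (rkD _ vJ) ltnn addbb.
  by rewrite !ffunE in_setD1 eq_sym jv vJ sgnb0.
rewrite [X in _ + sgnb _ X](bigD1 v) ?setU11 //= rk_self setU1K // sgnbD sgnbK.
rewrite addrCA [X in _ + X](_ : _ = 0) ?addr0 //.
rewrite sgnb_sum [X in _ + X](_ : _ = \sum_(i in J) sgnb (rk J v)
    (sgnb (rk (v |: J) i) (c ((v |: J) :\ i)))); last first.
  apply: eq_bigl => j; rewrite !inE.
  by case: (eqVneq j v) => [->|_] /=; rewrite ?andbT ?(negPf vJ).
rewrite -big_split big1 //= => j jJ.
have jv : j != v by apply: contraNneq vJ => <-.
rewrite !ffunE in_setD1 (negPf vJ) andbF !sgnb_sgnb.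
have -> : v |: J :\ j = (v |: J) :\ j.
  apply/setP=> i; rewrite !inE; case: (eqVneq i v) => //= ->.
  by rewrite eq_sym jv.
rewrite rkU // (rkD v jJ); case: (ltngtP v j) => [||/val_inj E] /=.
- by move=> _; case: (rk _ _) (rk _ _) => [] [] /=; rewrite ?addrN ?addNr.
- by move=> _; case: (rk _ _) (rk _ _) => [] [] /=; rewrite ?addrN ?addNr.
- by rewrite E eqxx in jv.
Qed.

Lemma cocycle_contraction v c : cobd c = 0 -> c = cobd (contraction v c).
Proof.
move=> c0; rewrite -{1}(contractionP v c) c0 [contraction v 0](_ : _ = 0) ?addr0 //.
by apply/ffunP=> J; rewrite !ffunE sgnb0 if_same.
Qed.

(* The contraction commutes with the square of the differential, which allows
   an induction on the size of the set at which it is evaluated. *)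
Lemma cobd_cobd c : cobd (cobd c) = 0.
Proof.
have contraction_cobd2 v a : contraction v (cobd (cobd a)) = cobd (cobd (contraction v a)).
  apply: (addrI (cobd (contraction v (cobd a)))); rewrite contractionP.
  by rewrite -cobdD [contraction v _ + _]addrC contractionP.
apply/ffunP=> J; rewrite [RHS]ffunE.
have [m] := ubnP #|J|; elim: m J c => // m IHm J c.
case: (set_0Vmem J) => [-> _|[v vJ]]; first exact: cobd_set0.
rewrite (cardsD1 v) vJ ltnS => Jm; have := IHm (J :\ v) (contraction v c) Jm.
rewrite -contraction_cobd2 ffunE setD11 setD1K // => /eqP.
by rewrite sgnb_eq0 => /eqP.
Qed.

End Coboundary.

(** * Double complexes with acyclic rows or columns *)

Section DoubleComplex.
Variables (n : nat) (V : zmodType).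
Local Notation cochain := {ffun {set 'I_n} -> V}.
Local Notation bicochain := {ffun {set 'I_n} -> {ffun {set 'I_n} -> V}}.
Implicit Types (c b : bicochain) (I J K : {set 'I_n}).

Definition bicobd c : bicochain :=
  locked [ffun I : {set 'I_n} => cobd c I + sgnb (odd #|I|) (cobd (c I))].

Lemma bicobd_row c I : bicobd c I = cobd c I + sgnb (odd #|I|) (cobd (c I)).
Proof. by rewrite /bicobd -lock ffunE. Qed.

Definition column K c : cochain := [ffun I => c I K].

Lemma bicobdE c I K :
  bicobd c I K = cobd (column K c) I + sgnb (odd #|I|) (cobd (c I) K).
Proof.
rewrite bicobd_row ffunE !cobdE; congr (_ + _); last first.
  by case: (odd _); rewrite ?ffunE cobdE.
rewrite sum_ffunE; apply: eq_bigr => i _; rewrite ffunE.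
by case: (rk _ _); rewrite ?ffunE.
Qed.

Lemma bicobdD : {morph bicobd : c c' / c + c'}.
Proof.
move=> c c'; apply/ffunP=> I.
by rewrite [RHS]ffunE !bicobd_row cobdD !ffunE cobdD sgnbD addrACA.
Qed.

Lemma bicobd0 : bicobd 0 = 0.
Proof. by apply: (addrI (bicobd 0)); rewrite -bicobdD !addr0. Qed.

Lemma bicobdB : {morph bicobd : c c' / c - c'}.
Proof.
move=> c c'; rewrite bicobdD; congr (_ + _).
by apply: (addrI (bicobd c')); rewrite -bicobdD !subrr bicobd0.
Qed.

Lemma bicobd_sum (J : Type) (r : seq J) (P : pred J) (F : J -> bicochain) :
  bicobd (\sum_(j <- r | P j) F j) = \sum_(j <- r | P j) bicobd (F j).
Proof. exact: (big_morph _ bicobdD bicobd0). Qed.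

Lemma bicobd_bicobd c : bicobd (bicobd c) = 0.
Proof.
apply/ffunP=> I; rewrite bicobd_row [RHS]ffunE.
have -> : bicobd c = cobd c + [ffun J : {set 'I_n} => sgnb (odd #|J|) (cobd (c J))].
  by apply/ffunP=> J; rewrite bicobd_row !ffunE.
rewrite cobdD cobd_cobd add0r [X in _ + sgnb _ (cobd X)]ffunE cobdD.
rewrite [X in _ + sgnb _ (_ + cobd X)]ffunE cobd_sgnb cobd_cobd sgnb0 addr0.
rewrite !cobdE cobd_sum sgnb_sum -big_split big1 //= => i iI.
rewrite ffunE cobd_sgnb !sgnb_sgnb (cardsD1 i I) iI /=.
by case: (rk _ _) (odd _) => [] [] /=; rewrite ?addrN ?addNr.
Qed.

(* Each row of a bicochain is corrected in turn, by increasing size of its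
   index; the rows of smaller index contribute only correct terms. *)
Lemma rows_acyclic (PY PX : {set 'I_n} -> cochain -> Prop) :
  (forall I, PX I 0) -> (forall I, PY I 0) ->
  (forall I x y, PX I x -> PX I y -> PX I (x - y)) ->
  (forall I x y, PY I x -> PY I y -> PY I (x - y)) ->
  (forall I J x, I \subset J -> PX I x -> PX J x) ->
  (forall I J x, I \subset J -> PY I x -> PY J x) ->
  (forall I x, PY I x -> PY I (cobd x)) ->
  (forall I x, PY I x -> PX I (cobd x) ->
     exists2 y, PY I y & PX I (x - cobd y)) ->
  forall c, (forall I, PY I (c I)) -> (forall I, PX I (bicobd c I)) ->
  exists2 b : bicochain, forall I, PY I (b I) & forall I, PX I ((c - bicobd b) I).
Proof.
move=> PX0 PY0 PXB PYB PXm PYm PYd row.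
have sgnP (P : {set 'I_n} -> cochain -> Prop) I :
    P I 0 -> (forall x y, P I x -> P I y -> P I (x - y)) ->
    forall s x, P I x -> P I (sgnb s x).
  by move=> P0 PB [] x Px //=; rewrite -sub0r; apply: (PB).
have addP (P : {set 'I_n} -> cochain -> Prop) I :
    P I 0 -> (forall x y, P I x -> P I y -> P I (x - y)) ->
    forall x y, P I x -> P I y -> P I (x + y).
  by move=> P0 PB x y Px Py; rewrite -[y]opprK; apply/PB => //; apply: (sgnP _ _ _ _ true).
have cobdP (P : {set 'I_n} -> cochain -> Prop) I (a : bicochain) :
    P I 0 -> (forall x y, P I x -> P I y -> P I (x - y)) ->
    (forall i, i \in I -> P I (a (I :\ i))) -> P I (cobd a I).
  move=> P0 PB Pa; rewrite cobdE; elim/big_ind: _ => //; first exact: (addP).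
  by move=> i iI; apply: (sgnP) => //; apply: Pa.
have step q c : (forall I, PY I (c I)) -> (forall I, PX I (bicobd c I)) ->
    (forall I, (#|I| < q)%N -> PX I (c I)) ->
    exists2 b : bicochain, forall I, PY I (b I) &
      forall I, (#|I| < q.+1)%N -> PX I ((c - bicobd b) I).
  move=> cY dcX cX.
  have /choice[y yP] I : exists y, PY I y /\ (#|I| = q -> PX I (c I - cobd y)).
    have [Iq|Iq] := eqVneq #|I| q; last first.
      by exists 0; split=> // E; rewrite E eqxx in Iq.
    have [||y] := row I (c I) => //; last by exists y.
    rewrite -[cobd _](sgnbK (odd #|I|)); apply: (sgnP) => //; first exact: (PXB I).
    have -> : sgnb (odd #|I|) (cobd (c I)) = bicobd c I - cobd c I.
      by rewrite bicobd_row addrC addKr.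
    apply: (PXB) => //; apply: (cobdP) => //; first exact: (PXB I).
    move=> i iI; apply: (PXm (I :\ i)); first exact: subsetDl.
    by apply: (cX); rewrite -Iq [ltnRHS](cardsD1 i) iI.
  (* The sign undoes the one that [bicobd] puts on row [I]. A bicochain carried by the rows of size
     q affects only rows of size q and q + 1, so the smaller rows stay corrected. *)
  exists [ffun I : {set 'I_n} => if #|I| == q then sgnb (odd #|I|) (y I) else 0] => I.
    rewrite ffunE; case: eqP => // _.
    by apply: (sgnP) => //; [apply: (PYB) | case: (yP I)].
  rewrite ltnS leq_eqVlt => Iq.
  have -> : (c - bicobd [ffun J : {set 'I_n} => if #|J| == q then sgnb (odd #|J|) (y J) else 0]) I
      = c I - (if #|I| == q then cobd (y I) else 0).
    rewrite [LHS]ffunE [X in _ + X]ffunE bicobd_row cobdE big1 => [|i iI].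
      rewrite add0r ffunE; case: eqP => _; rewrite ?cobd0 ?sgnb0 //.
      by rewrite cobd_sgnb sgnbK.
    rewrite ffunE ifF ?sgnb0 //; apply: contraTF Iq => /eqP <-.
    by rewrite negb_or -leqNgt (cardsD1 i I) iI leqnSn neq_ltn ltnSn orbT.
  case: eqP Iq => [/(proj2 (yP I))//|_ /= Iq]; rewrite subr0; exact: (cX).
move=> c cY dcX.
suff [b bY bX] : exists2 b : bicochain, forall I, PY I (b I) &
    forall I, (#|I| < n.+1)%N -> PX I ((c - bicobd b) I).
  by exists b => // I; apply: (bX); rewrite ltnS -[leqRHS](card_ord n) max_card.
elim: n.+1 => [|q [b bY bX]].
  by exists 0 => // I; rewrite ffunE.
have cbY I : PY I ((c - bicobd b) I).
  have -> : (c - bicobd b) I = c I - bicobd b I by rewrite !ffunE.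
  apply: (PYB) => //; rewrite bicobd_row; apply: (addP) => //; first exact: (PYB).
    apply: (cobdP) => //; first exact: (PYB).
    by move=> i iI; apply: PYm (bY _); apply: subsetDl.
  by apply: (sgnP) => //; [apply: (PYB) | apply: (PYd)].
have [||b' b'Y b'X] := step q (c - bicobd b) cbY => //.
  by move=> I; rewrite bicobdB bicobd_bicobd subr0.
exists (b + b') => I.
  by rewrite ffunE; apply: (addP) => //; apply: (PYB).
by move=> Iq; rewrite bicobdD opprD addrA; apply: b'X.
Qed.

(** The columns are corrected by increasing size of [K]. Closure under the signs [odd #|I|] enters
    because [bicobd] twists the differential in the [K] direction by a sign that varies along a
    column. *)
Lemma columns_acyclic (P : {set 'I_n} -> cochain -> Prop) :
  (forall K, P K 0) ->
  (forall K x y, P K x -> P K y -> P K (x - y)) ->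
  (forall K J x, K \subset J -> P K x -> P J x) ->
  (forall K x, P K x -> P K [ffun I : {set 'I_n} => sgnb (odd #|I|) (x I)]) ->
  (forall K x, P K x -> P K (cobd x)) ->
  (forall K x, P K x -> cobd x = 0 -> exists2 y, P K y & x = cobd y) ->
  forall c, (forall K, P K (column K c)) -> bicobd c = 0 ->
  exists2 b : bicochain, forall K, P K (column K b) & c = bicobd b.
Proof.
move=> P0 PB Pm Psg Pd col.
have PN K x : P K x -> P K (- x) by move=> Px; rewrite -sub0r; apply: (PB).
have PD K x y : P K x -> P K y -> P K (x + y).
  by move=> Px Py; rewrite -[y]opprK; apply: (PB) => //; apply: (PN).
have step q c : (forall K, P K (column K c)) -> bicobd c = 0 ->
    (forall K, (#|K| < q)%N -> column K c = 0) ->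
    exists2 b : bicochain, forall K, P K (column K b) &
      forall K, (#|K| < q.+1)%N -> column K (c - bicobd b) = 0.
  move=> cP dc c0.
  have /choice[y yP] K : exists y, P K y /\ (#|K| = q -> column K c = cobd y).
    have [Kq|Kq] := eqVneq #|K| q; last first.
      by exists 0; split=> // E; rewrite E eqxx in Kq.
    have [||y] := col K (column K c) => //; last by exists y.
    apply/ffunP=> I; rewrite [RHS]ffunE.
    have /ffunP/(_ I)/ffunP/(_ K) := dc; rewrite bicobdE !ffunE.
    rewrite [X in sgnb _ X]cobdE big1 ?sgnb0 ?addr0 // => j jK.
    have := c0 (K :\ j); rewrite -Kq [ltnRHS](cardsD1 j) jK => /(_ (ltnSn _)).
    by move/ffunP/(_ I); rewrite !ffunE => ->; rewrite sgnb0.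
  exists [ffun I : {set 'I_n} => [ffun K : {set 'I_n} => if #|K| == q then y K I else 0]] => K.
    rewrite [column _ _](_ : _ = if #|K| == q then y K else 0).
      by case: eqP => // _; case: (yP K).
    by apply/ffunP=> I; rewrite !ffunE; case: eqP; rewrite ?ffunE.
  rewrite ltnS leq_eqVlt => Kq; apply/ffunP=> I; rewrite !ffunE bicobdE.
  rewrite [X in sgnb _ X]cobdE big1 ?sgnb0 ?addr0 => [|j jK]; last first.
    rewrite !ffunE ifF ?sgnb0 //; apply: contraTF Kq => /eqP <-.
    by rewrite negb_or -leqNgt (cardsD1 j K) jK leqnSn neq_ltn ltnSn orbT.
  rewrite [column _ _](_ : _ = if #|K| == q then y K else 0); last first.
    by apply/ffunP=> J; rewrite !ffunE; case: eqP; rewrite ?ffunE.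
  have -> : c I K = column K c I by rewrite ffunE.
  case: eqP Kq => [/(proj2 (yP K)) -> _|_ /= Kq]; first by rewrite subrr.
  by rewrite c0 // cobd0 !ffunE subr0.
move=> c cP dc.
suff [b bP b0] : exists2 b : bicochain, forall K, P K (column K b) &
    forall K, (#|K| < n.+1)%N -> column K (c - bicobd b) = 0.
  exists b => //; apply/eqP; rewrite -subr_eq0; apply/eqP/ffunP=> I.
  apply/ffunP=> K; have /ffunP/(_ I) : column K (c - bicobd b) = 0.
    by apply: b0; rewrite ltnS -[leqRHS](card_ord n) max_card.
  by rewrite ffunE => ->; rewrite !ffunE.
have colD K a a' : column K (a + a') = column K a + column K a'.
  by apply/ffunP=> I; rewrite !ffunE.
have colN K a : column K (- a) = - column K a.
  by apply/ffunP=> I; rewrite !ffunE.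
elim: n.+1 => [|q [b bP b0]].
  by exists 0 => // K; rewrite [column _ _](_ : _ = 0) //; apply/ffunP=> I; rewrite !ffunE.
have cbP K : P K (column K (c - bicobd b)).
  rewrite colD colN; apply: (PB) => //.
  rewrite [column _ _](_ : _ = cobd (column K b) +
      [ffun I : {set 'I_n} => sgnb (odd #|I|)
        ((\sum_(j in K) sgnb (rk K j) (column (K :\ j) b)) I)]).
    apply: (PD); first exact: (Pd).
    apply: (Psg); elim/big_ind: _ => //; first exact: (PD).
    move=> j jK; have Pj : P K (column (K :\ j) b).
      by apply: Pm (bP _); apply: subsetDl.
    by case: (rk _ _) => //=; apply: (PN).
  apply/ffunP=> I; rewrite !ffunE bicobdE; congr (_ + _).
  rewrite cobdE sum_ffunE; congr sgnb.
  by apply: eq_bigr => j _; case: (rk _ _); rewrite !ffunE.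
have [||b' b'P b'0] := step q (c - bicobd b) cbP => //.
  by rewrite bicobdB bicobd_bicobd subr0.
exists (b + b') => K; first by rewrite colD; apply: (PD).
by move=> Kq; rewrite bicobdD opprD addrA; apply: b'0.
Qed.

End DoubleComplex.

(** * Bases of subquotients *)

Section BasisModulo.
Variable k : fieldType.

Definition lin_closed (U : lmodType k) (P : U -> Prop) :=
  P 0 /\ forall a x y, P x -> P y -> P (a *: x + y).

Lemma lin_closedD (U : lmodType k) (P : U -> Prop) x y :
  lin_closed P -> P x -> P y -> P (x + y).
Proof. by move=> [_ PD] Px Py; rewrite -[x]scale1r; apply: PD. Qed.

Lemma lin_closedZ (U : lmodType k) (P : U -> Prop) a x :
  lin_closed P -> P x -> P (a *: x).
Proof. by move=> [P0 PD] Px; rewrite -[_ *: x]addr0; apply: PD. Qed.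

Lemma lin_closedN (U : lmodType k) (P : U -> Prop) x :
  lin_closed P -> P x -> P (- x).
Proof. by move=> PP Px; rewrite -scaleN1r; apply: lin_closedZ. Qed.

Lemma lin_closedB (U : lmodType k) (P : U -> Prop) x y :
  lin_closed P -> P x -> P y -> P (x - y).
Proof. by move=> PP Px Py; apply: lin_closedD => //; apply: lin_closedN. Qed.

Lemma lin_closed_sum (U : lmodType k) (P : U -> Prop) (I : Type) (r : seq I)
    (Q : pred I) (F : I -> U) :
  lin_closed P -> (forall i, Q i -> P (F i)) -> P (\sum_(i <- r | Q i) F i).
Proof.
move=> PP PF; elim/big_ind: _ => //; first by case: PP.
by move=> x y; apply: lin_closedD.
Qed.

(** A basis of Z / B given by representatives, so that bases can be moved between complexes without
    forming quotient modules. *)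
Definition basis_mod (U : lmodType k) (Z B : U -> Prop) (J : finType)
    (z : J -> U) :=
  [/\ forall a, Z (z a),
      forall x, Z x -> exists mu : J -> k, B (x - \sum_a mu a *: z a)
    & forall mu : J -> k, B (\sum_a mu a *: z a) -> forall a, mu a = 0].

Section Transfer.
Variables (U U' : lmodType k) (Z B : U -> Prop) (Z' B' : U' -> Prop).
Variable f : {linear U -> U'}.
Hypotheses (Z_closed : lin_closed Z) (B'_closed : lin_closed B').
Hypothesis f_cocycle : forall x, Z x -> Z' (f x).
Hypothesis f_coboundary : forall x, B x -> B' (f x).
Hypothesis f_surj : forall x', Z' x' -> exists2 x, Z x & B' (x' - f x).
Hypothesis f_inj : forall x, Z x -> B' (f x) -> B x.

(** The hypotheses on [f] say that it induces an isomorphism from Z / B to Z' / B'. *)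
Lemma basis_mod_push (J : finType) (z : J -> U) :
  basis_mod Z B z -> basis_mod Z' B' (f \o z).
Proof.
case=> zZ z_span z_free; split=> [a|x' /f_surj[x Zx Bx]|mu] /=.
- exact/f_cocycle.
- have [mu Bmu] := z_span x Zx; exists mu.
  have <- : (x' - f x) + f (x - \sum_a mu a *: z a) = x' - \sum_a mu a *: f (z a).
    rewrite linearB linear_sum addrA subrK; congr (_ - _).
    by apply: eq_bigr => a _; rewrite linearZ.
  by apply: lin_closedD => //; apply: f_coboundary.
- have <- : f (\sum_a mu a *: z a) = \sum_a mu a *: f (z a).
    by rewrite linear_sum; apply: eq_bigr => a _; rewrite linearZ.
  move=> /f_inj H; apply/z_free/H.
  by apply: lin_closed_sum => // a _; apply: lin_closedZ.
Qed.

(** The inverse direction of the same isomorphism: representatives are lifted one by one, and the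
    errors, which lie in B', are absorbed by its linearity. *)
Lemma basis_mod_pull (J : finType) (z' : J -> U') :
  basis_mod Z' B' z' -> exists z : J -> U, basis_mod Z B z.
Proof.
case=> z'Z z'_span z'_free.
have /choice[z zP] a : exists x, Z x /\ B' (z' a - f x).
  by have [x] := f_surj (z'Z a); exists x.
have fz mu : B' (\sum_a mu a *: z' a - f (\sum_a mu a *: z a)).
  rewrite linear_sum -sumrB; apply: lin_closed_sum => // a _.
  by rewrite linearZ -scalerBr; apply: lin_closedZ => //; case: (zP a).
have zZ mu : Z (\sum_a mu a *: z a).
  by apply: lin_closed_sum => // a _; apply: lin_closedZ => //; case: (zP a).
exists z; split=> [a|x Zx|mu Bmu]; first by case: (zP a).
- have [mu Bmu] := z'_span _ (f_cocycle Zx); exists mu; apply: f_inj.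
    exact: lin_closedB.
  rewrite linearB -[f x](subrK (\sum_a mu a *: z' a)) -addrA.
  by apply: lin_closedD.
- apply: z'_free; rewrite -[\sum_a _](subrK (f (\sum_a mu a *: z a))).
  by apply: lin_closedD => //; apply: f_coboundary.
Qed.

End Transfer.

End BasisModulo.

Section LinearAlgebra.
Variables (k : fieldType) (U : vectType k).
Import VectorInternalTheory.

(** A subspace of maximal dimension among those inside [P] is all of [P], since adding the line of a
    missing vector would enlarge it. *)
Lemma vspace_of_closed (P : U -> Prop) : lin_closed P ->
  exists W : {vspace U}, forall x, x \in W <-> P x.
Proof.
move=> PP; pose Q m := `[< exists2 W : {vspace U}, \dim W = m & forall x, x \in W -> P x >].
have Q0 : exists m, Q m.
  exists 0%N; apply/asboolP; exists 0%VS; first exact: dimv0.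
  by move=> x; rewrite memv0 => /eqP ->; case: PP.
have Qmax m : Q m -> (m <= \dim {:U})%N.
  by case/asboolP => W <- _; apply/dimvS/subvf.
case: (ex_maxnP Q0 Qmax) => m /asboolP[W Wm WP] mmax.
exists W => x; split=> [/WP //|Px].
have /mmax : Q (\dim (W + <[x]>)%VS).
  apply/asboolP; exists (W + <[x]>)%VS => // u /memv_addP[w wW [v /vlineP[a ->] ->]].
  by apply: lin_closedD => //; [apply: WP | apply: lin_closedZ].
rewrite -Wm => le; have : (W == W + <[x]>)%VS by rewrite eqEdim addvSl.
by move/eqP ->; apply/(subvP (addvSr _ _))/memv_line.
Qed.

(** Representatives come from a basis of a complement of B in Z. The functionals are coordinates
    after projection along B, hence are defined on all of [U] and kill B. *)
Lemma basis_mod_exists (Z B : U -> Prop) :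
  lin_closed Z -> lin_closed B -> (forall x, B x -> Z x) ->
  exists m (z : 'I_m -> U) (l : 'I_m -> {linear U -> k^o}),
    [/\ forall a, Z (z a),
        forall a b, l a (z b) = (a == b)%:R,
        forall a x, B x -> l a x = 0
      & forall x, Z x -> B (x - \sum_a l a x *: z a)].
Proof.
move=> /vspace_of_closed[Wz WzP] /vspace_of_closed[Wb WbP] BZ.
have Wbz : (Wb <= Wz)%VS by apply/subvP=> x /WbP/BZ/WzP.
pose H := (Wz :\: Wb)%VS; pose X := vbasis H.
pose l a : {linear U -> k^o} := coord X a \o addv_pi1 Wz Wb.
exists (\dim H), (fun a => X`_a), l.
have lE a x : l a x = coord X a (addv_pi1 Wz Wb x) by [].
have pi12 x : Z x -> addv_pi1 Wz Wb x + addv_pi2 Wz Wb x = x.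
  by move=> Zx; apply: addv_pi1_pi2; apply/(subvP (addvSl _ _))/WzP.
have XH (a : 'I_(\dim H)) : X`_a \in H.
  by apply: vbasis_mem; apply: mem_nth; rewrite size_tuple.
split=> [a|a b|a x Bx|x Zx].
- by apply/WzP/(subvP (diffvSl _ _))/XH.
- rewrite lE [addv_pi1 _ _ _]daddv_pi_id ?capv_diff // coord_free 1?eq_sym //.
  exact/basis_free/vbasisP.
- rewrite lE; have := pi12 x (BZ x Bx); rewrite addv_pi2_id; last exact/WbP.
  by move/(canRL (addrK _)); rewrite subrr => ->; rewrite linear0.
- rewrite (_ : \sum_a l a x *: X`_a = addv_pi1 Wz Wb x); last first.
    by rewrite [RHS](@coord_vbasis _ _ _ H) ?memv_pi.
  by rewrite -{1}(pi12 x Zx) addrC addKr; apply/WbP/memv_pi2.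
Qed.

End LinearAlgebra.

(** * Systems of subspaces with weights of bounded support *)

Lemma ffun_subE (aT : finType) (V : zmodType) (f g : {ffun aT -> V}) x :
  (f - g) x = f x - g x.
Proof. by rewrite !ffunE. Qed.

Section Cocycles.
Variables (k : fieldType) (n : nat) (V : lmodType k).
Variables (B : {set 'I_n} -> V -> Prop) (p : nat).
Implicit Types (c b : {ffun {set 'I_n} -> V}) (I : {set 'I_n}).

(** Here [p] is the size of the index sets, one more than the Cech degree. *)
Definition cocycle c : Prop :=
  [/\ forall I, B I (c I), forall I, #|I| != p -> c I = 0 & cobd c = 0].

Definition coboundary c : Prop := exists b,
  [/\ forall I, B I (b I), forall I, #|I|.+1 != p -> b I = 0 & c = cobd b].

End Cocycles.

Lemma cobdZ (k : fieldType) n (V : lmodType k) a (c : {ffun {set 'I_n} -> V}) :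
  cobd (a *: c) = a *: cobd c.
Proof.
apply/ffunP=> J; rewrite [RHS]ffunE !cobdE scaler_sumr.
by apply: eq_bigr => j _; rewrite ffunE sgnbZ.
Qed.

Lemma cobd_map (n : nat) (V V' : zmodType) (f : {additive V -> V'})
    (c : {ffun {set 'I_n} -> V}) J :
  cobd [ffun I : {set 'I_n} => f (c I)] J = f (cobd c J).
Proof.
rewrite !cobdE raddf_sum; apply: eq_bigr => j _.
by rewrite ffunE sgnb_map.
Qed.

Section CocyclesClosed.
Variables (k : fieldType) (n : nat) (V : lmodType k).
Variables (B : {set 'I_n} -> V -> Prop) (p : nat).
Hypothesis B_closed : forall I, lin_closed (B I).

Lemma cocycle_closed : lin_closed (cocycle B p).
Proof.
split=> [|a x y [xB x0 dx] [yB y0 dy]]; split=> [I|I Ip|].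
- by rewrite ffunE; case: (B_closed I).
- by rewrite ffunE.
- by rewrite cobd0.
- by rewrite !ffunE; case: (B_closed I) => _; apply.
- by rewrite !ffunE x0 // y0 // scaler0 addr0.
- by rewrite cobdD cobdZ dx dy scaler0 addr0.
Qed.

Lemma coboundary_closed : lin_closed (coboundary B p).
Proof.
split=> [|a _ _ [x [xB x0 ->]] [y [yB y0 ->]]].
  exists 0; split=> [I|I Ip|]; rewrite ?ffunE ?cobd0 //.
  by case: (B_closed I).
exists (a *: x + y); split=> [I|I Ip|].
- by rewrite !ffunE; case: (B_closed I) => _; apply.
- by rewrite !ffunE x0 // y0 // scaler0 addr0.
- by rewrite cobdD cobdZ.
Qed.

End CocyclesClosed.

(* A system of subspaces csB I of k^r, such that all the csB I with I containing
   i are sums of members of a single decomposition of k^r, indexed by csW: the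
   member of index w is contained in csB I when csS i w is contained in I. *)
Record csystem (k : fieldType) (n r d : nat) := CSystem {
  csW : finType;
  csE : 'I_n -> csW -> 'M[k]_r;
  csS : 'I_n -> csW -> {set 'I_n};
  csB : {set 'I_n} -> 'rV[k]_r -> Prop;
  csE_orth : forall i w w',
    csE i w *m csE i w' = if w == w' then csE i w else 0;
  csE_sum : forall i, \sum_w csE i w = 1%:M;
  csS_size : forall i w, (#|csS i w| <= d)%N;
  csB_set0 : forall a, csB set0 a <-> a = 0;
  csBP : forall (I : {set 'I_n}) i a, i \in I ->
    csB I a <-> (forall w, ~~ (csS i w \subset I) -> a *m csE i w = 0)
}.

Arguments csE {k n r d}.
Arguments csS {k n r d}.

Section CSystemTheory.
Variables (k : fieldType) (n r d : nat) (B : csystem k n r d).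
Implicit Types I J : {set 'I_n}.

Lemma csB_closed I : lin_closed (csB B I).
Proof.
case: (set_0Vmem I) => [->|[i iI]].
  split=> [|a x y]; rewrite !csB_set0 // => -> ->.
  by rewrite scaler0 addr0.
split=> [|a x y]; rewrite !(csBP _ _ iI); first by move=> w _; rewrite mul0mx.
move=> xB yB w wI.
by rewrite mulmxDl -scalemxAl xB // yB // scaler0 addr0.
Qed.

Lemma csB_mono I J a : I \subset J -> csB B I a -> csB B J a.
Proof.
move=> IJ; case: (set_0Vmem I) => [->|[i iI]].
  by rewrite csB_set0 => ->; case: (csB_closed J).
rewrite !(csBP _ _ (i := i)) ?(subsetP IJ) // => aI w wJ.
by apply/aI/(contra _ wJ) => /subset_trans->.
Qed.

End CSystemTheory.

Lemma sgnb_closed (k : fieldType) (U : lmodType k) (P : U -> Prop) s u :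
  lin_closed P -> P u -> P (sgnb s u).
Proof. by case: s => //= ? ?; apply: lin_closedN. Qed.

Lemma cobd_closed (k : fieldType) n (U : lmodType k) (P : {set 'I_n} -> U -> Prop)
    (y : {ffun {set 'I_n} -> U}) :
  (forall K, lin_closed (P K)) ->
  (forall (J K : {set 'I_n}) u, J \subset K -> P J u -> P K u) ->
  (forall K, P K (y K)) -> forall K, P K (cobd y K).
Proof.
move=> Pc Pm yP K; rewrite cobdE; apply: lin_closed_sum => // j _.
apply: sgnb_closed => //; apply: Pm (yP _); exact: subsetDl.
Qed.

Definition trunc (k : fieldType) n (V : lmodType k) p
    (c : {ffun {set 'I_n} -> V}) : {ffun {set 'I_n} -> V} :=
  [ffun I : {set 'I_n} => if #|I| == p then c I else 0].

Section Trunc.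
Variables (k : fieldType) (n : nat) (V : lmodType k) (p : nat).
Local Notation U := {ffun {set 'I_n} -> V}.

Fact trunc_linear : linear (@trunc k n V p).
Proof.
move=> a x y; apply/ffunP=> I; rewrite !ffunE.
by case: eqP => // _; rewrite scaler0 addr0.
Qed.

HB.instance Definition _ := GRing.isLinear.Build k U U _ (@trunc k n V p)
  trunc_linear.

End Trunc.

Lemma cobd_trunc (k : fieldType) n (V : lmodType k) p
  (c : {ffun {set 'I_n} -> V}) : cobd (trunc p c) = trunc p.+1 (cobd c).
Proof.
apply/ffunP=> I; rewrite ffunE !cobdE; case: eqP => /eqP Ip.
  apply: eq_bigr => i iI; rewrite ffunE ifT //.
  by move: Ip; rewrite (cardsD1 i) iI eqSS.
apply: big1 => i iI; rewrite ffunE ifF ?sgnb0 //; apply/negbTE.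
by move: Ip; rewrite (cardsD1 i) iI eqSS.
Qed.

(** * Cohomology classes of one system, in all degrees at once *)

Section TotalFamily.
Variables (k : fieldType) (n r d : nat) (B : csystem k n r d).
Local Notation U := {ffun {set 'I_n} -> 'rV[k]_r}.

(* Cocycles z whose classes form a basis of the cohomology in all degrees, with
   functionals l on cochains that compute the coordinates of these classes. *)
Record total_family (J : finType) (deg : J -> nat) (z : J -> U)
    (l : J -> {linear U -> k^o}) : Prop := TotalFamily {
  tf_cocycle : forall a, cocycle (csB B) (deg a) (z a);
  tf_dual : forall a b, l a (z b) = (a == b)%:R;
  tf_cobd : forall a (u : U), (forall I, csB B I (u I)) -> l a (cobd u) = 0;
  tf_span : forall u : U, (forall I, csB B I (u I)) -> cobd u = 0 ->
    exists2 v : U, forall I, csB B I (v I) &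
      u - \sum_a l a u *: z a = cobd v;
  tf_deg : forall a (u : U), trunc (deg a) u = 0 -> l a u = 0
}.

Lemma csB_trunc p (u : U) : (forall I, csB B I (u I)) ->
  forall I, csB B I (trunc p u I).
Proof.
move=> uB I; rewrite ffunE; case: eqP => // _; by case: (csB_closed B I).
Qed.

Lemma coboundary_cocycle p c :
  coboundary (csB B) p c -> cocycle (csB B) p c.
Proof.
case=> b [bB b0 ->]; split; last exact: cobd_cobd.
  apply: (cobd_closed (P := csB B)) => //; first exact: csB_closed.
  exact: csB_mono.
move=> I Ip; rewrite cobdE big1 // => i iI; rewrite b0 ?sgnb0 //.
by move: Ip; rewrite (cardsD1 i) iI.
Qed.

Lemma cocycle_trunc p (u : U) : (forall I, csB B I (u I)) -> cobd u = 0 ->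
  cocycle (csB B) p (trunc p u).
Proof.
move=> uB du; split; first exact: csB_trunc.
  by move=> I /negPf Ip; rewrite ffunE Ip.
by rewrite cobd_trunc du linear0.
Qed.

(** Subsets have size at most [n], so the degrees below [m] exhaust the complex as soon as n <= m.
    Both parts share the numbers [h p]: the first ties them to the cohomology in each single degree,
    the second feeds them to the Kunneth formula. *)
Lemma total_family_exists : exists h : nat -> nat,
  (forall p, exists z : 'I_(h p) -> U,
    basis_mod (cocycle (csB B) p.+1) (coboundary (csB B) p.+1) z) /\
  forall m, (n <= m)%N -> exists z l,
    @total_family {p : 'I_m & 'I_(h p)} (fun s => (tag s).+1) z l.
Proof.
have B_closed := csB_closed B.
have /choice[f fP] p : exists s : {m : nat & (('I_m -> U) * ('I_m -> {linear U -> k^o}))%type},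
    [/\ forall a, cocycle (csB B) p.+1 ((tagged s).1 a),
        forall a b, (tagged s).2 a ((tagged s).1 b) = (a == b)%:R,
        forall a x, coboundary (csB B) p.+1 x -> (tagged s).2 a x = 0
      & forall x, cocycle (csB B) p.+1 x ->
        coboundary (csB B) p.+1 (x - \sum_a (tagged s).2 a x *: (tagged s).1 a)].
  have [] := @basis_mod_exists k U (cocycle (csB B) p.+1) (coboundary (csB B) p.+1).
  - exact: cocycle_closed.
  - exact: coboundary_closed.
  - exact: coboundary_cocycle.
  move=> m [z [l H]].
  by exists (Tagged (fun m : nat => ('I_m -> U) * ('I_m -> {linear U -> k^o}))%type (z, l)).
exists (fun p => tag (f p)); split=> [p|m nm].
  have [zZ zl lB zS] := fP p; exists (tagged (f p)).1; split=> // [x Zx|mu Bmu a].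
    by exists (fun a => (tagged (f p)).2 a x); apply: zS.
  have := lB a _ Bmu; rewrite linear_sum (bigD1 a) //= linearZ /= zl eqxx.
  rewrite big1 ?addr0 => [|b ba]; last first.
    by rewrite linearZ /= zl eq_sym (negPf ba) scaler0.
  by rewrite /GRing.scale /= mulr1.
pose J := {p : 'I_m & 'I_(tag (f p))}.
pose z (s : J) : U := (tagged (f (tag s))).1 (tagged s).
(* Truncating first makes a functional blind to the other degrees; this gives duality between
   classes of different degrees. *)
pose l (s : J) : {linear U -> k^o} :=
  (tagged (f (tag s))).2 (tagged s) \o @trunc k n _ (tag s).+1.
have lE s u : l s u = (tagged (f (tag s))).2 (tagged s) (trunc (tag s).+1 u) by [].
have trunc_z q (s : J) : trunc q (z s) = if q == (tag s).+1 then z s else 0.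
  have [/(_ (tagged s)) [_ z0 _] _ _ _] := fP (tag s).
  case: (eqVneq q (tag s).+1) => [->|qs]; apply/ffunP=> I; rewrite ffunE.
    by case: eqP => // /eqP Iq; rewrite z0.
  by rewrite [RHS]ffunE; case: eqP => // Iq; rewrite z0 // Iq.
exists z, l; split.
- by move=> s; have [zZ _ _ _] := fP (tag s); apply: zZ.
- move=> s s'; rewrite lE trunc_z; have [_ zl _ _] := fP (tag s).
  case: s zl s' => p a zl [p' b] /=; case: eqP => [[E]|ne]; last first.
    rewrite linear0; case: eqP => // E; case: ne.
    by have /= -> := congr1 tag E.
  have {}E : p = p' by apply: val_inj.
  by subst p'; rewrite zl eq_Tagged.
- move=> s u uB; rewrite lE; have [_ _ lB _] := fP (tag s); apply: lB.
  exists (trunc (tag s) u); split; first exact: csB_trunc.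
    by move=> I /negPf; rewrite eqSS ffunE => ->.
  by rewrite cobd_trunc.
- move=> u uB du.
  have /choice[v vP] (p : 'I_m) : exists v : U, (forall I, csB B I (v I)) /\
      trunc p.+1 u - \sum_a (tagged (f p)).2 a (trunc p.+1 u) *: (tagged (f p)).1 a
      = cobd v.
    have [_ _ _ /(_ _ (cocycle_trunc p.+1 uB du))[v [vB _ vE]]] := fP p.
    by exists v.
  exists (\sum_p v p) => [I|].
    rewrite sum_ffunE; apply: lin_closed_sum => // p _.
    by case: (vP p) => /(_ I).
  rewrite cobd_sum; under [RHS]eq_bigr do rewrite -(proj2 (vP _)).
  rewrite sumrB sig_big_dep /=; congr (_ - _); apply/ffunP=> I; rewrite sum_ffunE.
  (* At [set0] both sides vanish: the truncations start at size 1, and [u] takes its value there in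
     [csB B set0], which is zero. *)
  case: (set_0Vmem I) => [->|[i iI]].
    rewrite big1 => [|p _]; last by rewrite ffunE cards0.
    exact/(csB_set0 B)/uB.
  have Im : (#|I|.-1 < m)%N.
    apply: leq_trans nm; rewrite prednK; last by apply/card_gt0P; exists i.
    by rewrite -[leqRHS](card_ord n) max_card.
  have I0 : (0 < #|I|)%N by apply/card_gt0P; exists i.
  rewrite (bigD1 (Ordinal Im)) //= ffunE prednK // eqxx big1 ?addr0 // => p pI.
  rewrite ffunE ifF //; apply: contraNF pI => /eqP Ip.
  by apply/eqP/val_inj; rewrite /= Ip.
- by move=> s u u0; rewrite lE u0 linear0.
Qed.

End TotalFamily.

(** * Two systems: the product, the middle and the diagonal complex *)

Section TwoSystems.
Variables (k : fieldType) (n r1 r2 d1 d2 : nat).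
Variables (B1 : csystem k n r1 d1) (B2 : csystem k n r2 d2).
Hypothesis n_big : (d1 + d2 < n)%N.
Local Notation M := 'M[k]_(r1, r2).
Local Notation cochain := {ffun {set 'I_n} -> M}.
Local Notation bicochain := {ffun {set 'I_n} -> cochain}.
Implicit Types (I J K : {set 'I_n}) (t : M) (x : cochain) (c : bicochain).

Definition cols_in I t := forall j, csB B1 I (col j t)^T.
Definition rows_in K t := forall i, csB B2 K (row i t).

Lemma cols_inP I i t : i \in I -> cols_in I t <->
  (forall w, ~~ (csS B1 i w \subset I) -> (csE B1 i w)^T *m t = 0).
Proof.
move=> iI; split=> [tI w wI|tI j].
  apply/matrixP=> a j; have /(csBP _ _ iI)/(_ w wI) := tI j.
  move/(congr1 (fun u : 'rV_r1 => u 0 a)); rewrite !mxE => H; rewrite -[RHS]H.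
  by apply: eq_bigr => b _; rewrite !mxE mulrC.
apply/(csBP _ _ iI) => w wI; apply: trmx_inj; rewrite trmx_mul trmxK.
by rewrite colE mulmxA tI // mul0mx trmx0.
Qed.

Lemma rows_inP K i t : i \in K -> rows_in K t <->
  (forall w, ~~ (csS B2 i w \subset K) -> t *m csE B2 i w = 0).
Proof.
move=> iK; split=> [tK w wK|tK j].
  apply/row_matrixP=> a; rewrite row0 row_mul.
  by have /(csBP _ _ iK) -> := tK a.
by apply/(csBP _ _ iK) => w wK; rewrite -row_mul tK // row0.
Qed.

Lemma cols_in_closed I : lin_closed (cols_in I).
Proof.
split=> [j|a x y xI yI j].
  by rewrite [_^T](_ : _ = 0); [case: (csB_closed B1 I) | apply/rowP=> ?; rewrite !mxE].
rewrite !linearP; case: (csB_closed B1 I) => _; apply; [exact: xI | exact: yI].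
Qed.

Lemma rows_in_closed K : lin_closed (rows_in K).
Proof.
split=> [j|a x y xK yK j].
  by rewrite row0; case: (csB_closed B2 K).
rewrite !linearP; case: (csB_closed B2 K) => _; apply; [exact: xK | exact: yK].
Qed.

Lemma cols_in_mono I J t : I \subset J -> cols_in I t -> cols_in J t.
Proof. by move=> IJ tI j; apply: csB_mono IJ _. Qed.

Lemma rows_in_mono I J t : I \subset J -> rows_in I t -> rows_in J t.
Proof. by move=> IJ tI j; apply: csB_mono IJ _. Qed.

Lemma cols_in_set0 t : cols_in set0 t -> t = 0.
Proof.
move=> t0; apply/matrixP=> a j; have /(csB_set0 B1)/rowP/(_ a) := t0 j.
by rewrite !mxE.
Qed.

Lemma rows_in_set0 t : rows_in set0 t -> t = 0.
Proof.
by move=> t0; apply/row_matrixP=> a; rewrite row0; apply/(csB_set0 B2)/t0.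
Qed.

(* An element of k^r1 (x) k^r2 is a matrix t; B1(I) (x) B2(K) consists of the t with
   cols_in I t and rows_in K t. Row I of the double complex B1(I) (x) B2(K) is
   prod_row, that of B1(I u K) (x) B2(K) is mid_row. The row of index set0 is the
   augmentation, which is discarded in mid_row'. *)
Definition prod_row I x := forall K, cols_in I (x K) /\ rows_in K (x K).

Definition mid_row I x := forall K, cols_in (I :|: K) (x K) /\ rows_in K (x K).

Definition mid_row' I x := (I = set0 -> x = 0) /\ mid_row I x.

Definition tens_in K t := cols_in K t /\ rows_in K t.

Lemma rows_in_mull K t (A : 'M_r1) : rows_in K t -> rows_in K (A *m t).
Proof.
case: (set_0Vmem K) => [->|[i iK]].
  by move/rows_in_set0 ->; rewrite mulmx0; case: (rows_in_closed set0).
by rewrite !(rows_inP _ iK) => tK w wK; rewrite -mulmxA tK // mulmx0.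
Qed.

Lemma prod_row_closed I : lin_closed (prod_row I).
Proof.
have [c0 cD] := cols_in_closed I.
split=> [K|a x y xI yI K]; have [r0 rD] := rows_in_closed K.
  by rewrite ffunE.
by rewrite !ffunE; have [? ?] := xI K; have [? ?] := yI K; split; auto.
Qed.

Lemma mid_row_closed I : lin_closed (mid_row I).
Proof.
split=> [K|a x y xI yI K]; have [c0 cD] := cols_in_closed (I :|: K);
  have [r0 rD] := rows_in_closed K.
  by rewrite ffunE.
by rewrite !ffunE; have [? ?] := xI K; have [? ?] := yI K; split; auto.
Qed.

Lemma mid_row'_closed I : lin_closed (mid_row' I).
Proof.
have [m0 mD] := mid_row_closed I.
split=> [|a x y [x0 xI] [y0 yI]]; split; auto.
by move=> I0; rewrite x0 // y0 // scaler0 addr0.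
Qed.

Lemma prod_row_mono I J x : I \subset J -> prod_row I x -> prod_row J x.
Proof.
move=> IJ xI K; have [xc xr] := xI K; split=> //.
exact: cols_in_mono xc.
Qed.

Lemma mid_row_mono I J x : I \subset J -> mid_row I x -> mid_row J x.
Proof.
move=> IJ xI K; have [xc xr] := xI K; split=> //.
by apply: cols_in_mono xc; apply: setSU.
Qed.

Lemma mid_row'_mono I J x : I \subset J -> mid_row' I x -> mid_row' J x.
Proof.
move=> IJ [x0 xI]; split; last exact: mid_row_mono xI.
by move=> J0; apply: x0; apply/eqP; rewrite -subset0 -J0.
Qed.

Lemma mid_row_cobd I x : mid_row I x -> mid_row I (cobd x).
Proof.
pose P K t := cols_in (I :|: K) t /\ rows_in K t.
move=> xI; apply: (@cobd_closed _ _ M P) => // [K|J K t JK [tc tr]].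
  have [c0 cD] := cols_in_closed (I :|: K); have [r0 rD] := rows_in_closed K.
  by split=> [|a u v [? ?] [? ?]]; split; auto.
by split; [apply: cols_in_mono tc; apply: setUS | apply: rows_in_mono tr].
Qed.

Lemma mid_row'_cobd I x : mid_row' I x -> mid_row' I (cobd x).
Proof.
by case=> x0 /mid_row_cobd xI; split=> // /x0 ->; rewrite cobd0.
Qed.

(* The vector x is decomposed by weights w of B1 at some i in I. If the support of
   w is contained in I there is nothing to do. Otherwise a further decomposition
   by the weights of B2 at an index t of the support outside I gives pieces that
   can be contracted along any v outside the supports of both weights. *)
Lemma mid_row'_acyclic I x : mid_row' I x -> prod_row I (cobd x) ->
  exists2 y, mid_row' I y & prod_row I (x - cobd y).
Proof.
case: (set_0Vmem I) => [->|[i iI]] [x0 xI] dxI.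
  exists 0; first by case: (mid_row'_closed set0).
  by rewrite x0 // cobd0 subr0; case: (prod_row_closed set0).
have I0 : I = set0 -> False by move=> I0; rewrite I0 inE in iI.
pose lw w (z : cochain) : cochain :=
  [ffun K : {set 'I_n} => (csE B1 i w)^T *m z K].
have sum_lw : x = \sum_w lw w x.
  apply/ffunP=> K; rewrite sum_ffunE.
  under eq_bigr do rewrite ffunE.
  rewrite -mulmx_suml -[x K in LHS]mul1mx -trmx1 -(csE_sum B1 i).
  by rewrite raddf_sum.
suff /choice[y yP] w : exists y, mid_row' I y /\ prod_row I (lw w x - cobd y).
  exists (\sum_w y w).
    apply: lin_closed_sum => [|w _]; first exact: mid_row'_closed.
    by case: (yP w).
  rewrite cobd_sum sum_lw -sumrB.
  apply: lin_closed_sum => [|w _]; first exact: prod_row_closed.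
  by case: (yP w).
have lwE w' K : (csE B1 i w')^T *m lw w x K = if w == w' then lw w x K else 0.
  rewrite ffunE mulmxA -trmx_mul csE_orth.
  by case: eqP => _ //; rewrite trmx0 mul0mx.
have [wI|/subsetPn[t tw tI]] := boolP (csS B1 i w \subset I).
  exists 0; split; first by case: (mid_row'_closed I).
  rewrite cobd0 subr0 => K; split; last first.
    by rewrite ffunE; apply: rows_in_mull; case: (xI K).
  apply/(cols_inP _ iI) => w' w'I; rewrite lwE.
  by case: eqP w'I => // <-; rewrite wI.
have lw0 K : ~~ (csS B1 i w \subset I :|: K) -> lw w x K = 0.
  move=> wK; have [xc _] := xI K; rewrite ffunE.
  by have /(cols_inP _ (i := i)) -> := xc; rewrite ?inE ?iI.
(* By hypothesis [cobd x] has its columns in B1(I), which has no component of weight [w], as the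
   support of [w] is not inside [I]. *)
have dlw : cobd (lw w x) = 0.
  apply/ffunP=> K; rewrite (cobd_map (mulmx (csE B1 i w)^T)) [RHS]ffunE.
  have [dxc _] := dxI K; apply: (proj1 (cols_inP _ iI) dxc).
  by apply/subsetPn; exists t.
(* Since [t] is in the support of [w] but not in [I], it lies in every [K] where [lw w x K] is
   nonzero; there the row condition is described by the decomposition of [B2] at [t]. *)
pose lrw w' : cochain := [ffun K : {set 'I_n} => lw w x K *m csE B2 t w'].
suff /choice[y yP] w' : exists y, mid_row' I y /\ lrw w' = cobd y.
  exists (\sum_w' y w'); split.
    apply: lin_closed_sum => [|w' _]; first exact: mid_row'_closed.
    by case: (yP w').
  rewrite (_ : lw w x = \sum_w' lrw w').
    rewrite cobd_sum -sumrB big1 => [|w' _]; first by case: (prod_row_closed I).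
    by case: (yP w') => _ ->; rewrite subrr.
  apply/ffunP=> K; rewrite sum_ffunE.
  under eq_bigr do rewrite ffunE.
  by rewrite -mulmx_sumr csE_sum mulmx1.
(* The piece of weights [w] and [w'] is carried by the [K] that contain [S]. As [v] is not in [S],
   the sets [K] and [v |: K] contain [S] simultaneously, so the contraction along [v] stays in the
   row. *)
pose S := (csS B1 i w :\: I) :|: csS B2 t w'.
have [v vS] : exists v, v \notin S.
  apply/existsP; rewrite -negb_forall; apply: contraTN n_big => /forallP Sall.
  have := cardsU (csS B1 i w :\: I) (csS B2 t w').
  have := csS_size i w; have := csS_size t w'.
  have := subset_leq_card (subsetDl (csS B1 i w) I).
  have : n = #|S| by rewrite -[LHS]card_ord; apply: eq_card => u; rewrite (Sall u).
  by rewrite /S; lia.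
exists (contraction v (lrw w')); split; last first.
  apply: cocycle_contraction; apply/ffunP=> K.
  by rewrite (cobd_map (mulmxr (csE B2 t w'))) /= dlw !ffunE mul0mx.
split=> // K.
rewrite ffunE; case: ifP => vK.
  have [c0 _] := cols_in_closed (I :|: K); have [r0 _] := rows_in_closed K.
  by split.
have [SK|SK] := boolP (S \subset K); last first.
  rewrite (_ : lrw w' (v |: K) = 0) ?sgnb0.
    have [c0 _] := cols_in_closed (I :|: K); have [r0 _] := rows_in_closed K.
    by split.
  have {}SK : ~~ (S \subset v |: K).
    apply: contra SK => SvK; apply/subsetP=> u uS.
    by have := subsetP SvK u uS; rewrite !inE; case: eqP => // uv; rewrite -uv uS in vS.
  rewrite ffunE; have [wK|wK] := boolP (csS B1 i w \subset I :|: (v |: K)); last first.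
    by rewrite lw0 // mul0mx.
  have tK : t \in v |: K by have := subsetP wK t tw; rewrite inE (negPf tI).
  have [_ xr] := xI (v |: K); have H := proj1 (rows_inP _ tK) (rows_in_mull (csE B1 i w)^T xr) w'.
  rewrite [lw _ _ _]ffunE; apply: H.
  apply: contra SK => w'K; rewrite subUset w'K andbT.
  by rewrite subDset.
have [wIK w'K] : csS B1 i w \subset I :|: K /\ csS B2 t w' \subset K.
  by move: SK; rewrite subUset subDset => /andP[].
have tK : t \in K by have := subsetP wIK t tw; rewrite inE (negPf tI).
split; [apply: (sgnb_closed (P := cols_in _)) | apply: (sgnb_closed (P := rows_in _))].
- exact: cols_in_closed.
- apply/(cols_inP _ (i := i)); first by rewrite inE iI.
  move=> w'' w''K; rewrite ffunE mulmxA lwE; case: eqP => [E|_]; last by rewrite mul0mx.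
  by rewrite -E wIK in w''K.
- exact: rows_in_closed.
- apply/(rows_inP _ tK) => w'' w''K; rewrite ffunE -mulmxA csE_orth.
  by case: eqP w''K => [<-|_ _]; rewrite ?w'K ?mulmx0.
Qed.

Section Bicocycles.
Variables (B : {set 'I_n} -> cochain -> Prop) (p : nat).

(** Here [p] is the total size of the two indices, two more than the total degree. *)
Definition bicocycle c : Prop :=
  [/\ forall I, B I (c I),
      forall I K, (#|I| + #|K|)%N != p -> c I K = 0
    & bicobd c = 0].

Definition bicoboundary c : Prop := exists b : bicochain,
  [/\ forall I, B I (b I),
      forall I K, (#|I| + #|K|).+1 != p -> b I K = 0
    & c = bicobd b].

Definition bitrunc q c : bicochain := [ffun I : {set 'I_n} =>
  [ffun K : {set 'I_n} => if (#|I| + #|K|)%N == q then c I K else 0]].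

Lemma bicobd_bitrunc q c I K : bicobd (bitrunc q c) I K =
  if (#|I| + #|K|)%N == q.+1 then bicobd c I K else 0.
Proof.
have cardS (l : 'I_n) (L : {set 'I_n}) : l \in L -> #|L| = #|L :\ l|.+1.
  by move=> lL; rewrite (cardsD1 l) lL.
rewrite !bicobdE !cobdE; case: eqP => /eqP IKq.
  congr (_ + sgnb _ _); apply: eq_bigr => l lL; rewrite !ffunE ifT //;
    by move: IKq; rewrite (cardS _ _ lL) ?addSn ?addnS eqSS.
by rewrite !big1 ?sgnb0 ?addr0 // => l lL; rewrite !ffunE ifF ?sgnb0 //;
  apply/negbTE; move: IKq; rewrite (cardS _ _ lL) ?addSn ?addnS eqSS.
Qed.

Lemma bitrunc_closed q c : (forall I, lin_closed (B I)) ->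
  (forall I x (P : pred {set 'I_n}), B I x ->
    B I [ffun K : {set 'I_n} => if P K then x K else 0]) ->
  (forall I, B I (c I)) -> forall I, B I (bitrunc q c I).
Proof.
move=> Bc Bt cB I; rewrite ffunE.
exact: (Bt I (c I) (fun K : {set 'I_n} => (#|I| + #|K|)%N == q)).
Qed.

Lemma bicocycle_closed :
  (forall I, lin_closed (B I)) -> lin_closed bicocycle.
Proof.
move=> B_closed.
split=> [|a x y [xB x0 dx] [yB y0 dy]]; split=> [I|I K Ip|].
- by rewrite ffunE; case: (B_closed I).
- by rewrite !ffunE.
- by rewrite bicobd0.
- by rewrite !ffunE; case: (B_closed I) => _; apply.
- by rewrite !ffunE x0 // y0 // scaler0 addr0.
- have bicobdZ : bicobd (a *: x) = a *: bicobd x.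
    apply/ffunP=> I; rewrite [RHS]ffunE !bicobd_row cobdZ !ffunE cobdZ.
    by rewrite scalerDr sgnbZ.
  by rewrite bicobdD bicobdZ dx dy scaler0 addr0.
Qed.

Lemma bicoboundary_closed :
  (forall I, lin_closed (B I)) -> lin_closed bicoboundary.
Proof.
move=> B_closed; split=> [|a _ _ [x [xB x0 ->]] [y [yB y0 ->]]].
  exists 0; split=> [I|I K Ip|]; rewrite ?ffunE ?bicobd0 // ?ffunE //.
  by case: (B_closed I).
exists (a *: x + y); split=> [I|I K Ip|].
- by rewrite !ffunE; case: (B_closed I) => _; apply.
- by rewrite !ffunE x0 // y0 // scaler0 addr0.
- rewrite bicobdD; congr (_ + _); apply/ffunP=> I.
  by rewrite [LHS]ffunE !bicobd_row cobdZ !ffunE cobdZ scalerDr sgnbZ.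
Qed.

End Bicocycles.

Lemma mid_row'_filter I x (P : pred {set 'I_n}) : mid_row' I x ->
  mid_row' I [ffun K : {set 'I_n} => if P K then x K else 0].
Proof.
case=> x0 xI; split=> [I0|K].
  by apply/ffunP=> K; rewrite !ffunE x0 // ffunE if_same.
rewrite ffunE; case: (P K) => //.
by have [m0 _] := mid_row_closed I; have := m0 K; rewrite ffunE.
Qed.

Lemma prod_row_filter I x (P : pred {set 'I_n}) : prod_row I x ->
  prod_row I [ffun K : {set 'I_n} => if P K then x K else 0].
Proof.
move=> xI K; rewrite ffunE; case: (P K) => //.
by have [m0 _] := prod_row_closed I; have := m0 K; rewrite ffunE.
Qed.

Lemma prod_mid_row' I x : prod_row I x -> mid_row' I x.
Proof.
move=> xI; split=> [I0|K]; last first.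
  by have [xc xr] := xI K; split=> //; apply: cols_in_mono xc; apply: subsetUl.
apply/ffunP=> K; rewrite [RHS]ffunE; have [xc _] := xI K.
by apply: cols_in_set0; rewrite -I0.
Qed.

(** The quotient of the middle complex by the product complex has acyclic rows, by
    [mid_row'_acyclic]. *)
Lemma mid_prod_rel_acyclic c : (forall I, mid_row' I (c I)) ->
  (forall I, prod_row I (bicobd c I)) ->
  exists2 b : bicochain, forall I, mid_row' I (b I) &
    forall I, prod_row I ((c - bicobd b) I).
Proof.
apply: rows_acyclic => [I|I|I x y|I x y|I J x|I J x|I x|I x].
- by case: (prod_row_closed I).
- by case: (mid_row'_closed I).
- exact: (lin_closedB (prod_row_closed I)).
- exact: (lin_closedB (mid_row'_closed I)).
- exact: prod_row_mono.
- exact: mid_row'_mono.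
- exact: mid_row'_cobd.
- exact: mid_row'_acyclic.
Qed.

(** The long exact sequence of the inclusion, done by hand: relative acyclicity corrects a cocycle,
    or a primitive, into the product complex. The correction may spread over all total degrees, and
    [bitrunc] keeps the part that matters. *)
Lemma basis_mod_prod_mid q (J : finType) (z : J -> bicochain) :
  basis_mod (bicocycle prod_row q.+1) (bicoboundary prod_row q.+1) z ->
  basis_mod (bicocycle mid_row' q.+1) (bicoboundary mid_row' q.+1) z.
Proof.
apply: (basis_mod_push (f := idfun)) => [|||||] /=.
- by apply: bicocycle_closed => I; apply: prod_row_closed.
- by apply: bicoboundary_closed => I; apply: mid_row'_closed.
- by move=> c [cB c0 dc]; split=> // I; apply: prod_mid_row'.
- by move=> _ [b [bB b0 ->]]; exists b; split=> // I; apply: prod_mid_row'.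
- move=> c [cB c0 dc]; have [|b bB cbB] := mid_prod_rel_acyclic cB.
    by move=> I; rewrite dc ffunE; case: (prod_row_closed I).
  have btB : forall I, mid_row' I (bitrunc q b I).
    apply: (bitrunc_closed (B := mid_row')) => // I; first exact: mid_row'_closed.
    exact: mid_row'_filter.
  exists (c - bicobd (bitrunc q b)).
    split=> [I|I K IK|]; last by rewrite bicobdB bicobd_bicobd subr0.
      have -> : (c - bicobd (bitrunc q b)) I = bitrunc q.+1 (c - bicobd b) I.
        apply/ffunP=> K; rewrite !ffunE bicobd_bitrunc; case: eqP => // /eqP IK.
        by rewrite subr0 c0.
      apply: (bitrunc_closed (B := prod_row)) => // J'; first exact: prod_row_closed.
      exact: prod_row_filter.
    by rewrite !ffunE bicobd_bitrunc (negPf IK) subr0 c0.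
  exists (bitrunc q b); split=> // [I K|]; last by rewrite opprB addrC subrK.
  by rewrite eqSS !ffunE => /negPf ->.
- move=> c [cB c0 _] [b [bB b0 cE]]; rewrite cE in cB c0 *.
  have [b' b'B bb'B] := mid_prod_rel_acyclic bB cB.
  exists (bitrunc q (b - bicobd b')); split.
  + apply: (bitrunc_closed (B := prod_row)) => // I; first exact: prod_row_closed.
    exact: prod_row_filter.
  + by move=> I K; rewrite eqSS !ffunE => /negPf ->.
  + apply/ffunP=> I; apply/ffunP=> K; rewrite bicobd_bitrunc.
    case: eqP => [_|/eqP/c0 //]; by rewrite bicobdB bicobd_bicobd subr0.
Qed.

(** [first_row c] sits in the augmentation row of index [set0], and [edge c] is its image in the
    rows indexed by singletons. *)
Definition first_row (c : cochain) : bicochain :=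
  [ffun I : {set 'I_n} => if I == set0 then c else 0].

Definition edge (c : cochain) : bicochain :=
  [ffun I : {set 'I_n} => if #|I| == 1%N then c else 0].

(** A second application of [bicobd] shows that [edge] anticommutes with the differentials; hence
    the minus sign when [edge] is applied to coboundaries below. *)
Lemma bicobd_first_row (c : cochain) : bicobd (first_row c) = edge c + first_row (cobd c).
Proof.
apply/ffunP=> I; rewrite bicobd_row !ffunE; congr (_ + _); last first.
  by case: eqP => [->|]; rewrite ?cards0 ?cobd0 ?sgnb0.
rewrite cobdE; have [I1|I1] := boolP (#|I| == 1%N).
  have /cards1P[i ->] := I1; rewrite big_set1 !ffunE setDv eqxx.
  rewrite /rk (_ : [set j in [set i] | (j < i)%N] = set0) ?cards0 //.
  by apply/setP=> j; rewrite !inE; case: eqP => // ->; rewrite ltnn.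
rewrite big1 // => i iI; rewrite ffunE ifF ?sgnb0 //; apply: contraNF I1 => /eqP I0.
by rewrite (cardsD1 i) iI I0 cards0.
Qed.

Fact edge_linear : linear edge.
Proof.
move=> a x y; apply/ffunP=> I; rewrite !ffunE.
by case: eqP => // _; rewrite scaler0 addr0.
Qed.

HB.instance Definition _ := GRing.isLinear.Build k cochain bicochain _ edge
  edge_linear.

Fact first_row_linear : linear first_row.
Proof.
move=> a x y; apply/ffunP=> I; rewrite !ffunE.
by case: eqP => // _; rewrite scaler0 addr0.
Qed.

HB.instance Definition _ := GRing.isLinear.Build k cochain bicochain _ first_row
  first_row_linear.

Lemma mid_row_edge (c : cochain) : (forall K, tens_in K (c K)) -> forall I, mid_row' I (edge c I).
Proof.
move=> cT I; rewrite ffunE; case: eqP => I1; last by case: (mid_row'_closed I).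
split=> [I0|K]; first by rewrite I0 cards0 in I1.
by have [cc cr] := cT K; split=> //; apply: cols_in_mono cc; apply: subsetUr.
Qed.

Definition mid_column K x := forall I, cols_in (I :|: K) (x I) /\ rows_in K (x I).

Lemma mid_column_closed K : lin_closed (mid_column K).
Proof.
have [r0 rD] := rows_in_closed K.
split=> [I|a x y xI yI I]; have [c0 cD] := cols_in_closed (I :|: K).
  by rewrite ffunE.
by rewrite !ffunE; have [? ?] := xI I; have [? ?] := yI I; split; auto.
Qed.

(** For [v] in [K] the sets I u K and (v u I) u K agree, so contraction along [v] preserves the
    column of [K]. The column of [set0] is zero because B2(set0) is. Row [set0] is included here, so
    this is acyclicity of the augmented columns. *)
Lemma mid_columns_acyclic c : (forall K, mid_column K (column K c)) ->
  bicobd c = 0 ->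
  exists2 b : bicochain, forall K, mid_column K (column K b) & c = bicobd b.
Proof.
apply: columns_acyclic => [K|K x y|K J x KJ xK I|K x xK I|K x xK|K x xK dx].
- by case: (mid_column_closed K).
- exact: (lin_closedB (mid_column_closed K)).
- have [xc xr] := xK I; split; last exact: rows_in_mono xr.
  by apply: cols_in_mono xc; apply: setUS.
- have [xc xr] := xK I; rewrite ffunE; split.
    exact: (sgnb_closed _ (cols_in_closed _)).
  exact: (sgnb_closed _ (rows_in_closed _)).
- move=> I; split.
    pose P J t := cols_in (J :|: K) t.
    apply: (@cobd_closed _ _ M P) => [J|J L t JL|J]; rewrite /P.
    + exact: cols_in_closed.
    + by apply: cols_in_mono; apply: setSU.
    + by case: (xK J).
  apply: (@cobd_closed _ _ M (fun _ => rows_in K)) => // [J|J].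
    exact: rows_in_closed.
  by case: (xK J).
- case: (set_0Vmem K) => [K0|[v vK]].
    exists 0; first by case: (mid_column_closed K).
    rewrite cobd0; apply/ffunP=> I; rewrite [RHS]ffunE.
    by case: (xK I) => _; rewrite K0 => /rows_in_set0.
  exists (contraction v x); last exact: cocycle_contraction.
  move=> I; rewrite ffunE; case: ifP => vI.
    have [c0 _] := cols_in_closed (I :|: K); have [r0 _] := rows_in_closed K.
    by split.
  have [xc xr] := xK (v |: I); split.
    apply: (sgnb_closed _ (cols_in_closed _)).
    by apply: cols_in_mono xc; rewrite !subUset sub1set inE vK orbT subsetUl subsetUr.
  exact: (sgnb_closed _ (rows_in_closed _)).
Qed.

Lemma mid_column_row c : (forall I, mid_row I (c I)) <->
  (forall K, mid_column K (column K c)).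
Proof.
split=> [cI K I|cK I K]; first by rewrite ffunE; apply: cI.
by have := cK K I; rewrite ffunE.
Qed.

Lemma mid_row_first (c : cochain) : (forall K, tens_in K (c K)) ->
  forall I, mid_row I (first_row c I).
Proof.
move=> cT I; rewrite ffunE; case: eqP => [->|_]; last by case: (mid_row_closed I).
by move=> K; rewrite set0U; apply: cT.
Qed.

Lemma tens_in_closed K : lin_closed (tens_in K).
Proof.
have [c0 cD] := cols_in_closed K; have [r0 rD] := rows_in_closed K.
by split=> [|a u v [? ?] [? ?]]; split; auto.
Qed.

(** A cocycle without row [set0] acquires a primitive once that row is allowed, and row [set0] of
    the primitive is the matching diagonal cocycle. The total size drops by one since [edge] uses
    rows indexed by singletons. *)
Lemma basis_mod_mid_tens q (J : finType) (z : J -> bicochain) :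
  basis_mod (bicocycle mid_row' q.+2) (bicoboundary mid_row' q.+2) z ->
  exists y : J -> cochain, basis_mod (cocycle tens_in q.+1) (coboundary tens_in q.+1) y.
Proof.
have edge0 m (c : cochain) : (forall I : {set 'I_n}, #|I| != m -> c I = 0) ->
    forall I K : {set 'I_n}, (#|I| + #|K|)%N != m.+1 -> edge c I K = 0.
  move=> c0 I K; rewrite ffunE; case: ifP => [/eqP ->|_ _]; last by rewrite ffunE.
  by rewrite add1n eqSS; apply: c0.
apply: (basis_mod_pull (f := edge)) => [|||||] /=.
- exact/cocycle_closed/tens_in_closed.
- by apply: bicoboundary_closed => I; apply: mid_row'_closed.
- move=> c [cB c0 dc]; split; [exact: mid_row_edge | exact: edge0 |].
  have := bicobd_first_row c; rewrite dc linear0 addr0 => <-.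
  exact: bicobd_bicobd.
- move=> _ [b [bB b0 ->]]; exists (- edge b); split=> [I|I K IK|].
  + rewrite ffunE; apply: (lin_closedN (mid_row'_closed I)).
    exact: mid_row_edge.
  + rewrite !ffunE; case: eqP => [I1|_]; last by rewrite ffunE oppr0.
    by rewrite b0 ?oppr0 //; move: IK; rewrite I1 add1n.
  + have := bicobd_first_row (cobd b); rewrite cobd_cobd linear0 addr0 => <-.
    have -> : first_row (cobd b) = bicobd (first_row b) - edge b.
      by rewrite bicobd_first_row addrC addKr.
    by rewrite bicobdD bicobd_bicobd add0r.
- move=> y [yB y0 dy].
  have [|b /mid_column_row bB yE] := @mid_columns_acyclic y _ dy.
    by apply/mid_column_row => I; case: (yB I).
  pose b1 := bitrunc q.+1 b.
  have b1B : forall I, mid_row I (b1 I).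
    apply: (bitrunc_closed (B := mid_row)) => // [I|I x P xI K].
      exact: mid_row_closed.
    rewrite ffunE; case: (P K) => //.
    by have [m0 _] := mid_row_closed I; have := m0 K; rewrite ffunE.
  have {}yE : y = bicobd b1.
    apply/ffunP=> I; apply/ffunP=> K; rewrite bicobd_bitrunc -yE.
    by case: eqP => // /eqP /y0.
  have b10 I K : (#|I| + #|K|).+1 != q.+2 -> b1 I K = 0.
    by rewrite eqSS !ffunE => /negPf ->.
  have db1 : cobd (b1 set0) = 0.
    have /ffunP/(_ set0) := yE; rewrite bicobd_row cobd_set0 add0r cards0 /= => <-.
    by case: (yB set0) => /(_ erefl).
  exists (b1 set0).
    split=> // [K|K Kq]; first by have := b1B set0 K; rewrite set0U.
    by apply: b10; rewrite cards0.
  exists (b1 - first_row (b1 set0)); split=> [I|I K IK|].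
  + split=> [->|]; first by rewrite !ffunE eqxx subrr.
    rewrite ffun_subE.
    apply: (lin_closedB (mid_row_closed I)) => //; apply: mid_row_first => K.
    by have := b1B set0 K; rewrite set0U.
  + rewrite ffun_subE ffun_subE [first_row _ I]ffunE; case: eqP => [->|_].
      by rewrite subrr.
    by rewrite b10 // ffunE subrr.
  + by rewrite bicobdB -yE bicobd_first_row db1 linear0 addr0.
- move=> c [cB c0 dc] [y [yB y0 yE]].
  (* [first_row c - y] is a cocycle of the augmented complex, since both terms have the differential
     [edge c]. As [y] vanishes in row [set0], row [set0] of a primitive bounds [c]. *)
  have [||b /mid_column_row bB bE] := @mid_columns_acyclic (first_row c - y).
  + apply/mid_column_row => I; rewrite ffun_subE.
    apply: (lin_closedB (mid_row_closed I)); last by case: (yB I).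
    exact: mid_row_first.
  + by rewrite bicobdB bicobd_first_row dc linear0 addr0 yE subrr.
  have cE : c = cobd (b set0).
    have /ffunP/(_ set0) := bE; rewrite bicobd_row cobd_set0 add0r cards0 /= => <-.
    by case: (yB set0) => /(_ erefl) E _; rewrite ffun_subE E subr0 ffunE eqxx.
  exists [ffun K : {set 'I_n} => if #|K| == q then b set0 K else 0]; split=> [K|K Kq|].
  + rewrite ffunE; case: eqP => _; last by case: (tens_in_closed K).
    by have := bB set0 K; rewrite set0U.
  + by rewrite ffunE ifF //; apply/negbTE; move: Kq; rewrite eqSS.
  + apply/ffunP=> K; have [Kq|Kq] := eqVneq #|K| q.+1; last first.
      rewrite c0 // cobdE big1 // => j jK; rewrite ffunE ifF ?sgnb0 //.
      by apply/negbTE; move: Kq; rewrite (cardsD1 j) jK eqSS.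
    rewrite [in LHS]cE !cobdE; apply: eq_bigr => j jK; rewrite ffunE ifT //.
    by move/eqP: Kq; rewrite (cardsD1 j) jK eqSS.
Qed.

(** * The Kunneth formula for B1(I) (x) B2(K) *)

Section Kunneth.
Variables (J1 J2 : finType) (deg1 : J1 -> nat) (deg2 : J2 -> nat).
Variables (z : J1 -> {ffun {set 'I_n} -> 'rV[k]_r1}).
Variables (y : J2 -> {ffun {set 'I_n} -> 'rV[k]_r2}).
Variables (l1 : J1 -> {linear {ffun {set 'I_n} -> 'rV[k]_r1} -> k^o}).
Variables (l2 : J2 -> {linear {ffun {set 'I_n} -> 'rV[k]_r2} -> k^o}).
Hypotheses (tf1 : total_family B1 deg1 z l1) (tf2 : total_family B2 deg2 y l2).

Definition cross (u : {ffun {set 'I_n} -> 'rV[k]_r1})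
    (v : {ffun {set 'I_n} -> 'rV[k]_r2}) : bicochain :=
  [ffun I : {set 'I_n} => [ffun K : {set 'I_n} => (u I)^T *m v K]].

Lemma bicobd_cross u v : cobd v = 0 -> bicobd (cross u v) = cross (cobd u) v.
Proof.
move=> dv; apply/ffunP=> I; apply/ffunP=> K; rewrite bicobdE.
have -> : cross u v I = [ffun K : {set 'I_n} => mulmx (u I)^T (v K)].
  by apply/ffunP=> L; rewrite !ffunE.
rewrite [X in sgnb _ X](_ : _ = 0) ?sgnb0 ?addr0; last first.
  by rewrite (cobd_map (mulmx (u I)^T)) dv ffunE; apply: mulmx0.
have -> : column K (cross u v) = [ffun I : {set 'I_n} => (mulmxr (v K) \o trmx) (u I)].
  by apply/ffunP=> L; rewrite !ffunE.
by rewrite (cobd_map (mulmxr (v K) \o trmx)) !ffunE.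
Qed.

Fact cross_linear v : linear (cross^~ v).
Proof.
move=> a u u'; apply/ffunP=> I; apply/ffunP=> K; rewrite !ffunE.
by rewrite linearP mulmxDl scalemxAl.
Qed.

Lemma crossD u u' v : cross (u + u') v = cross u v + cross u' v.
Proof. by have := cross_linear v 1 u u'; rewrite !scale1r. Qed.

Lemma crossZ a u v : cross (a *: u) v = a *: cross u v.
Proof.
apply/ffunP=> I; apply/ffunP=> K; rewrite !ffunE.
by rewrite linearZ /= scalemxAl.
Qed.

Lemma crossN u v : cross (- u) v = - cross u v.
Proof. by rewrite -scaleN1r crossZ scaleN1r. Qed.

Lemma cross_comb (J : finType) (mu : J -> k) u v :
  cross (\sum_a mu a *: u a) v = \sum_a mu a *: cross (u a) v.
Proof.
rewrite (big_morph (cross^~ v) (fun u u' => crossD u u' v) (id1 := 0)).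
  by apply: eq_bigr => a _; rewrite crossZ.
by have := crossZ 0 0 v; rewrite !scale0r.
Qed.

Lemma cols_in_cross I u (v : 'rV_r2) : csB B1 I u -> cols_in I (u^T *m v).
Proof.
move=> uI j; rewrite (_ : _^T = v 0 j *: u); last first.
  by apply/rowP=> a; rewrite !mxE big_ord1 !mxE mulrC.
exact: lin_closedZ (csB_closed B1 I) uI.
Qed.

Lemma rows_in_cross K u (v : 'rV_r2) : csB B2 K v -> rows_in K ((u : 'rV_r1)^T *m v).
Proof.
move=> vK i; rewrite (_ : row _ _ = u 0 i *: v); last first.
  by apply/rowP=> a; rewrite !mxE big_ord1 !mxE.
exact: lin_closedZ (csB_closed B2 K) vK.
Qed.

Lemma prod_row_cross (u : {ffun {set 'I_n} -> 'rV[k]_r1})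
    (v : {ffun {set 'I_n} -> 'rV[k]_r2}) :
  (forall I, csB B1 I (u I)) -> (forall K, csB B2 K (v K)) ->
  forall I, prod_row I (cross u v I).
Proof.
by move=> uB vB I K; rewrite !ffunE; split; [apply: cols_in_cross | apply: rows_in_cross].
Qed.

Definition row_cochain (i : 'I_r1) x : {ffun {set 'I_n} -> 'rV[k]_r2} :=
  [ffun K : {set 'I_n} => row i (x K)].

Fact row_cochain_linear i : linear (row_cochain i).
Proof. by move=> a x x'; apply/ffunP=> K; rewrite !ffunE linearP. Qed.

HB.instance Definition _ i := GRing.isLinear.Build k cochain
  {ffun {set 'I_n} -> 'rV[k]_r2} _ (row_cochain i) (row_cochain_linear i).

Lemma cobd_row_cochain i x : cobd (row_cochain i x) = row_cochain i (cobd x).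
Proof. by apply/ffunP=> K; rewrite (cobd_map (row i)) ffunE. Qed.

(* The contraction of row I of a bicochain with a cohomology class of the second
   complex; a cocycle all of whose slants vanish is a coboundary. *)
Definition slant b x : 'rV[k]_r1 := \row_i l2 b (row_cochain i x).

Fact slant_linear b : linear (slant b).
Proof. by move=> a x x'; apply/rowP=> i; rewrite !mxE !linearP. Qed.

HB.instance Definition _ b := GRing.isLinear.Build k cochain 'rV[k]_r1 _ (slant b)
  (slant_linear b).

Lemma slant_mulmx b (A : 'M_r1) x :
  slant b [ffun K : {set 'I_n} => A *m x K] = slant b x *m A^T.
Proof.
apply/rowP=> i; rewrite !mxE.
rewrite (_ : row_cochain i _ = \sum_j A i j *: row_cochain j x).
  rewrite linear_sum; apply: eq_bigr => j _.
  by rewrite linearZ /= !mxE mulrC.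
apply/ffunP=> K; rewrite sum_ffunE ffunE.
apply/rowP=> a; rewrite summxE !mxE ffunE mxE; apply: eq_bigr => j _.
by rewrite !ffunE !mxE.
Qed.

(** B1(I) is cut out by multiplying the values of [x] by constant matrices on the left, which
    commutes with applying [l2 b] row by row. *)
Lemma slant_csB b I x : prod_row I x -> csB B1 I (slant b x).
Proof.
case: (set_0Vmem I) => [->|[i iI]] xI.
  rewrite (_ : x = 0) ?linear0; first by case: (csB_closed B1 set0).
  apply/ffunP=> K; rewrite [RHS]ffunE; apply: cols_in_set0.
  by case: (xI K).
apply/(csBP _ _ iI) => w wI; rewrite -[csE _ _ _]trmxK -slant_mulmx.
rewrite [X in slant b X](_ : _ = 0) ?linear0 //; apply/ffunP=> K.
by rewrite !ffunE; have [/(cols_inP _ iI)-> //] := xI K.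
Qed.

Lemma slant_cobd b x : (forall K, rows_in K (x K)) -> slant b (cobd x) = 0.
Proof.
move=> xK; apply/rowP=> i; rewrite !mxE -cobd_row_cochain.
by apply: (tf_cobd tf2) => K; rewrite ffunE; apply: xK.
Qed.

Lemma slant_cross b (u : 'rV_r1) (v : {ffun {set 'I_n} -> 'rV[k]_r2}) :
  slant b [ffun K : {set 'I_n} => u^T *m v K] = l2 b v *: u.
Proof.
apply/rowP=> i; rewrite !mxE (_ : row_cochain _ _ = u 0 i *: v).
  by rewrite linearZ /= mulrC.
by apply/ffunP=> K; rewrite !ffunE; apply/rowP=> a; rewrite !mxE big_ord1 !mxE.
Qed.

Definition slants b c : {ffun {set 'I_n} -> 'rV[k]_r1} :=
  [ffun I : {set 'I_n} => slant b (c I)].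

Lemma slants_bicobd b c : (forall I, prod_row I (c I)) ->
  slants b (bicobd c) = cobd (slants b c).
Proof.
move=> cB; apply/ffunP=> I; rewrite (cobd_map (slant b)) ffunE bicobd_row.
rewrite linearD -[RHS]addr0; congr (_ + _); rewrite sgnb_map /= slant_cobd ?sgnb0 //.
by move=> K; case: (cB I K).
Qed.

Lemma slants_cross b b' u : slants b (cross u (y b')) = (b == b')%:R *: u.
Proof.
apply/ffunP=> I; rewrite !ffunE (slant_cross b (u I)) (tf_dual tf2).
by [].
Qed.

(** Each matrix row of [x] is a cocycle of the second complex without cohomology class, hence
    bounds. The primitives, stacked into [s], satisfy the row condition; the column condition and
    the vanishing of the slants are then restored in turn without changing the coboundary. *)
Lemma kernel_row_acyclic I x : prod_row I x -> (forall b, slant b x = 0) ->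
  cobd x = 0 -> exists v, [/\ prod_row I v, forall b, slant b v = 0 & x = cobd v].
Proof.
case: (set_0Vmem I) => [->|[i iI]] xI sx dx.
  exists 0; split=> [|b|]; rewrite ?linear0 ?cobd0 //.
    by case: (prod_row_closed set0).
  apply/ffunP=> K; rewrite [RHS]ffunE; apply: cols_in_set0.
  by case: (xI K).
have /choice[u uP] (a : 'I_r1) : exists u : {ffun {set 'I_n} -> 'rV[k]_r2},
    (forall K, csB B2 K (u K)) /\ row_cochain a x = cobd u.
  have [K||u uB uE] := tf_span tf2 (u := row_cochain a x).
  - by rewrite ffunE; case: (xI K).
  - by rewrite cobd_row_cochain dx linear0.
  exists u; split=> //; rewrite -uE big1 ?subr0 // => b _.
  by have /rowP/(_ a) := sx b; rewrite !mxE => ->; rewrite scale0r.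
pose s : cochain := [ffun K : {set 'I_n} => \matrix_a u a K].
have sK K : rows_in K (s K) by move=> a; rewrite ffunE rowK; case: (uP a).
have ds : cobd s = x.
  apply/ffunP=> K; apply/row_matrixP=> a; have [_ /ffunP/(_ K)] := uP a.
  rewrite ffunE => ->; rewrite -(cobd_map (row a)); congr (cobd _ K).
  by apply/ffunP=> L; rewrite ffunE [s L]ffunE /= rowK.
(* The projector onto B1(I). It fixes the columns of [x], so [Q^T *m s] has the same coboundary as
   [s]. *)
pose Q := \sum_(w | csS B1 i w \subset I) csE B1 i w.
have QE w : ~~ (csS B1 i w \subset I) -> Q *m csE B1 i w = 0.
  move=> wI; rewrite mulmx_suml big1 // => w' w'I; rewrite csE_orth.
  by case: eqP wI => // <-; rewrite w'I.
have QI t : cols_in I t -> Q^T *m t = t.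
  move=> tI; rewrite -[RHS]mul1mx -trmx1 -(csE_sum B1 i).
  rewrite [X in _ = X^T *m _](bigID (fun w => csS B1 i w \subset I)) /= -/Q.
  rewrite linearD mulmxDl [X in _ = _ + X](_ : _ = 0) ?addr0 //.
  rewrite (raddf_sum (@trmx k r1 r1)) mulmx_suml big1 // => w wI.
  exact: (proj1 (cols_inP _ iI) tI).
pose s1 : cochain := [ffun K : {set 'I_n} => Q^T *m s K].
have s1I : prod_row I s1.
  move=> K; rewrite ffunE; split; last exact: rows_in_mull.
  by apply/(cols_inP _ iI) => w wI; rewrite mulmxA -trmx_mul QE // trmx0 mul0mx.
have ds1 : cobd s1 = x.
  apply/ffunP=> K; rewrite (cobd_map (mulmx Q^T)) ds /= QI //.
  by case: (xI K).
exists (s1 - \sum_b [ffun K : {set 'I_n} => (slant b s1)^T *m y b K]); split.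
- apply: (lin_closedB (prod_row_closed I)) => //.
  apply: lin_closed_sum => [|b _ K]; first exact: prod_row_closed.
  rewrite ffunE; split; first exact/cols_in_cross/slant_csB.
  by apply: rows_in_cross; case: (tf_cocycle tf2 b).
- move=> b; rewrite linearB linear_sum (bigD1 b) //= slant_cross (tf_dual tf2).
  rewrite eqxx scale1r big1 ?addr0 ?subrr // => b' b'b.
  by rewrite slant_cross (tf_dual tf2) eq_sym (negPf b'b) scale0r.
- rewrite cobdB ds1 cobd_sum big1 ?subr0 // => b _; apply/ffunP=> K.
  rewrite (cobd_map (mulmx (slant b s1)^T)); have [_ _ ->] := tf_cocycle tf2 b.
  by rewrite !ffunE; apply: mulmx0.
Qed.

(** Bicochains with vanishing slants form a subcomplex with acyclic rows, so [rows_acyclic] applies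
    with zero as the inner condition. *)
Lemma kernel_acyclic c : (forall I, prod_row I (c I)) ->
  (forall b, slants b c = 0) -> bicobd c = 0 ->
  exists2 e : bicochain, forall I, prod_row I (e I) & c = bicobd e.
Proof.
move=> cB cs dc.
pose PY I x := prod_row I x /\ forall b, slant b x = 0.
have PYc I : lin_closed (PY I).
  have [p0 pD] := prod_row_closed I; split=> [|a u v [uI us] [vI vs]].
    by split=> // b; rewrite linear0.
  by split; [exact: pD | move=> b; rewrite linearP /= us vs scaler0 addr0].
have [||||||||||e eP eE] := @rows_acyclic n M PY (fun _ x => x = 0) _ _ _ _ _ _ _ _ c.
- by [].
- by move=> I; case: (PYc I).
- by move=> _ ? ? -> ->; rewrite subrr.
- by move=> I u v; apply: (lin_closedB (PYc I)).
- by [].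
- by move=> I J u IJ [uI us]; split=> //; apply: prod_row_mono uI.
- move=> I u [uI us]; split=> [K|b]; last by rewrite slant_cobd // => K; case: (uI K).
  split.
    apply: (cobd_closed (P := fun _ => cols_in I)) => // [L|L]; first exact: cols_in_closed.
    by case: (uI L).
  apply: (cobd_closed (P := rows_in)) => [L|L L' t LL'|L].
  + exact: rows_in_closed.
  + exact: rows_in_mono.
  + by case: (uI L).
- move=> I u [uI us] du; have [v [vI vs ->]] := kernel_row_acyclic uI us du.
  by exists v; rewrite ?subrr.
- by move=> I; split=> // b; have /ffunP/(_ I) := cs b; rewrite !ffunE.
- by move=> I; rewrite dc ffunE.
exists e; first by move=> I; case: (eP I).
by apply/ffunP=> I; have /eqP := eE I; rewrite ffun_subE subr_eq0 => /eqP.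
Qed.

Definition degree_pairs p := [set s : J1 * J2 | (deg1 s.1 + deg2 s.2)%N == p].

Lemma cross_cocycle a b :
  bicocycle prod_row (deg1 a + deg2 b)%N (cross (z a) (y b)).
Proof.
have [zB z0 dz] := tf_cocycle tf1 a; have [yB y0 dy] := tf_cocycle tf2 b.
split=> [|I K IK|]; first exact: prod_row_cross.
  rewrite !ffunE; have [Ia|Ia] := eqVneq #|I| (deg1 a); last first.
    by rewrite z0 // trmx0 mul0mx.
  rewrite y0 ?mulmx0 //; apply: contraNneq IK => ->.
  by rewrite Ia.
rewrite bicobd_cross // dz; apply/ffunP=> I; apply/ffunP=> K.
by rewrite !ffunE trmx0 mul0mx.
Qed.

(** Subtracting the products of the slants of [c] with the classes [y b] leaves a cocycle without
    slants, which bounds; the slants are cocycles of the first complex and expand in the [z a].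
    Independence follows by applying [l1 a] to the slant by [b], which kills coboundaries. *)
Lemma kunneth_basis q :
  basis_mod (bicocycle prod_row q.+1) (bicoboundary prod_row q.+1)
    (fun s : {s | s \in degree_pairs q.+1} => cross (z (val s).1) (y (val s).2)).
Proof.
split=> [[[a b]] /=|c [cB c0 dc]|mu [e [eB _ eE]] [[a b] abq]].
- by rewrite inE /= => /eqP <-; apply: cross_cocycle.
- have sB b I : csB B1 I (slants b c I) by rewrite ffunE; apply: slant_csB.
  have ds b : cobd (slants b c) = 0.
    rewrite -slants_bicobd // dc; apply/ffunP=> I; rewrite !ffunE.
    by rewrite linear0.
  have /choice[v vP] b : exists v : {ffun {set 'I_n} -> 'rV[k]_r1},
      (forall I, csB B1 I (v I)) /\
      slants b c - \sum_a l1 a (slants b c) *: z a = cobd v.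
    by have [v vB vE] := tf_span tf1 (sB b) (ds b); exists v.
  have vB b : forall I, csB B1 I (v b I) by case: (vP b).
  have yB b : forall I, csB B2 I (y b I) by case: (tf_cocycle tf2 b).
  have crossB b : forall I, prod_row I (cross (v b) (y b) I).
    exact: prod_row_cross.
  pose c1 := c - \sum_b cross (slants b c) (y b).
  have [|b||e eB eE] := @kernel_acyclic c1.
  + move=> I; rewrite ffun_subE; apply: (lin_closedB (prod_row_closed I)) => //.
    rewrite sum_ffunE; apply: lin_closed_sum => [|b _]; first exact: prod_row_closed.
    exact: prod_row_cross.
  + apply/ffunP=> I; rewrite [RHS]ffunE ffunE ffun_subE linearB sum_ffunE linear_sum.
    rewrite (bigD1 b) //= big1 => [|b' b'b].
      have /ffunP/(_ I) := slants_cross b b (slants b c).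
      by rewrite eqxx scale1r !ffunE => ->; rewrite addr0 subrr.
    have /ffunP/(_ I) := slants_cross b b' (slants b' c).
    by rewrite eq_sym (negPf b'b) scale0r !ffunE.
  + rewrite bicobdB dc bicobd_sum big1 ?subrr // => b _.
    have [_ _ dy] := tf_cocycle tf2 b; rewrite bicobd_cross // ds.
    by apply/ffunP=> I; apply/ffunP=> K; rewrite !ffunE trmx0 mul0mx.
  pose w := \sum_b cross (v b) (y b) + e.
  have cE : c = \sum_s l1 s.1 (slants s.2 c) *: cross (z s.1) (y s.2) + bicobd w.
    have dw b : bicobd (cross (v b) (y b)) = cross (slants b c) (y b)
        - \sum_a l1 a (slants b c) *: cross (z a) (y b).
      have [_ _ dy] := tf_cocycle tf2 b.
      by rewrite bicobd_cross // -(proj2 (vP b)) crossD crossN cross_comb.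
    rewrite bicobdD -eE bicobd_sum (eq_bigr _ (fun b _ => dw b)) sumrB /c1.
    set S := \sum_b cross (slants b c) (y b); set T := \sum_b \sum_a _.
    have -> : \sum_s l1 s.1 (slants s.2 c) *: cross (z s.1) (y s.2) = T.
      rewrite /T exchange_big pair_big /=.
      by apply: eq_bigr => -[].
    by rewrite [S - T]addrC addrACA subrr addr0 addrA subrr add0r.
  have cross0 I K a b : (#|I| + #|K|)%N != (deg1 a + deg2 b)%N ->
    cross (z a) (y b) I K = 0 by have [_ + _] := cross_cocycle a b; apply.
  (* [cE] runs over all pairs of classes. In total size q.+1 only those of [degree_pairs]
     contribute, and [w] is truncated accordingly. *)
  exists (fun s => l1 (val s).1 (slants (val s).2 c)).
  exists (bitrunc q w); split=> [I|I K|].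
  + apply: (bitrunc_closed (B := prod_row)) => // {}I.
    * exact: prod_row_closed.
    * exact: prod_row_filter.
    * rewrite /w ffunE; apply: (lin_closedD (prod_row_closed I)) => //.
      rewrite sum_ffunE; apply: lin_closed_sum => [|b _]; [exact: prod_row_closed | exact: crossB].
  + by rewrite eqSS !ffunE => /negPf ->.
  + apply/ffunP=> I; apply/ffunP=> K; rewrite bicobd_bitrunc ffun_subE ffun_subE.
    rewrite sum_ffunE sum_ffunE.
    rewrite [X in _ - X](_ : _ = \sum_(s in degree_pairs q.+1)
      (l1 s.1 (slants s.2 c) *: cross (z s.1) (y s.2)) I K); last first.
      rewrite [RHS]big_sub. by apply: eq_bigr => s _.
    case: eqP => /eqP IK.
      have /ffunP/(_ I)/ffunP/(_ K) := cE; rewrite ffunE ffunE sum_ffunE sum_ffunE => ->.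
      rewrite (bigID (fun s => s \in degree_pairs q.+1)) /=.
      rewrite [X in _ + X + _ - _]big1 ?addr0 => [|[a b]]; first by rewrite addrC addKr.
      by rewrite inE => ab; rewrite ffunE ffunE cross0 ?scaler0 // (eqP IK) eq_sym.
    rewrite c0 // big1 ?subrr // => [[a b]]; rewrite inE => /eqP ab.
    by rewrite ffunE ffunE cross0 ?scaler0 // ab.
- have : l1 a (slants b (bicobd e)) = 0.
    rewrite slants_bicobd // (tf_cobd tf1) // => I.
    by rewrite ffunE; apply: slant_csB.
  rewrite -eE.
  have -> : slants b (\sum_s mu s *: cross (z (val s).1) (y (val s).2)) =
      \sum_s (mu s * (b == (val s).2)%:R) *: z (val s).1.
    apply/ffunP=> I; rewrite ffunE sum_ffunE linear_sum sum_ffunE.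
    apply: eq_bigr => s _; rewrite /= [X in slant b X]ffunE linearZ /=.
    have /ffunP/(_ I) := slants_cross b (val s).2 (z (val s).1).
    by rewrite ffunE => ->; rewrite !ffunE scalerA.
  rewrite linear_sum (bigD1 (exist _ (a, b) abq)) //= linearZ /= (tf_dual tf1).
  rewrite !eqxx !mulr1 big1 => [|[[a' b'] ab'] ne]; last first.
    rewrite linearZ /= (tf_dual tf1).
    case: (eqVneq b b') => [E|_]; last by rewrite mulr0 scale0r.
    case: (eqVneq a a') => [E'|_]; last by rewrite scaler0.
    by case/negP: ne; apply/eqP/val_inj; rewrite /= E E'.
  by rewrite addr0 => H; rewrite -[LHS]mulr1; exact: H.
Qed.

End Kunneth.

End TwoSystems.

(** * Sections over the charts as Laurent polynomials *)

Section Monomials.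
Variables (k : fieldType) (n : nat).
Local Notation K := (ratfun k n).
Local Notation X := (@Defs.coord k n).
Implicit Types (I J : {set 'I_n}) (m : 'X_{1..n}) (f : K).

Definition mono m : K := tofrac ('X_[m] : {mpoly k[n]}).

Definition ones e : 'X_{1..n} := [multinom e | _ < n].

Lemma mono_neq0 m : mono m != 0.
Proof. by rewrite tofrac_eq0 -msupp_eq0 msuppX. Qed.

Lemma monoD m m' : mono (m + m') = mono m * mono m'.
Proof. by rewrite /mono mpolyXD rmorphM. Qed.

Lemma mono_coord i e : mono (U_(i) *+ e) = X i ^+ e.
Proof. by rewrite /mono -mpolyXn rmorphXn. Qed.

Lemma mono_prod_coord I e :
  mono ((\sum_(i in I) U_(i)) *+ e) = (\prod_(i in I) X i) ^+ e.
Proof.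
rewrite /mono -mpolyXn rmorphXn /= prod_coordE; congr (_ ^+ _).
congr tofrac; elim/big_rec2: _ => [|i p m _ <-]; first exact: mpolyX0.
by rewrite mpolyXD.
Qed.

Lemma mdeg_ones e : mdeg (ones e) = (n * e)%N.
Proof.
by rewrite mdegE; under eq_bigr do rewrite mnmE; rewrite sum_nat_const card_ord.
Qed.

Lemma sum_U1E I t : (\sum_(i in I) U_(i))%MM t = (t \in I).
Proof.
rewrite mnm_sumE; have [tI|tI] := boolP (t \in I).
  by rewrite (bigD1 t) //= mnm1E eqxx big1 // => i /andP[_ /negPf it]; rewrite mnm1E it.
by rewrite big1 // => i iI; rewrite mnm1E; case: eqP => // E; rewrite -E iI in tI.
Qed.

Lemma mdeg_sum_U1 I e : mdeg ((\sum_(i in I) U_(i)) *+ e)%MM = (e * #|I|)%N.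
Proof.
rewrite mdegMn mulnC mdeg_sum; under eq_bigr do rewrite mdeg1.
by rewrite sum1_card.
Qed.

(** The degree e of [m'] bounds each of its exponents, so the e-th power of the product of the x_i
    with i in [I] cancels what the denominator has inside [I]; outside [I] the numerator cancels
    it. *)
Lemma regular_monoV I m m' : mdeg m = mdeg m' ->
  (forall t, t \notin I -> (m' t <= m t)%N) -> regular I (mono m / mono m').
Proof.
move=> mm' le; pose e := mdeg m'.
pose uI := ((\sum_(i in I) U_(i)) *+ e)%MM.
have le' : (m' <= m + uI)%MM.
  apply/mnm_lepP => t; rewrite mnmDE mulmnE sum_U1E.
  have [tI|/le] := boolP (t \in I); last by rewrite addn0.
  by rewrite mul1n (leq_trans _ (leq_addl _ _)) // /e mdegE (bigD1 t) //= leq_addr.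
exists e, 'X_[m + uI - m']; split.
  rewrite dhomogX /=; apply/eqP/(@addIn (mdeg m')).
  by rewrite -mdegD submK // mdegD mm' addnC mdeg_sum_U1.
rewrite -mono_prod_coord -/uI -/(mono _).
apply/eqP; rewrite eqr_div ?mono_neq0 // -!monoD submK //.
Qed.

Lemma regular_sub I J f : I \subset J -> regular I f -> regular J f.
Proof.
move=> IJ [e [p [hp ->]]]; rewrite [p]mpolyE raddf_sum mulr_suml /=.
rewrite big_seq; apply: regular_sum => m mp.
rewrite -mul_mpolyC rmorphM -mulrA; apply: regularM.
  exact: (regular_const J p@_m).
rewrite -mono_prod_coord; apply: regular_monoV => [|t tJ].
  by rewrite mdeg_sum_U1; apply: (dhomog_mf hp).
rewrite mulmnE sum_U1E (_ : t \in I = false) //.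
by apply: contraNF tJ; apply: (subsetP IJ).
Qed.

(** Clearing denominators gives an identity of polynomials in which both sides are multiplied by
    monomials, so their supports can be compared exponent by exponent; the monomial coming from [I]
    does not involve x_t for t outside [I]. *)
Lemma regular_mpolyV I (G : {mpoly k[n]}) m' : G \is (mdeg m').-homog ->
  regular I (tofrac G / mono m') <->
  (forall m, m \in msupp G -> forall t, t \notin I -> (m' t <= m t)%N).
Proof.
move=> hG; split=> [[e [p [hp E]]] m mG t tI|H]; last first.
  rewrite [G]mpolyE raddf_sum mulr_suml /= big_seq; apply: regular_sum => m mG.
  rewrite -mul_mpolyC rmorphM -mulrA; apply: regularM.
    exact: (regular_const I G@_m).
  by apply: regular_monoV; [apply: (dhomog_mf hG) | apply: H].
move: E; rewrite -mono_prod_coord => /eqP.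
rewrite eqr_div ?mono_neq0 // -!rmorphM /= tofrac_eq => /eqP E.
set uI := (_ *+ e)%MM in E.
have : (m + uI)%MM \in msupp (p * 'X_[m']).
  by rewrite -E mcoeff_msupp addmC mcoeffMX -mcoeff_msupp.
rewrite (perm_mem (msuppMX p m')) => /mapP[m1 _ /mnmP/(_ t)].
rewrite !mnmDE mulmnE sum_U1E (negPf tI) mul0n addn0 => ->.
by rewrite leq_addr.
Qed.

(* A regular function on the intersection of all the charts is a Laurent
   polynomial, which is represented here with a denominator (x_0 .. x_(n-1))^e. *)
Lemma regular_denominator f : regular [set: 'I_n] f -> exists e0, forall e,
  (e0 <= e)%N -> exists2 G : {mpoly k[n]}, G \is (n * e).-homog &
    f = tofrac G / mono (ones e).
Proof.
move=> [e0 [p [hp ->]]]; exists e0 => e e0e.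
exists (p * 'X_[ones (e - e0)]).
  rewrite -(subnKC e0e) mulnDr dhomogM //; last by rewrite dhomogX /= mdeg_ones addKn.
  by move: hp; rewrite cardsT card_ord mulnC.
rewrite -mono_prod_coord; have -> : ones e = (ones e0 + ones (e - e0))%MM.
  by apply/mnmP => t; rewrite mnmDE !mnmE subnKC.
have -> : ((\sum_(i in [set: 'I_n]) U_(i)) *+ e0)%MM = ones e0.
  by apply/mnmP => t; rewrite mulmnE sum_U1E inE mul1n mnmE.
rewrite rmorphM monoD -/(mono _) invfM mulrACA divff ?mono_neq0 //.
by rewrite mulr1.
Qed.

Lemma regular_common_denominator (T : finType) (f : T -> K) :
  (forall j, regular [set: 'I_n] (f j)) -> exists e (G : T -> {mpoly k[n]}),
    forall j, G j \is (n * e).-homog /\ f j = tofrac (G j) / mono (ones e).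
Proof.
move=> fR; have /choice[e0 e0P] j := regular_denominator (fR j).
pose e := (\max_j e0 j)%N; exists e.
have /choice[G GP] j : exists G : {mpoly k[n]}, G \is (n * e).-homog /\
    f j = tofrac G / mono (ones e).
  by have [|G GP GE] := e0P j e; [apply: leq_bigmax | exists G].
by exists G.
Qed.

End Monomials.

Definition cmx (k : fieldType) n r s (A : 'M[k]_(r, s)) : 'M[ratfun k n]_(r, s) :=
  map_mx (@ratconst k n) A.

(* In the frames tD the transition matrices of E become the constants tM, and
   tD is the action of a torus, with weights twt on the weight spaces tE. *)
Record toric (k : fieldType) n (E : vbundle k n) (d : nat) := Toric {
  tW : finType;
  twt : 'I_n -> tW -> 'X_{1..n};
  tE : tW -> 'M[k]_(vrank E);
  tM : 'I_n -> 'I_n -> 'M[k]_(vrank E);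
  tD : 'I_n -> 'M[ratfun k n]_(vrank E);
  tD' : 'I_n -> 'M[ratfun k n]_(vrank E);
  tM_id : forall i, tM i i = 1%:M;
  tM_comp : forall i j l, tM i j *m tM j l = tM i l;
  tDK : forall i, tD i *m tD' i = 1%:M;
  tD_trans : forall i j, trans E i j *m tD j = tD i *m cmx n (tM i j);
  tE_orth : forall w w', tE w *m tE w' = if w == w' then tE w else 0;
  tE_sum : \sum_w tE w = 1%:M;
  twt_self : forall i w, twt i w i = 0%N;
  twt_deg : forall i w, (mdeg (twt i w) <= d)%N;
  tD_E : forall i w, tD i *m cmx n (tE w) =
    (mono k (twt i w) / @Defs.coord k n i ^+ mdeg (twt i w)) *: cmx n (tE w)
}.
Arguments twt {k n E d}.
Arguments tE {k n E d}.
Arguments tM {k n E d}.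
Arguments tD {k n E d}.
Arguments tD' {k n E d}.
Arguments tDK {k n E d}.
Arguments tE_sum {k n E d}.
Arguments tD_E {k n E d}.

Fact mulr_divV (F : fieldType) (a b : F) : a != 0 -> b != 0 ->
  b / a * (a / b) = 1.
Proof. by move=> a0 b0; rewrite mulrA divfK ?divff. Qed.

(** * Sections in logarithmic frames and their monomial components *)

Section Toric.
Variables (k : fieldType) (n d : nat) (E : vbundle k n) (T : toric E d).
Variable i0 : 'I_n.
Local Notation K := (ratfun k n).
Local Notation X := (@Defs.coord k n).
Local Notation r := (vrank E).
Local Notation cmx := (@cmx k n _ _).
Implicit Types (I J : {set 'I_n}) (i j : 'I_n) (s : ratsection E) (m : 'X_{1..n}).

Lemma cmxM p q t (A : 'M_(p, q)) (B : 'M_(q, t)) : cmx (A *m B) = cmx A *m cmx B.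
Proof. exact: map_mxM. Qed.

Lemma tD'K i : tD' T i *m tD T i = 1%:M.
Proof. exact/mulmx1C/tDK. Qed.

Lemma tD'_E i w : tD' T i *m cmx (tE T w) =
  (X i ^+ mdeg (twt T i w) / mono k (twt T i w)) *: cmx (tE T w).
Proof.
have X0 : X i ^+ mdeg (twt T i w) != 0 by rewrite expf_neq0 ?coord_neq0.
have := congr1 (mulmx (tD' T i)) (tD_E T i w).
rewrite mulmxA tD'K mul1mx -scalemxAr => {2}->.
rewrite scalerA (mulr_divV (mono_neq0 _ _) X0); exact: esym (scale1r _).
Qed.

(** Coordinates on the single chart [i0] determine a compatible family; in the frames [tD] the
    passage to the other charts is by the constant matrices [tM]. *)
Definition log_coord s : 'rV[K]_r := s i0 *m tD T i0.

Definition log_section (u : 'rV[K]_r) : ratsection E :=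
  [ffun i => u *m cmx (tM T i0 i) *m tD' T i].

Lemma log_sectionK : cancel log_section log_coord.
Proof.
move=> u; rewrite /log_coord ffunE tM_id -mulmxA tD'K mulmx1.
by rewrite [cmx 1%:M]map_mx1 mulmx1.
Qed.

Lemma trans_log i j : trans E i j = tD T i *m cmx (tM T i j) *m tD' T j.
Proof. by rewrite -tD_trans -mulmxA tDK mulmx1. Qed.

Lemma log_coordK I s : is_section I s -> log_section (log_coord s) = s.
Proof.
case=> sT _; apply/ffunP=> i; rewrite ffunE (sT i0 i) trans_log.
by rewrite /log_coord -!mulmxA.
Qed.

Lemma log_section_compat u i j :
  log_section u j = log_section u i *m trans E i j.
Proof.
rewrite [LHS]ffunE [log_section u i]ffunE trans_log !mulmxA.
rewrite -(mulmxA (u *m cmx (tM T i0 i)) (tD' T i)) tD'K mulmx1.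
by rewrite -(mulmxA u (cmx (tM T i0 i))) -cmxM tM_comp.
Qed.

Lemma log_section_linear : linear log_section.
Proof.
move=> a u v; apply/ffunP=> i.
rewrite [LHS]ffunE [RHS]ffunE [Y in _ = Y + _]ffunE.
rewrite [log_section u i]ffunE [log_section v i]ffunE.
by rewrite !mulmxDl -!scalemxAl.
Qed.

HB.instance Definition _ := GRing.isLinear.Build K 'rV[K]_r (ratsection E) _
  log_section log_section_linear.

Lemma regular_cmx I p q t (A : 'M[K]_(p, q)) (B : 'M[k]_(q, t)) :
  (forall a b, regular I (A a b)) -> forall a b, regular I ((A *m cmx B) a b).
Proof.
move=> AR a b; rewrite mxE; apply: regular_sum => c _.
by apply: regularM; rewrite ?mxE //; apply: regular_const.
Qed.

(** One chart of [I] suffices, since transition matrices between charts of [I] are regular on U_I.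
    Weight components suffice because the [tE] are constant and sum to 1. *)
Lemma is_sectionP I i u : i \in I ->
  is_section I (log_section u) <->
  forall w b, regular I ((log_section u i *m cmx (tE T w)) 0 b).
Proof.
move=> iI; split=> [[_ uR] w b|uR].
  by apply: regular_cmx => a c; rewrite [a]ord1; apply: uR.
split=> [? ?|j jI a]; first exact: log_section_compat.
have uiR c : regular I (log_section u i 0 c).
  rewrite -[log_section u i]mulmx1 -(map_mx1 (@ratconst k n)) -(tE_sum T).
  rewrite raddf_sum mulmx_sumr summxE; apply: regular_sum => w _; exact: uR.
rewrite (log_section_compat u i j) mxE; apply: regular_sum => c _.
apply: regularM => //; apply: (@regular_sub _ _ [set i; j]); last exact: trans_regular.
by apply/subsetP=> t; rewrite !inE => /orP[] /eqP ->.
Qed.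

Definition coefmx m (g : 'rV[{mpoly k[n]}]_r) : 'rV[k]_r := map_mx (mcoeff m) g.

Definition laurent e (g : 'rV[{mpoly k[n]}]_r) : 'rV[K]_r :=
  (mono k (ones n e))^-1 *: map_mx (@tofrac {mpoly k[n]}) g.

Lemma coefmxM m g (A : 'M[k]_r) :
  coefmx m (g *m map_mx (@mpolyC n k) A) = coefmx m g *m A.
Proof.
apply/rowP=> b; rewrite !mxE raddf_sum; apply: eq_bigr => a _ /=.
by rewrite !mxE mulrC mcoeffCM mulrC.
Qed.

Lemma laurentM e g (A : 'M[k]_r) :
  laurent e g *m cmx A = laurent e (g *m map_mx (@mpolyC n k) A).
Proof.
rewrite /laurent -scalemxAl map_mxM; congr (_ *: (_ *m _)).
by apply/matrixP=> a b; rewrite !mxE.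
Qed.

(** On the weight space of [w], leaving the logarithmic frame multiplies by a power of x_i and
    divides by x^(twt i w). So a monomial x^m over (x_0 .. x_(n-1))^e acquires the exponent m t - e
    - twt i w t at each t other than [i], and this must not be negative for t outside [I]. *)
Lemma log_section_laurentP I i e (g : 'rV[{mpoly k[n]}]_r) : i \in I ->
  (forall b, g 0 b \is (n * e).-homog) ->
  is_section I (log_section (laurent e g)) <->
  (forall m w t, t \notin I -> (m t < e + twt T i w t)%N ->
     coefmx m g *m (tM T i0 i *m tE T w) = 0).
Proof.
move=> iI hg; rewrite (is_sectionP _ iI).
have entry w : log_section (laurent e g) i *m cmx (tE T w) =
    \row_b (tofrac ('X_[U_(i) *+ mdeg (twt T i w)] *
              (g *m map_mx (@mpolyC n k) (tM T i0 i *m tE T w)) 0 b)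
            / mono k (twt T i w + ones n e)).
  rewrite ffunE -mulmxA tD'_E -scalemxAr -mulmxA -cmxM laurentM.
  rewrite /laurent; move: (g *m _) => h; apply/rowP=> b; rewrite !mxE.
  rewrite (rmorphM (@tofrac {mpoly k[n]})) /= -/(mono k (U_(i) *+ mdeg (twt T i w))).
  rewrite mono_coord monoD invfM -!mulrA; congr (_ * _).
  by rewrite mulrC -mulrA mulrC -!mulrA.
have gA_homog (A : 'M[k]_r) b : (g *m map_mx (@mpolyC n k) A) 0 b \is (n * e).-homog.
  rewrite mxE; apply: rpred_sum => a _; rewrite mxE mulrC mul_mpolyC.
  exact: dhomogZ.
have regP w b : regular I ((log_section (laurent e g) i *m cmx (tE T w)) 0 b) <->
    (forall m, (coefmx m g *m (tM T i0 i *m tE T w)) 0 b != 0 ->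
       forall t, t \notin I -> (e + twt T i w t <= m t)%N).
  rewrite entry mxE regular_mpolyV; last first.
    rewrite mdegD mdeg_ones; apply: dhomogM => //.
    by rewrite dhomogX /= mdegMn mdeg1 mul1n.
  rewrite mulrC; set A := tM T i0 i *m tE T w.
  split=> [H m mA t tI|H m].
    have mi : (U_(i) *+ mdeg (twt T i w))%MM t = 0%N.
      by rewrite mulmnE mnm1E (_ : i == t = false) //; apply: contraNF tI => /eqP <-.
    have := H (U_(i) *+ mdeg (twt T i w) + m)%MM _ t tI.
    rewrite !mnmDE mi mnmE add0n addnC; apply.
    by rewrite mcoeff_msupp mcoeffMX; rewrite -coefmxM mxE in mA.
  rewrite (perm_mem (msuppMX _ _)) => /mapP[m1 m1A ->] t tI.
  rewrite !mnmDE mnmE addnC (leq_trans _ (leq_addl _ _)) //.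
  by apply: H => //; rewrite -coefmxM mxE -mcoeff_msupp.
split=> [H m w t tI mt|H w b].
  apply/rowP=> b; rewrite [RHS]mxE; apply/eqP; apply: contraTT mt => mb.
  by rewrite -leqNgt; apply: (proj1 (regP w b) (H w b)).
apply/regP => m mb t tI; rewrite leqNgt; apply: contraNN mb => mt.
by rewrite (H m w t) // mxE.
Qed.

Fact laurent_zmod_morphism e : zmod_morphism (laurent e).
Proof. by move=> g h; rewrite /laurent raddfB scalerBr. Qed.

HB.instance Definition _ e := GRing.isZmodMorphism.Build
  'rV[{mpoly k[n]}]_r 'rV[K]_r (laurent e) (laurent_zmod_morphism e).

Fact coefmx_zmod_morphism m : zmod_morphism (coefmx m).
Proof. by move=> g h; apply/rowP=> b; rewrite !mxE mcoeffB. Qed.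

HB.instance Definition _ m := GRing.isZmodMorphism.Build
  'rV[{mpoly k[n]}]_r 'rV[k]_r (coefmx m) (coefmx_zmod_morphism m).

Lemma laurent_inj e : injective (laurent e).
Proof.
move=> g h /(scalerI (invr_neq0 (mono_neq0 k (ones n e)))) /rowP gh.
by apply/rowP=> b; have := gh b; rewrite !mxE => /eqP; rewrite tofrac_eq => /eqP.
Qed.

Definition monomx m (a : 'rV[k]_r) : 'rV[{mpoly k[n]}]_r :=
  'X_[m] *: map_mx (@mpolyC n k) a.

Lemma coefmx_monomx m m' a :
  coefmx m (monomx m' a) = if m == m' then a else 0.
Proof.
apply/rowP=> b; rewrite !mxE mulrC mcoeffCM mcoeffX eq_sym.
by case: eqP => _; rewrite ?mulr1 ?mulr0 ?mxE.
Qed.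

Lemma monomx_sum (g : 'rV[{mpoly k[n]}]_r) (ms : seq 'X_{1..n}) : uniq ms ->
  (forall b, {subset msupp (g 0 b) <= ms}) ->
  g = \sum_(m <- ms) monomx m (coefmx m g).
Proof.
move=> ums gms; apply/rowP=> b; rewrite summxE; apply/mpolyP=> m.
rewrite raddf_sum /=; have [mms|mms] := boolP (m \in ms).
  rewrite (bigD1_seq m) //= big1 => [|m' m'm].
    by rewrite !mxE mulrC mcoeffCM mcoeffX eqxx mulr1 addr0.
  by rewrite !mxE mulrC mcoeffCM mcoeffX (negPf m'm) mulr0.
rewrite big1_seq => [|m' /andP[_ m'ms]].
  by apply/eqP; rewrite mcoeff_eq0; apply: contra mms; apply: gms.
rewrite !mxE mulrC mcoeffCM mcoeffX; case: eqP => [mE|_]; last by rewrite mulr0.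
by rewrite -mE m'ms in mms.
Qed.

Lemma monomx_homog e m a b : mdeg m = (n * e)%N -> monomx m a 0 b \is (n * e).-homog.
Proof.
move=> me; rewrite !mxE mulrC mul_mpolyC; apply: dhomogZ.
by rewrite dhomogX /= me.
Qed.

Lemma laurentZD e p (g h : 'rV[{mpoly k[n]}]_r) :
  laurent e (p *: g + h) = tofrac p *: laurent e g + laurent e h.
Proof.
rewrite /laurent map_mxD scalerDr map_mxZ scalerA [_^-1 * _]mulrC -scalerA.
exact: erefl.
Qed.

(* a x^m / (x_0 .. x_(n-1))^e is a section over U_I. *)
Definition wt_section m e I a := is_section I (log_section (laurent e (monomx m a))).

Lemma wt_sectionP m e I i a : i \in I -> mdeg m = (n * e)%N ->
  wt_section m e I a <-> (forall w t, t \notin I -> (m t < e + twt T i w t)%N ->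
    a *m (tM T i0 i *m tE T w) = 0).
Proof.
move=> iI me; rewrite /wt_section (log_section_laurentP iI) => [|b]; last exact: monomx_homog.
split=> [H w t tI mt|H m' w t tI mt].
  by have := H m w t tI mt; rewrite coefmx_monomx eqxx.
rewrite coefmx_monomx; case: eqP mt => [-> mt|_ _]; last by rewrite mul0mx.
exact: H mt.
Qed.

Lemma is_section_set0 u : is_section set0 (log_section u).
Proof. by split=> [i j|i]; [apply: log_section_compat | rewrite inE]. Qed.

Lemma is_section_coef I e (g : 'rV[{mpoly k[n]}]_r) m :
  (forall b, g 0 b \is (n * e).-homog) -> mdeg m = (n * e)%N ->
  is_section I (log_section (laurent e g)) -> wt_section m e I (coefmx m g).
Proof.
move=> hg me; case: (set_0Vmem I) => [-> _|[i iI]]; first exact: is_section_set0.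
by move/(log_section_laurentP iI hg) => H; apply/(wt_sectionP _ iI me) => w t; apply: H.
Qed.

Lemma laurent_ones e a : laurent e (monomx (ones n e) a) = cmx a.
Proof.
apply/rowP=> b; rewrite !mxE rmorphM /= -/(mono _ _) mulrA mulVf ?mono_neq0 //.
by rewrite mul1r.
Qed.

Lemma coefmx_eq0_deg e (g : 'rV[{mpoly k[n]}]_r) m :
  (forall b, g 0 b \is (n * e).-homog) -> mdeg m != (n * e)%N -> coefmx m g = 0.
Proof.
by move=> hg me; apply/rowP=> b; rewrite !mxE; apply: (dhomog_nemf_coeff (hg b)).
Qed.

Lemma is_section_closed I (u v : 'rV[K]_r) a :
  is_section I (log_section u) -> is_section I (log_section v) ->
  is_section I (log_section (ratconst n a *: u + v)).
Proof.
move=> [uT uR] [vT vR]; split=> [i j|i iI b]; first exact: log_section_compat.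
rewrite linearP !ffunE mxE; apply: regularD; last by have := vR i iI b; rewrite ffunE.
rewrite mxE; apply: regularM; first exact: regular_const.
by have := uR i iI b; rewrite ffunE.
Qed.

Lemma wt_section_closed m e I : lin_closed (wt_section m e I).
Proof.
split=> [|a x y].
  rewrite /wt_section (_ : monomx m 0 = 0) ?raddf0.
    split=> [i j|i iI b]; first by rewrite !ffunE mul0mx.
    by rewrite ffunE mxE; apply: regular0.
  by apply/rowP=> b; rewrite !mxE mulr0.
rewrite /wt_section; have -> : monomx m (a *: x + y) = a%:MP *: monomx m x + monomx m y.
  apply/rowP=> b; rewrite !mxE mpolyCD mpolyCM mulrDr; congr (_ + _).
  by rewrite mulrCA.
rewrite laurentZD; exact: is_section_closed.
Qed.

(** The weight projectors of chart [i] conjugated into the frame of [i0], where all charts can be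
    compared. *)
Lemma sum_frame i : \sum_w tM T i0 i *m tE T w *m tM T i i0 = 1%:M.
Proof. by rewrite -mulmx_suml -mulmx_sumr tE_sum mulmx1 tM_comp tM_id. Qed.

Lemma frame_orth i w w' :
  (tM T i0 i *m tE T w *m tM T i i0) *m (tM T i0 i *m tE T w' *m tM T i i0) =
  if w == w' then tM T i0 i *m tE T w *m tM T i i0 else 0.
Proof.
rewrite -!mulmxA (mulmxA (tM T i i0)) tM_comp tM_id mul1mx (mulmxA (tE T w)).
by rewrite tE_orth; case: eqP => _; rewrite ?mul0mx ?mulmx0.
Qed.

Lemma mul_frame_eq0 i (a : 'rV[k]_r) w :
  a *m (tM T i0 i *m tE T w *m tM T i i0) = 0 <-> a *m (tM T i0 i *m tE T w) = 0.
Proof.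
rewrite mulmxA; split=> [H|->]; last by rewrite mul0mx.
by rewrite -[LHS]mulmx1 -(tM_id T i) -(tM_comp T i i0 i) mulmxA H mul0mx.
Qed.

(** [is_section set0] imposes no regularity, so vanishing at [set0] has to be required
    separately. *)
Definition supported_sections m e I (a : 'rV[k]_r) :=
  (I = set0 -> a = 0) /\ wt_section m e I a.

Lemma supported_sections_closed m e I : lin_closed (supported_sections m e I).
Proof.
have [s0 sD] := wt_section_closed m e I.
split=> [|a x y [x0 xI] [y0 yI]]; first by split.
by split=> [I0|]; [rewrite x0 // y0 // scaler0 addr0 | apply: sD].
Qed.

(* The weight of x^m / (x_0 .. x_(n-1))^e is negative at some i; the complement
   of the set S below contains some v because the degree of m is n e > e + d. *)
Lemma nonzero_weight_acyclic m e (c : {ffun {set 'I_n} -> 'rV[k]_r}) :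
  (d < n)%N -> mdeg m = (n * e)%N -> m <> ones n e ->
  (forall I, supported_sections m e I (c I)) -> cobd c = 0 ->
  exists2 b : {ffun {set 'I_n} -> 'rV[k]_r},
    forall I, supported_sections m e I (b I) & c = cobd b.
Proof.
move=> dn me mne cS dc.
have [i im] : exists i, (m i < e)%N.
  apply/existsP; apply: contra_notT mne; rewrite negb_exists => /forallP H.
  have le t : (e <= m t)%N by rewrite leqNgt H.
  apply/mnmP => t; rewrite mnmE; apply/eqP; rewrite eqn_leq le andbT leqNgt.
  apply: contra_eqN me => lt; rewrite gtn_eqF // -(mdeg_ones n e) !mdegE.
  rewrite (bigD1 t) // [ltnRHS](bigD1 t) //= mnmE -addSn leq_add //.
  by apply: leq_sum => u _; rewrite mnmE.
pose P w := tM T i0 i *m tE T w *m tM T i i0.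
pose cw w : {ffun {set 'I_n} -> 'rV[k]_r} := [ffun I : {set 'I_n} => c I *m P w].
suff /choice[b bP] w : exists b : {ffun {set 'I_n} -> 'rV[k]_r},
    (forall I, supported_sections m e I (b I)) /\ cw w = cobd b.
  exists (\sum_w b w) => [I|].
    rewrite sum_ffunE; apply: lin_closed_sum => [|w _].
      exact: supported_sections_closed.
    by case: (bP w) => /(_ I).
  rewrite cobd_sum; under [RHS]eq_bigr do rewrite -(proj2 (bP _)).
  apply/ffunP=> I; rewrite sum_ffunE; under [RHS]eq_bigr do rewrite ffunE.
  by rewrite -mulmx_sumr sum_frame mulmx1.
have dcw : cobd (cw w) = 0.
  apply/ffunP=> I; rewrite (cobd_map (mulmxr (P w))) dc !ffunE.
  by rewrite /= mul0mx.
(* The indices that [I] must contain for the component of weight [w] to be nonzero at [I]. Because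
   [i] is among them in every chart, sets without [i] carry nothing, and the decomposition at [i]
   serves all the others. *)
pose S := [set t | (m t < e + twt T i w t)%N].
have iS : i \in S by rewrite inE twt_self addn0.
(* If [S] were everything, summing [m t + 1 <= e + twt T i w t] over all t would give n e + n <= n e
   + d. *)
have [v vS] : exists v, v \notin S.
  apply/existsP; rewrite -negb_forall; apply: contraTN dn => /forallP Sall.
  rewrite -leqNgt; apply: leq_trans (twt_deg i w); rewrite -(leq_add2l (n * e)).
  rewrite -{1}me -(mdeg_ones n e) !mdegE -big_split /=.
  rewrite -[X in (_ + X <= _)%N](card_ord n) -sum1_card -big_split /=.
  by apply: leq_sum => t _; have := Sall t; rewrite inE mnmE addn1.
have cS0 I : ~~ (S \subset I) -> cw w I = 0.
  have [c0 cI] := cS I; rewrite ffunE; case: (set_0Vmem I) => [/c0 -> _|[j jI]].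
    by rewrite mul0mx.
  have [iI|iI] := boolP (i \in I); last first.
    rewrite (_ : c I = 0) ?mul0mx //.
    rewrite -[LHS]mulmx1 -(sum_frame j) mulmx_sumr big1 // => w' _.
    apply/mul_frame_eq0/(proj1 (wt_sectionP _ jI me) cI w' i) => //.
    by rewrite (leq_trans im) ?leq_addr.
  case/subsetPn => t tS tI; apply/mul_frame_eq0.
  by apply: (proj1 (wt_sectionP _ iI me) cI w t) => //; rewrite inE in tS.
exists (contraction v (cw w)); split; last exact: cocycle_contraction.
move=> I; have [s0 _] := supported_sections_closed m e I.
rewrite ffunE; case: ifP => vI; first exact: s0.
have [SI|SI] := boolP (S \subset I); last first.
  rewrite cS0 ?sgnb0 //; apply: contra SI => SvI; apply/subsetP=> u uS.
  by have := subsetP SvI u uS; rewrite !inE; case: eqP => // uv; rewrite -uv uS in vS.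
have iI := subsetP SI i iS.
apply: sgnb_closed; first exact: supported_sections_closed.
split=> [I0|]; first by rewrite I0 inE in iI.
apply/(wt_sectionP _ iI me) => w' t tI mt; apply/mul_frame_eq0.
rewrite ffunE -mulmxA frame_orth; case: eqP => [ww'|_]; last by rewrite mulmx0.
by rewrite -ww' in mt; have : t \in I; [apply: (subsetP SI); rewrite inE | rewrite (negPf tI)].
Qed.

End Toric.

(** * Reduction of the Cech complex to weight zero *)

Section WeightZero.
Variables (k : fieldType) (n d : nat) (E : vbundle k n) (T : toric E d).
Variable i0 : 'I_n.
Hypothesis dn : (d < n)%N.
Local Notation K := (ratfun k n).
Local Notation r := (vrank E).
Local Notation log_section := (log_section T i0).
Local Notation log_coord := (log_coord T i0).
Local Notation cmx := (@cmx k n _ _).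
Implicit Types (I J : {set 'I_n}) (i j : 'I_n) (m : 'X_{1..n}).

Lemma regular_tD i a b : regular [set: 'I_n] (tD T i a b).
Proof.
rewrite -[tD T i]mulmx1 -(map_mx1 (@ratconst k n)) -(tE_sum T) raddf_sum mulmx_sumr.
rewrite summxE; apply: regular_sum => w _; rewrite (tD_E T) !mxE.
apply: regularM; last exact: regular_const.
rewrite -mono_coord; apply: regular_monoV => [|t]; last by rewrite inE.
by rewrite mdegMn mdeg1 mul1n.
Qed.

Lemma regular_log_coord I s b : I != set0 -> is_section I s ->
  regular [set: 'I_n] (log_coord s 0 b).
Proof.
case/set0Pn=> i iI [sT sR]; rewrite mxE; apply: regular_sum => a _.
apply: regularM; last exact: regular_tD.
rewrite (sT i i0) mxE; apply: regular_sum => a' _; apply: regularM.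
  exact: regular_sub (subsetT I) (sR i iI a').
by apply: (@regular_sub _ _ [set i; i0]); [exact: subsetT | exact: trans_regular].
Qed.

(** Where all coordinates are invertible, logarithmic coordinates of sections are Laurent
    polynomials, and one denominator serves the finitely many entries. The condition at [set0]
    excludes the arbitrary rational functions that [is_section set0] would allow. *)
Lemma laurent_cochain (c : {ffun {set 'I_n} -> ratsection E}) :
  (forall I, is_section I (c I)) -> c set0 = 0 ->
  exists e (g : {ffun {set 'I_n} -> 'rV[{mpoly k[n]}]_r}),
    (forall I b, g I 0 b \is (n * e).-homog) /\
    c = [ffun I : {set 'I_n} => log_section (laurent e (g I))].
Proof.
move=> cS c0.
have [|e [G GP]] := @regular_common_denominator k n ({set 'I_n} * 'I_r)%type
    (fun s => log_coord (c s.1) 0 s.2).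
  move=> [I b] /=; have [->|I0] := eqVneq I set0; last exact: regular_log_coord (cS I).
  by rewrite c0 /log_coord ffunE mul0mx mxE; apply: regular0.
exists e, [ffun I : {set 'I_n} => \row_b G (I, b)]; split=> [I b|].
  by rewrite ffunE mxE; case: (GP (I, b)).
apply/ffunP=> I; rewrite ffunE -[LHS](log_coordK T i0 (cS I)); congr log_section.
apply/rowP=> b; have [_ /= ->] := GP (I, b).
by rewrite ffunE !mxE mulrC.
Qed.

Lemma log_section0 : log_section 0 = 0.
Proof. by apply/ffunP=> i; rewrite ffunE !mul0mx ffunE. Qed.

Definition const_cochain (c : {ffun {set 'I_n} -> 'rV[k]_r}) : cochain_space E :=
  [ffun I : {set 'I_n} => log_section (cmx (c I))].

Lemma const_cochainE c I : const_cochain c I = log_section (cmx (c I)).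
Proof. exact: ffunE. Qed.

Lemma cochainZD a (x y : cochain_space E) I :
  (a *: x + y) I = ratconst n a *: x I + y I.
Proof. by rewrite !ffunE. Qed.

Fact const_cochain_linear : linear const_cochain.
Proof.
move=> a x y; apply/ffunP=> I.
apply: etrans (esym (cochainZD a (const_cochain x) (const_cochain y) I)).
have cD : cmx ((a *: x + y) I) = ratconst n a *: cmx (x I) + cmx (y I).
  by rewrite !ffunE [LHS]map_mxD map_mxZ.
apply: etrans (const_cochainE _ _) _; apply: etrans (congr1 log_section cD) _.
apply: etrans (log_section_linear T i0 _ _ _) (esym _).
exact: (congr2 (fun s t : ratsection E => ratconst n a *: s + t)
  (const_cochainE x I) (const_cochainE y I)).
Qed.

HB.instance Definition _ := GRing.isLinear.Build k
  {ffun {set 'I_n} -> 'rV[k]_r} (cochain_space E) _ const_cochain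
  const_cochain_linear.

Lemma cech_dE (c : {ffun {set 'I_n} -> ratsection E}) :
  cech_d (c : cochain_space E) = cobd c.
Proof.
apply/ffunP=> J; rewrite cobdE ffunE; apply: eq_bigr => j _.
exact: scaler_signn.
Qed.

(** The condition [b set0 = 0] forces [b = 0] when p = 0, which makes the two cases of
    [is_coboundary] uniform. *)
Lemma is_coboundaryP p (c : {ffun {set 'I_n} -> ratsection E}) :
  is_coboundary p (c : cochain_space E) <->
  exists b : {ffun {set 'I_n} -> ratsection E},
    [/\ forall I, is_section I (b I), b set0 = 0,
        forall I, #|I| != p -> b I = 0 & c = cobd b].
Proof.
case: p => [|p] /=.
  split=> [->|[b [_ b0 bp ->]]].
    exists 0; rewrite cobd0; split=> // [I||I _]; rewrite ffunE //.
    by split=> [i j|i _ a]; rewrite !ffunE ?mul0mx // mxE; apply: regular0.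
  rewrite (_ : b = 0) ?cobd0 //; apply/ffunP=> I; rewrite [RHS]ffunE.
  by have [->|I0] := eqVneq I set0 => //; apply: bp; rewrite cards_eq0.
split=> [[b [bP ->]]|[b [bS b0 bp ->]]]; exists b; rewrite cech_dE.
  split=> // [I||I /eqP Ip]; try by case: (bP I).
    by have [_ ->] := bP set0; rewrite // cards0.
  by have [_ ->] := bP I.
by split=> // I; split=> // /eqP; apply: bp.
Qed.

Lemma is_cocycleP p (c : {ffun {set 'I_n} -> ratsection E}) :
  is_cocycle p (c : cochain_space E) <->
  [/\ forall I, is_section I (c I), forall I, #|I| != p.+1 -> c I = 0 & cobd c = 0].
Proof.
rewrite /is_cocycle cech_dE; split=> [[cP ->]|[cS cp ->]]; split=> // I.
- by case: (cP I).
- by case: (cP I) => _ H /eqP; apply: H.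
- by split=> // /eqP; apply: cp.
Qed.

Definition weight_zero I (a : 'rV[k]_r) :=
  (I = set0 -> a = 0) /\ is_section I (log_section (cmx a)).

Lemma weight_zero_supported I e a :
  weight_zero I a <-> supported_sections T i0 (ones n e) e I a.
Proof. by rewrite /supported_sections /wt_section laurent_ones. Qed.

Fact weight_zero_set0 a : weight_zero set0 a <-> a = 0.
Proof. by split=> [[->]//|->]; split=> //; apply: is_section_set0. Qed.

(** Constant coordinates are the case m = 0, e = 0 of [wt_sectionP]: the only poles come from the
    frame. *)
Fact weight_zeroP I i a : i \in I -> weight_zero I a <->
  (forall w, ~~ ([set t | (0 < twt T i w t)%N] \subset I) ->
    a *m (tM T i0 i *m tE T w *m tM T i i0) = 0).
Proof.
move=> iI; rewrite (weight_zero_supported I 0).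
have me : mdeg (ones n 0) = (n * 0)%N by rewrite mdeg_ones.
split=> [[_ /(wt_sectionP _ _ _ iI me) H] w /subsetPn[t]|H].
  by rewrite inE => tw tI; apply/mul_frame_eq0/H; [exact: tI | rewrite mnmE].
split=> [I0|]; first by rewrite I0 inE in iI.
apply/(wt_sectionP _ _ _ iI me) => w t tI; rewrite mnmE => tw; apply/mul_frame_eq0/H.
by apply/subsetPn; exists t; rewrite ?inE.
Qed.

Fact weight_support_size i w : (#|[set t | (0 < twt T i w t)%N]| <= d)%N.
Proof.
apply: leq_trans (twt_deg i w); rewrite mdegE -sum1_card big_mkcond /=.
by apply: leq_sum => t _; rewrite inE; case: ifP.
Qed.

Definition weight_system : csystem k n r d :=
  CSystem (@frame_orth k n d E T i0) (sum_frame T i0) weight_support_size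
    weight_zero_set0 weight_zeroP.

Definition laurent_section e (g : 'rV[{mpoly k[n]}]_r) : ratsection E :=
  log_section (laurent e g).

Fact laurent_section_zmod_morphism e : zmod_morphism (laurent_section e).
Proof.
move=> g h; rewrite /laurent_section raddfB; exact: (raddfB log_section).
Qed.

HB.instance Definition _ e := GRing.isZmodMorphism.Build
  'rV[{mpoly k[n]}]_r (ratsection E) (laurent_section e)
  (laurent_section_zmod_morphism e).

Lemma laurent_section_inj e : injective (laurent_section e).
Proof. exact: inj_comp (can_inj (log_sectionK T i0)) (@laurent_inj k n E e). Qed.

Definition laurents e (g : {ffun {set 'I_n} -> 'rV[{mpoly k[n]}]_r}) :
  {ffun {set 'I_n} -> ratsection E} :=
  [ffun I : {set 'I_n} => laurent_section e (g I)].

Lemma laurentsE e g I : laurents e g I = laurent_section e (g I).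
Proof. exact: ffunE. Qed.

Lemma cobd_laurents e g : cobd (laurents e g) = laurents e (cobd g).
Proof. by apply/ffunP=> I; rewrite (cobd_map (laurent_section e)) ffunE. Qed.

Lemma laurents_inj e : injective (laurents e).
Proof.
move=> g h /ffunP gh; apply/ffunP=> I; apply: (@laurent_section_inj e).
exact: etrans (esym (laurentsE e g I)) (etrans (gh I) (laurentsE e h I)).
Qed.

Fact laurents_zmod_morphism e : zmod_morphism (laurents e).
Proof.
move=> g h; apply/ffunP=> I; apply: etrans (laurentsE _ _ _) _; rewrite ffun_subE.
apply: etrans (laurent_section_zmod_morphism e _ _) (esym _).
apply: etrans (ffun_subE _ _ _) _.
exact: (congr2 (fun s t : ratsection E => s - t) (laurentsE e g I) (laurentsE e h I)).
Qed.

HB.instance Definition _ e := GRing.isZmodMorphism.Build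
  {ffun {set 'I_n} -> 'rV[{mpoly k[n]}]_r} {ffun {set 'I_n} -> ratsection E}
  (laurents e) (laurents_zmod_morphism e).

Definition monomxs m (a : {ffun {set 'I_n} -> 'rV[k]_r}) :
  {ffun {set 'I_n} -> 'rV[{mpoly k[n]}]_r} := [ffun I : {set 'I_n} => monomx m (a I)].

Definition coefmxs m (g : {ffun {set 'I_n} -> 'rV[{mpoly k[n]}]_r}) :
  {ffun {set 'I_n} -> 'rV[k]_r} := [ffun I : {set 'I_n} => coefmx m (g I)].

Lemma cobd_coefmxs m g : cobd (coefmxs m g) = coefmxs m (cobd g).
Proof. by apply/ffunP=> I; rewrite (cobd_map (@coefmx k n E m)) ffunE. Qed.

Fact monomx_zmod_morphism m : zmod_morphism (@monomx k n E m).
Proof.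
move=> a b; rewrite /monomx -scalerBr; congr (_ *: _); exact: raddfB.
Qed.

HB.instance Definition _ m := GRing.isZmodMorphism.Build
  'rV[k]_r 'rV[{mpoly k[n]}]_r (@monomx k n E m) (monomx_zmod_morphism m).

Lemma cobd_monomxs m a : cobd (monomxs m a) = monomxs m (cobd a).
Proof. by apply/ffunP=> I; rewrite (cobd_map (@monomx k n E m)) ffunE. Qed.

Lemma const_cochain_laurents e a :
  const_cochain a = laurents e (monomxs (ones n e) a).
Proof.
apply/ffunP=> I; apply: etrans (const_cochainE a I) (esym _).
apply: etrans (laurentsE _ _ _) _; congr log_section.
by rewrite ffunE laurent_ones.
Qed.

Lemma const_cochain_cobd a :
  cobd (const_cochain a : {ffun {set 'I_n} -> ratsection E}) = const_cochain (cobd a).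
Proof. by rewrite !(const_cochain_laurents 0) cobd_laurents cobd_monomxs. Qed.

Lemma const_cochain_supported p (a : {ffun {set 'I_n} -> 'rV[k]_r}) :
  (forall I, csB weight_system I (a I)) -> (forall I, #|I| != p -> a I = 0) ->
  [/\ forall I, is_section I (const_cochain a I),
      const_cochain a set0 = 0 & forall I, #|I| != p -> const_cochain a I = 0].
Proof.
have c0 I : a I = 0 -> const_cochain a I = 0.
  move=> aI; apply: etrans (const_cochainE a I) _; rewrite aI [cmx 0]map_mx0.
  exact: log_section0.
move=> aB ap; split=> [I||I Ip]; last by apply/c0/ap.
  by rewrite const_cochainE; case: (aB I).
by apply: c0; apply/(csB_set0 weight_system).
Qed.

Lemma laurents_sum e (g : {ffun {set 'I_n} -> 'rV[{mpoly k[n]}]_r}) :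
  exists2 ms : seq 'X_{1..n}, uniq ms /\ ones n e \in ms &
    g = \sum_(m <- ms) monomxs m (coefmxs m g).
Proof.
(* The exponent [ones n e], which represents weight zero, is put in the list by force so that it can
   always be split off. *)
pose ms := undup (ones n e :: flatten [seq msupp (g s.1 0 s.2) |
   s <- enum {: {set 'I_n} * 'I_r}]).
have ums : uniq ms by apply: undup_uniq.
exists ms; first by rewrite ums mem_undup inE eqxx.
apply/ffunP=> I; rewrite sum_ffunE; under eq_bigr do rewrite !ffunE.
apply: monomx_sum => // b m mg; rewrite mem_undup inE; apply/orP; right.
by apply/flattenP; exists (msupp (g I 0 b)) => //; apply/mapP; exists (I, b); rewrite ?mem_enum.
Qed.

Lemma is_section_laurent_sum I e (ms : seq 'X_{1..n}) (P : pred 'X_{1..n})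
    (x : 'X_{1..n} -> 'rV[{mpoly k[n]}]_r) :
  (forall m, m \in ms -> P m -> is_section I (laurent_section e (x m))) ->
  is_section I (laurent_section e (\sum_(m <- ms | P m) x m)).
Proof.
move=> xS; rewrite big_seq_cond; elim/big_ind: _ => [|u v uS vS|m /andP[mms Pm]].
- rewrite (raddf0 (laurent_section e)).
  by split=> [i j|i _ b]; rewrite !ffunE ?mul0mx // mxE; apply: regular0.
- have := @is_section_closed k n d E T i0 I (laurent e u) (laurent e v) 1 uS vS.
  rewrite rmorph1 scale1r => uvS; rewrite /laurent_section.
  have -> : laurent e (u + v) = laurent e u + laurent e v by exact: (raddfD (laurent e)).
  exact: uvS.
- exact: xS.
Qed.

Lemma coefmxs_supported e (g : {ffun {set 'I_n} -> 'rV[{mpoly k[n]}]_r}) :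
  (forall I b, g I 0 b \is (n * e).-homog) ->
  (forall I, is_section I (laurents e g I)) -> g set0 = 0 ->
  forall m, mdeg m = (n * e)%N ->
  forall I, supported_sections T i0 m e I (coefmxs m g I).
Proof.
move=> gh gS g0 m me I; rewrite ffunE; split=> [->|]; first by rewrite g0 raddf0.
by apply: (is_section_coef (gh I) me); have := gS I; rewrite laurentsE.
Qed.

Lemma laurents_eq0 e g I : laurents e g I = 0 -> g I = 0.
Proof.
rewrite laurentsE => gI; apply: (@laurent_section_inj e); rewrite gI.
exact: esym (raddf0 (laurent_section e)).
Qed.

(** Taking the coefficient of a monomial commutes with the differential and preserves sections. So
    the finitely many components of nonzero weight of a cocycle bound separately, and the weight
    zero component of a primitive is a primitive of weight zero. *)
Lemma basis_mod_cohomology p (J : finType) (z : J -> {ffun {set 'I_n} -> 'rV[k]_r}) :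
  basis_mod (cocycle (csB weight_system) p.+1) (coboundary (csB weight_system) p.+1) z ->
  basis_mod (@is_cocycle k n E p) (@is_coboundary k n E p) (const_cochain \o z).
Proof.
apply: basis_mod_push.
- by apply: cocycle_closed => I; apply: csB_closed.
- exact: is_coboundary_closed.
- move=> a [aB ap da]; apply/is_cocycleP.
  have [cS _ c0] := const_cochain_supported aB ap.
  by split=> //; rewrite const_cochain_cobd da linear0.
- move=> _ [b [bB bp ->]]; apply/is_coboundaryP; exists (const_cochain b).
  have [cS c0 cp] := const_cochain_supported bB bp.
  by rewrite const_cochain_cobd.
- move=> c /is_cocycleP[cS cp dc].
  have c0 : c set0 = 0 by apply: cp; rewrite cards0.
  have [e [g [gh cE]]] := laurent_cochain cS c0.
  have {}cE : c = laurents e g by [].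
  have gp I : #|I| != p.+1 -> g I = 0.
    by move=> Ip; apply: (@laurents_eq0 e); rewrite -cE cp.
  have dg : cobd g = 0.
    by apply: (@laurents_inj e); rewrite -cobd_laurents -cE dc raddf0.
  have g0 : g set0 = 0 by apply: gp; rewrite cards0.
  have gS I : is_section I (laurents e g I) by rewrite -cE.
  have dcoef m : cobd (coefmxs m g) = 0.
    by rewrite cobd_coefmxs dg; apply/ffunP=> I; rewrite !ffunE raddf0.
  have coefp m I : #|I| != p.+1 -> coefmxs m g I = 0.
    by move=> Ip; rewrite ffunE gp // raddf0.
  have /choice[b bP] m : exists b : {ffun {set 'I_n} -> 'rV[k]_r}, m != ones n e ->
      [/\ forall I, wt_section T i0 m e I (b I), forall I, #|I| != p -> b I = 0,
          b set0 = 0 & coefmxs m g = cobd b].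
    have [me|me] := eqVneq (mdeg m) (n * e)%N; last first.
      exists 0 => _; split=> [I|I _||]; rewrite ?ffunE ?cobd0 //.
        by case: (wt_section_closed T i0 m e I).
      by apply/ffunP=> I; rewrite ffunE (coefmx_eq0_deg (gh I)) // ffunE.
    have [->|mne] := eqVneq m (ones n e); first by exists 0.
    have [||b bS bE] := nonzero_weight_acyclic dn me _ (coefmxs_supported gh gS g0 me).
    + exact/eqP.
    + exact: dcoef.
    (* The primitive supplied by acyclicity is not concentrated in one size; its part of size p is
       enough because the component of [c] has size p.+1. *)
    exists (trunc p b) => _; split=> [I|I /negPf Ip||].
    + rewrite ffunE; case: eqP => _; last by case: (wt_section_closed T i0 m e I).
      by case: (bS I).
    + by rewrite ffunE Ip.
    + by rewrite ffunE; case: eqP => // _; case: (bS set0) => ->.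
    + rewrite cobd_trunc -bE; apply/ffunP=> I; rewrite [RHS]ffunE.
      by case: eqP => // /eqP /coefp.
  have [ms [ums msones] gE] := laurents_sum e g.
  exists (coefmxs (ones n e) g).
    split=> [I|I Ip|]; [|exact: coefp|exact: dcoef].
    apply/(weight_zero_supported I e); apply: coefmxs_supported => //.
    exact: mdeg_ones.
  pose h := \sum_(m <- ms | m != ones n e) monomxs m (b m).
  have hI I : h I = \sum_(m <- ms | m != ones n e) monomx m (b m I).
    by rewrite sum_ffunE; apply: eq_bigr => m _; rewrite ffunE.
  apply/is_coboundaryP; exists (laurents e h); split=> [I||I Ip|].
  + rewrite laurentsE hI; apply: is_section_laurent_sum => m _ mne.
    by have [bS _ _ _] := bP m mne; apply: bS.
  + rewrite laurentsE hI big1 ?raddf0 // => m mne.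
    by have [_ _ -> _] := bP m mne; rewrite raddf0.
  + rewrite laurentsE hI big1 ?raddf0 // => m mne.
    by have [_ bm0 _ _] := bP m mne; rewrite (bm0 I Ip) raddf0.
  + rewrite cobd_laurents cE.
    apply: etrans (congr1 (fun v : {ffun {set 'I_n} -> ratsection E} => laurents e g - v)
      (const_cochain_laurents e (coefmxs (ones n e) g))) _.
    apply: etrans (esym (raddfB (laurents e) _ _)) _; congr (laurents e _).
    have {1}-> : g = monomxs (ones n e) (coefmxs (ones n e) g) +
        \sum_(m <- ms | m != ones n e) monomxs m (coefmxs m g).
      by rewrite {1}gE (bigD1_seq (ones n e)).
    rewrite addrC addKr cobd_sum.
    apply: eq_bigr => m mne; rewrite cobd_monomxs.
    by have [_ _ _ ->] := bP m mne.
- move=> a [aB ap da] /is_coboundaryP[b [bS b0 bp aE]].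
  have [e [g [gh bE]]] := laurent_cochain bS b0.
  have {}bE : b = laurents e g by [].
  have g0 : g set0 = 0 by apply: (@laurents_eq0 e); rewrite -bE.
  have gS I : is_section I (laurents e g I) by rewrite -bE.
  exists (coefmxs (ones n e) g); split=> [I|I Ip|].
  + apply/(weight_zero_supported I e); apply: coefmxs_supported => //.
    exact: mdeg_ones.
  + rewrite ffunE (_ : g I = 0) ?raddf0 //; apply: (@laurents_eq0 e).
    by rewrite -bE bp.
  + rewrite cobd_coefmxs; apply/ffunP=> I; rewrite [RHS]ffunE.
    have -> : cobd g = monomxs (ones n e) a.
      apply: (@laurents_inj e); apply: etrans (esym (cobd_laurents e g)) _.
      apply: etrans (congr1 (@cobd _ _) (esym bE)) _.
      by apply: etrans (esym aE) _; apply: const_cochain_laurents.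
    by rewrite ffunE coefmx_monomx eqxx.
Qed.

End WeightZero.

(** * Tensor products *)

Section TensorMatrices.
Variable R : comNzRingType.

Lemma tensmx1 m n : (1%:M : 'M[R]_m) *t (1%:M : 'M[R]_n) = 1%:M.
Proof.
apply/matrixP=> a b; case: (mxtens_indexP a) => a1 a2.
case: (mxtens_indexP b) => b1 b2; rewrite tensmxE !mxE -natrM mulnb.
by rewrite (inj_eq (can_inj (@mxtens_indexK _ _))) -pair_eqE.
Qed.

Lemma tensmxZ m n p q a b (A : 'M[R]_(m, n)) (B : 'M[R]_(p, q)) :
  (a *: A) *t (b *: B) = (a * b) *: (A *t B).
Proof.
apply/matrixP=> s t; case: (mxtens_indexP s) => s1 s2.
case: (mxtens_indexP t) => t1 t2.
by rewrite tensmxE [RHS]mxE tensmxE !mxE mulrACA.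
Qed.

Lemma tensmx_sum (I J : finType) m n p q (A : I -> 'M[R]_(m, n))
    (B : J -> 'M[R]_(p, q)) :
  (\sum_i A i) *t (\sum_j B j) = \sum_(s : I * J) A s.1 *t B s.2.
Proof.
apply/matrixP=> s t; case: (mxtens_indexP s) => s1 s2.
case: (mxtens_indexP t) => t1 t2.
rewrite tensmxE !summxE big_distrlr pair_big /=.
by apply: eq_bigr => -[i j] _; rewrite tensmxE.
Qed.

Definition tens_mx m n (u : 'rV[R]_(m * n)) : 'M[R]_(m, n) :=
  \matrix_(i, j) u 0 (mxtens_index (i, j)).

Definition tens_row m n (t : 'M[R]_(m, n)) : 'rV[R]_(m * n) :=
  \row_s t (mxtens_unindex s).1 (mxtens_unindex s).2.

Lemma tens_rowK m n : cancel (@tens_row m n) (@tens_mx m n).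
Proof. by move=> t; apply/matrixP=> i j; rewrite !mxE mxtens_indexK. Qed.

Lemma tens_mxK m n : cancel (@tens_mx m n) (@tens_row m n).
Proof.
move=> u; apply/rowP=> s; rewrite !mxE; case: (mxtens_indexP s) => i j.
by rewrite mxtens_indexK.
Qed.

Fact tens_row_linear m n : linear (@tens_row m n).
Proof. by move=> a t t'; apply/rowP=> s; rewrite !mxE. Qed.

HB.instance Definition _ m n := GRing.isLinear.Build R 'M[R]_(m, n)
  'rV[R]_(m * n) _ (@tens_row m n) (@tens_row_linear m n).

Lemma tens_mxM m n p q (u : 'rV[R]_(m * n)) (A : 'M[R]_(m, p)) (B : 'M[R]_(n, q)) :
  tens_mx (u *m (A *t B)) = A^T *m tens_mx u *m B.
Proof.
apply/matrixP=> i j; rewrite !mxE; under [RHS]eq_bigr do rewrite !mxE mulr_suml.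
rewrite exchange_big pair_big /= (reindex (@mxtens_index m n)) /=.
  by apply: eq_bigr => -[a b] _; rewrite tensmxE !mxE mulrA [_ * A _ _]mulrC.
by exists (@mxtens_unindex m n) => s _; rewrite ?mxtens_indexK ?mxtens_unindexK.
Qed.

End TensorMatrices.

Section TensorToric.
Variables (k : fieldType) (n d1 d2 : nat) (E F : vbundle k n).
Variables (T1 : toric E d1) (T2 : toric F d2).
Local Notation tb := (tensor_bundle E F).

Definition tensor_wt i (w : tW T1 * tW T2) := (twt T1 i w.1 + twt T2 i w.2)%MM.
Definition tensor_E (w : tW T1 * tW T2) : 'M[k]_(vrank tb) := tE T1 w.1 *t tE T2 w.2.
Definition tensor_M i j : 'M[k]_(vrank tb) := tM T1 i j *t tM T2 i j.
Definition tensor_D i : 'M[ratfun k n]_(vrank tb) := tD T1 i *t tD T2 i.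
Definition tensor_D' i : 'M[ratfun k n]_(vrank tb) := tD' T1 i *t tD' T2 i.

Lemma cmxT p q s t (A : 'M[k]_(p, q)) (B : 'M[k]_(s, t)) :
  cmx n (A *t B) = cmx n A *t cmx n B.
Proof. exact: map_mxT. Qed.

Fact tensor_M_id i : tensor_M i i = 1%:M.
Proof. by rewrite /tensor_M !tM_id tensmx1. Qed.

Fact tensor_M_comp i j l : tensor_M i j *m tensor_M j l = tensor_M i l.
Proof. by rewrite /tensor_M tensmx_mul !tM_comp. Qed.

Fact tensor_DK i : tensor_D i *m tensor_D' i = 1%:M.
Proof. by rewrite /tensor_D /tensor_D' tensmx_mul !tDK tensmx1. Qed.

Fact tensor_D_trans i j :
  trans tb i j *m tensor_D j = tensor_D i *m cmx n (tensor_M i j).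
Proof.
rewrite /tensor_D /tensor_M cmxT /= /tensor_trans.
by rewrite [LHS]tensmx_mul [RHS]tensmx_mul !tD_trans.
Qed.

Fact tensor_E_orth w w' : tensor_E w *m tensor_E w' = if w == w' then tensor_E w else 0.
Proof.
case: w w' => [a b] [a' b']; rewrite /tensor_E tensmx_mul !tE_orth -pair_eqE /=.
by case: eqP => _; case: eqP => _; rewrite /= ?tens0mx ?tensmx0.
Qed.

Fact tensor_E_sum : \sum_w tensor_E w = 1%:M.
Proof. by rewrite /tensor_E -tensmx_sum !tE_sum tensmx1. Qed.

Fact tensor_wt_self i w : tensor_wt i w i = 0%N.
Proof. by rewrite mnmDE !twt_self. Qed.

Fact tensor_wt_deg i w : (mdeg (tensor_wt i w) <= d1 + d2)%N.
Proof. by rewrite mdegD leq_add ?twt_deg. Qed.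

Fact tensor_D_E i w : tensor_D i *m cmx n (tensor_E w) =
  (mono k (tensor_wt i w) / @Defs.coord k n i ^+ mdeg (tensor_wt i w)) *: cmx n (tensor_E w).
Proof.
rewrite /tensor_D /tensor_E cmxT.
rewrite [LHS]tensmx_mul !tD_E tensmxZ; congr (_ *: _).
by rewrite mulf_div -monoD mdegD exprD.
Qed.

Definition tensor_toric : toric tb (d1 + d2) :=
  Toric tensor_M_id tensor_M_comp tensor_DK tensor_D_trans tensor_E_orth
    tensor_E_sum tensor_wt_self tensor_wt_deg tensor_D_E.

(** The support of a pair of weights is the union of the two supports, and its projector is the
    tensor product of the two. Summing over the projectors of one factor isolates the condition on
    the other. *)
Lemma weight_zero_tensor i0 (I : {set 'I_n}) (u : 'rV[k]_(vrank tb)) :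
  csB (weight_system tensor_toric i0) I u <->
  tens_in (weight_system T1 i0) (weight_system T2 i0) I (tens_mx u).
Proof.
case: (set_0Vmem I) => [->|[i iI]].
  split=> [/(csB_set0 (weight_system tensor_toric i0)) ->|[/cols_in_set0 u0 _]].
    have -> : tens_mx (0 : 'rV[k]_(vrank E * vrank F)) = 0.
      by apply/matrixP=> a b; rewrite !mxE.
    split=> [j|j]; first by rewrite col0 trmx0; case: (csB_closed (weight_system T1 i0) set0).
    by rewrite row0; case: (csB_closed (weight_system T2 i0) set0).
  apply/(csB_set0 (weight_system tensor_toric i0)).
  by rewrite -[u]tens_mxK u0 linear0.
have eE w : csE (weight_system tensor_toric i0) i w =
    csE (weight_system T1 i0) i w.1 *t csE (weight_system T2 i0) i w.2.
  by rewrite /= /tensor_M /tensor_E !tensmx_mul.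
have eS w : csS (weight_system tensor_toric i0) i w =
    csS (weight_system T1 i0) i w.1 :|: csS (weight_system T2 i0) i w.2.
  by apply/setP=> t; rewrite !inE mnmDE addn_gt0.
rewrite (csBP _ _ iI) /tens_in (cols_inP _ _ iI) (rows_inP _ _ iI).
have uE w : u *m csE (weight_system tensor_toric i0) i w = 0 <->
    (csE (weight_system T1 i0) i w.1)^T *m tens_mx u *m csE (weight_system T2 i0) i w.2 = 0.
  rewrite eE -tens_mxM; split=> [->|H].
    by apply/matrixP=> a b; rewrite !mxE.
  by rewrite -[LHS]tens_mxK H linear0.
split=> [H|[H1 H2] w wI].
  split=> w wI.
    rewrite -[LHS]mulmx1 -(csE_sum (weight_system T2 i0) i) mulmx_sumr big1 // => w' _.
    apply: (proj1 (uE (w, w'))); apply: H; rewrite eS.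
    by apply: contra wI; rewrite subUset => /andP[].
  rewrite -[tens_mx u]mul1mx -trmx1 -(csE_sum (weight_system T1 i0) i).
  rewrite (raddf_sum (@trmx k _ _)) mulmx_suml mulmx_suml big1 // => w' _.
  apply: (proj1 (uE (w', w))); apply: H; rewrite eS.
  by apply: contra wI; rewrite subUset => /andP[].
apply/uE; move: wI; rewrite eS subUset negb_and => /orP[wI|wI].
  by rewrite H1 // mul0mx.
by rewrite -mulmxA H2 // mulmx0.
Qed.

End TensorToric.

(** * Polynomial functors applied to the cotangent bundle *)

Section TorusWeights.
Import VectorInternalTheory passmx.

Variables (k : closedFieldType) (d : nat) (P : polyFunctor k d) (m : nat).
Local Notation r := (pf_rank P m).

Definition generic_torus : 'M[{mpoly k[m]}]_r :=
  pf_mx_ext P (@mpolyC m k) (diag_mx (\row_a 'X_a)).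

Lemma pf_diagE (S : comNzRingType) (f : {rmorphism k -> S}) (t : 'rV[S]_m) :
  pf_mx_ext P f (diag_mx t) = map_mx (mmap f (t 0)) generic_torus.
Proof.
have fC c : mmap f (t 0) (@mpolyC m k c) = f c by rewrite mmapC.
rewrite /generic_torus (pf_mx_ext_map P _ fC).
congr pf_mx_ext; apply/matrixP=> a b; rewrite !mxE raddfMn /=.
by rewrite mmapX mmap1U.
Qed.

(** The coefficient of X^w in P(diag X), which is the projector onto the weight space of [w]. *)
Definition weight_mx (w : 'X_{1..m}) : 'M[k]_r := map_mx (mcoeff w) generic_torus.

Lemma pf_mx_diag s : pf_mx P (diag_mx s) = map_mx (meval (s 0)) generic_torus.
Proof. by rewrite -pf_mx_extE pf_diagE. Qed.

(* Coefficient of X^w in P(diag s) P(diag X) = P(diag (s X)). *)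
Lemma pf_mx_diag_weight (s : 'rV[k]_m) w :
  pf_mx P (diag_mx s) *m weight_mx w = ('X_[w]).@[s 0] *: weight_mx w.
Proof.
have : map_mx (@mpolyC m k) (pf_mx P (diag_mx s)) *m generic_torus =
    pf_mx_ext P (@mpolyC m k) (diag_mx (\row_a ((s 0 a)%:MP * 'X_a))).
  rewrite -pf_mx_extE (pf_mx_ext_map P (f' := @mpolyC m k)) // -pf_mx_extM.
  congr pf_mx_ext; rewrite map_diag_mx mulmx_diag; congr diag_mx.
  by apply/rowP=> a; rewrite !mxE.
rewrite pf_diagE /weight_mx; move: (pf_mx P (diag_mx s)) generic_torus => A G.
move/matrixP=> E; apply/matrixP=> a b.
have := congr1 (mcoeff w) (E a b); rewrite !mxE raddf_sum.
under eq_bigr do rewrite !mxE /= mcoeffCM.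
rewrite (_ : (mmap _ _ _)@_w = ('X_[w]).@[s 0] * (G a b)@_w).
  by move=> <-; apply: eq_bigr => c _; rewrite !mxE.
have mmap1E v : mmap1 ((\row_c ((s 0 c)%:MP * 'X_c) : 'rV[{mpoly k[m]}]_m) 0) v =
    ('X_[v]).@[s 0] *: 'X_[v].
  rewrite /mmap1 mevalX [in RHS]mpolyXE_id -mul_mpolyC rmorph_prod -big_split.
  by apply: eq_bigr => c _; rewrite mxE exprMn rmorphXn.
rewrite /mmap raddf_sum /=; under eq_bigr do rewrite mcoeffCM mmap1E mcoeffZ mcoeffX.
have [wG|wG] := boolP (w \in msupp (G a b)).
  rewrite (bigD1_seq w) //= eqxx mulr1 mulrC big1 ?addr0 // => v /negPf ->.
  by rewrite !mulr0.
rewrite (memN_msupp_eq0 wG) mulr0 big1_seq // => v /andP[_ vG].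
by case: eqP => [vw|_]; [rewrite -vw vG in wG | rewrite !mulr0].
Qed.

(** An algebraically closed field is infinite, so the identity for diagonal matrices over k implies
    the one for the generic diagonal matrix. *)
Lemma generic_torus_weight w : generic_torus *m map_mx (@mpolyC m k) (weight_mx w) =
  'X_[w] *: map_mx (@mpolyC m k) (weight_mx w).
Proof.
apply/matrixP=> a b; apply: meval_inj => v.
have := pf_mx_diag_weight (\row_c v c) w; rewrite pf_mx_diag /weight_mx.
have sv c : (\row_c v c : 'rV[k]_m) 0 c = v c by rewrite mxE.
move: generic_torus => G /matrixP/(_ a b); rewrite ![in LHS]mxE ![in RHS]mxE.
rewrite (meval_eq _ sv) => E; rewrite !mxE mevalM mevalC -E raddf_sum.
by apply: eq_bigr => c _; rewrite /= !mxE mevalM mevalC (meval_eq _ sv).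
Qed.

(** Compare the coefficients of X^w in [generic_torus_weight] for [w']. *)
Lemma weight_mx_orth w w' :
  weight_mx w *m weight_mx w' = if w == w' then weight_mx w else 0.
Proof.
have GA (A : 'M[k]_r) : map_mx (mcoeff w) (generic_torus *m map_mx (@mpolyC m k) A) =
    weight_mx w *m A.
  rewrite /weight_mx; move: generic_torus => G.
  apply/matrixP=> a b; rewrite !mxE raddf_sum; apply: eq_bigr => c _.
  by rewrite /= !mxE mulrC mcoeffCM mulrC.
rewrite -GA generic_torus_weight.
have [<-|ww'] := eqVneq w w'.
  move: (weight_mx w) => A; apply/matrixP=> a b.
  by rewrite !mxE mulrC mcoeffCM mcoeffX eqxx mulr1.
move: (weight_mx w') => A; apply/matrixP=> a b.
by rewrite !mxE mulrC mcoeffCM mcoeffX eq_sym (negPf ww') mulr0.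
Qed.

Lemma pf_mx_scalar c : pf_mx P (c%:M : 'M_m) = (c ^+ d)%:M.
Proof.
have -> : pf_mx P (c%:M : 'M_m) = c ^+ d *: pf_mx P (1%:M : 'M_m).
  rewrite /pf_mx; have -> : linfun (mulmxr c%:M) = c *: \1%VF :> 'Hom('rV[k]_m, 'rV[k]_m).
    by apply/lfunP=> u; rewrite scale_lfunE lfunE id_lfunE /= mul_mx_scalar.
  have -> : linfun (mulmxr 1%:M) = \1%VF :> 'Hom('rV[k]_m, 'rV[k]_m).
    by apply/lfunP=> u; rewrite lfunE id_lfunE /= mulmx1.
  by rewrite pf_map_homothety pf_map_id linearZ.
by rewrite pf_mx1 scalemx1.
Qed.

(** A scalar matrix c acts on the weight space of [w] by c^(mdeg w), and by c^d since P has degree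
    d; some c in k tells these two powers apart. *)
Lemma weight_mx_deg w : mdeg w != d -> weight_mx w = 0.
Proof.
move=> wd; pose q : {poly k} := 'X^(mdeg w) - 'X^d.
have q0 : q != 0.
  apply/eqP => /(congr1 (fun q : {poly k} => q`_(mdeg w))) /eqP.
  by rewrite coefB !coefXn coef0 eqxx (negPf wd) subr0 oner_eq0.
have /closed_nonrootP[c] := q0; rewrite /root hornerD hornerN !hornerXn subr_eq0 => cE.
have := pf_mx_diag_weight (const_mx c) w.
rewrite diag_const_mx pf_mx_scalar mul_scalar_mx mevalX.
under eq_bigr do rewrite mxE; rewrite prodrXr -mdegE => /eqP.
rewrite -subr_eq0 -scalerBl scaler_eq0 subr_eq0 eq_sym (negPf cE) /=.
by move/eqP.
Qed.

(** The generic torus evaluated at (1, .., 1), where every monomial becomes 1 and P gives the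
    identity. By [weight_mx_deg] the weights of degree at most d suffice. *)
Lemma weight_mx_sum : \sum_(w : 'X_{1..m < d.+1}) weight_mx w = 1%:M.
Proof.
have := pf_mx1 P m; rewrite -diag_const_mx pf_mx_diag => <-.
have Gd a b w : w \in msupp (generic_torus a b) -> mdeg w = d.
  rewrite mcoeff_msupp; apply: contraNeq => /weight_mx_deg /matrixP/(_ a b).
  by rewrite [LHS]mxE [RHS]mxE => ->.
rewrite /weight_mx; move: generic_torus Gd => G Gd.
apply/matrixP=> a b; rewrite summxE [RHS]mxE [X in _ = X.@[_]](@mpolywE _ _ d.+1).
  rewrite raddf_sum; apply: eq_bigr => w _ /=; rewrite mxE mevalZ mevalX.
  by rewrite big1 ?mulr1 // => c _; rewrite mxE expr1n.
rewrite msizeE; apply/bigmax_leqP_seq => w wG _; by rewrite (Gd a b w wG).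
Qed.

Lemma pf_diag_weight (S : comNzRingType) (f : {rmorphism k -> S}) (t : 'rV[S]_m) w :
  pf_mx_ext P f (diag_mx t) *m map_mx f (weight_mx w) =
  (\prod_a t 0 a ^+ w a) *: map_mx f (weight_mx w).
Proof.
have fC c : mmap f (t 0) (@mpolyC m k c) = f c by rewrite mmapC.
have -> : map_mx f (weight_mx w) = map_mx (mmap f (t 0)) (map_mx (@mpolyC m k) (weight_mx w)).
  by rewrite -map_mx_comp; apply: eq_map_mx => c; rewrite /= fC.
rewrite pf_diagE -map_mxM generic_torus_weight map_mxZ; congr (_ *: _).
by rewrite /= mmapX.
Qed.

End TorusWeights.

Fact dlog_field_identity (F : fieldType) (xi xj xa xb : F) (ac ic : bool) :
  xi != 0 -> xj != 0 -> (ac -> xa = xb) -> (ic -> xi = xb) ->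
  (xj / xi *+ ac - xa * xj / xi ^+ 2 *+ ic) * (xb / xj) =
  xa / xi * (ac%:R - ic%:R).
Proof.
move=> xi0 xj0; case: ac => [/(_ isT) ->|_]; case: ic => [/(_ isT) <-|_] /=;
  by rewrite ?mulr0n ?mulr1n; field; rewrite ?xi0 ?xj0.
Qed.

(** * The logarithmic frames of P(Omega) *)

Section OmegaToric.
Variables (k : closedFieldType) (n d : nat) (P : polyFunctor k d).
Local Notation K := (ratfun k n).
Local Notation X := (@Defs.coord k n).
Local Notation E := (pf_bundle P (omega k n)).

(* The forms d log (x_t / x_i) with t <> i, expressed in the d log (x_s / x_j). *)
Definition dlog_mx (i j : 'I_n) : 'M[k]_n.-1 := \matrix_(a, b)
  ((fintype.lift i a == fintype.lift j b)%:R - (i == fintype.lift j b)%:R).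

Definition dlog_row i : 'rV[K]_n.-1 := \row_a (X (fintype.lift i a) / X i).

Definition dlog_row' i : 'rV[K]_n.-1 := \row_a (X i / X (fintype.lift i a)).

Lemma dlog_rowK i : diag_mx (dlog_row i) *m diag_mx (dlog_row' i) = 1%:M.
Proof.
rewrite mulmx_diag; apply/matrixP=> a b; rewrite !mxE; congr (_ *+ _).
by rewrite mulr_divV ?coord_neq0.
Qed.

(** This combines d(x_t / x_i) = (x_t / x_i) d log (x_t / x_i) with d log (x_t / x_i) = d log (x_t /
    x_j) - d log (x_i / x_j), whose coefficients are constant. *)
Lemma omega_trans_dlog i j : omega_trans k i j *m diag_mx (dlog_row j) =
  diag_mx (dlog_row i) *m cmx n (dlog_mx i j).
Proof.
rewrite mul_mx_diag mul_diag_mx; apply/matrixP=> a b; rewrite !mxE.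
rewrite (rmorphB (@ratconst k n)) !(rmorph_nat (@ratconst k n)).
apply: dlog_field_identity; try exact: coord_neq0.
  by move=> /eqP ->.
by move=> /eqP <-.
Qed.

Lemma cmx_inj p q : injective (@cmx k n p q).
Proof. exact: map_mx_inj. Qed.

Lemma dlog_mxE i j : cmx n (dlog_mx i j) =
  diag_mx (dlog_row' i) *m omega_trans k i j *m diag_mx (dlog_row j).
Proof.
by rewrite -mulmxA omega_trans_dlog mulmxA (mulmx1C (dlog_rowK i)) mul1mx.
Qed.

Lemma dlog_mx_id i : dlog_mx i i = 1%:M.
Proof.
apply/matrixP=> a b; rewrite !mxE (inj_eq lift_inj) (negPf (neq_lift i b)) subr0.
by case: eqP.
Qed.

Lemma dlog_mx_comp i j l : dlog_mx i j *m dlog_mx j l = dlog_mx i l.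
Proof.
apply: cmx_inj; rewrite [LHS]map_mxM ![map_mx _ _]dlog_mxE dlog_mxE.
rewrite -(omega_trans_comp k i j l) !mulmxA.
rewrite -(mulmxA _ (diag_mx (dlog_row j)) (diag_mx (dlog_row' j))) dlog_rowK mulmx1.
by [].
Qed.

Local Notation r := (pf_rank P n.-1).
Definition pf_M i j : 'M[k]_(vrank E) := pf_mx P (dlog_mx i j).
Definition pf_D i : 'M[K]_(vrank E) := pf_mx_ext P (@ratconst k n) (diag_mx (dlog_row i)).
Definition pf_D' i : 'M[K]_(vrank E) := pf_mx_ext P (@ratconst k n) (diag_mx (dlog_row' i)).
Definition pf_E (w : 'X_{1..n.-1 < d.+1}) : 'M[k]_(vrank E) := weight_mx P w.
(** The torus element of chart [i] has the entries x_t / x_i with t = [lift i a], so the character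
    [w] takes the value x^(pf_wt i w) / x_i^(mdeg w) on it. *)
Definition pf_wt (i : 'I_n) (w : 'X_{1..n.-1 < d.+1}) : 'X_{1..n} :=
  [multinom (if unlift i t is Some a then (w : 'X_{1..n.-1}) a else 0%N) | t < n].

Fact pf_M_id i : pf_M i i = 1%:M.
Proof. by rewrite /pf_M dlog_mx_id pf_mx1. Qed.

Fact pf_M_comp i j l : pf_M i j *m pf_M j l = pf_M i l.
Proof. by rewrite /pf_M -pf_mxM dlog_mx_comp. Qed.

Fact pf_DK i : pf_D i *m pf_D' i = 1%:M.
Proof. by rewrite /pf_D /pf_D' -pf_mx_extM dlog_rowK pf_mx_ext1. Qed.

Fact pf_D_trans i j : trans E i j *m pf_D j = pf_D i *m cmx n (pf_M i j).
Proof.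
rewrite /pf_D /pf_M -pf_mx_extM omega_trans_dlog pf_mx_extM; congr (_ *m _).
by rewrite /cmx -(pf_mx_extE P) (pf_mx_ext_map P (f' := @ratconst k n)).
Qed.

Fact pf_E_orth w w' : pf_E w *m pf_E w' = if w == w' then pf_E w else 0.
Proof. by rewrite /pf_E weight_mx_orth. Qed.

Fact pf_E_sum : \sum_w pf_E w = 1%:M.
Proof. exact: weight_mx_sum. Qed.

Fact pf_wt_self i w : pf_wt i w i = 0%N.
Proof. by rewrite mnmE unlift_none. Qed.

Lemma pf_wt_lift i w a : pf_wt i w (fintype.lift i a) = (w : 'X_{1..n.-1}) a.
Proof. by rewrite mnmE liftK. Qed.

Lemma mdeg_pf_wt i w : mdeg (pf_wt i w) = mdeg w.
Proof.
rewrite !mdegE (bigD1_ord i) //= pf_wt_self add0n.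
by apply: eq_bigr => a _; rewrite pf_wt_lift.
Qed.

Fact pf_wt_deg i w : (mdeg (pf_wt i w) <= d)%N.
Proof. by rewrite mdeg_pf_wt -ltnS bmdeg. Qed.

Fact pf_D_E i w : pf_D i *m cmx n (pf_E w) =
  (mono k (pf_wt i w) / X i ^+ mdeg (pf_wt i w)) *: cmx n (pf_E w).
Proof.
rewrite /pf_D /pf_E /cmx pf_diag_weight; congr (_ *: _).
rewrite mdeg_pf_wt mdegE -prodrXr /mono mpolyXE_id rmorph_prod (bigD1_ord i) //=.
rewrite pf_wt_self expr0 rmorph1 mul1r -prodf_div.
by apply: eq_bigr => a _; rewrite mxE expr_div_n pf_wt_lift rmorphXn.
Qed.

Definition pf_toric : toric E d :=
  Toric pf_M_id pf_M_comp pf_DK pf_D_trans pf_E_orth pf_E_sum pf_wt_self pf_wt_deg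
    pf_D_E.

End OmegaToric.

(** * Kunneth isomorphism *)

Section Bases.
Variable k : fieldType.

Definition is_basis (V : lmodType k) (J : finType) (e : J -> V) :=
  basis_mod (fun _ => True) (fun x : V => x = 0) e.

Lemma basis_span (V : lmodType k) (J : finType) (e : J -> V) x :
  is_basis e -> exists mu, x = \sum_a mu a *: e a.
Proof.
case=> _ /(_ x I)[mu /eqP] + _; rewrite subr_eq0 => /eqP ->; by exists mu.
Qed.

Lemma basisI (V : lmodType k) (J : finType) (e : J -> V) :
  (forall x, exists mu, x = \sum_a mu a *: e a) ->
  (forall mu, \sum_a mu a *: e a = 0 -> forall a, mu a = 0) -> is_basis e.
Proof.
move=> sp fr; split=> // x _; have [mu {1}->] := sp x.
by exists mu; rewrite subrr.
Qed.

Lemma basis_coord (V : lmodType k) (J : finType) (e : J -> V) : is_basis e ->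
  exists l : J -> {linear V -> k^o},
    (forall x, x = \sum_a l a x *: e a) /\ forall a b, l a (e b) = (a == b)%:R.
Proof.
move=> eB; have [_ _ fr] := eB.
have /choice[c cP] x := basis_span x eB.
have c_uniq x (mu : J -> k) : x = \sum_a mu a *: e a -> forall a, c x a = mu a.
  move=> xE a; apply/eqP; rewrite -subr_eq0; apply/eqP.
  apply: (fr (fun a => c x a - mu a)); under eq_bigr do rewrite scalerBl.
  by rewrite sumrB -xE -cP subrr.
have c_lin a : linear (fun x => c x a : k^o).
  move=> t x y; apply: (c_uniq _ (fun a => t * c x a + c y a)).
  rewrite {1}(cP x) {1}(cP y) scaler_sumr -big_split.
  by apply: eq_bigr => b _; rewrite scalerDl scalerA.
pose l a : {linear V -> k^o} := HB.pack (fun x => c x a : k^o)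
  (GRing.isLinear.Build _ _ _ _ (fun x => c x a : k^o) (c_lin a)).
exists l; split=> [x|a b]; first exact: cP.
apply: (c_uniq _ (fun a => (a == b)%:R)).
rewrite (bigD1 b) //= eqxx scale1r big1 ?addr0 // => b' /negPf ->.
by rewrite scale0r.
Qed.

Lemma lmod_iso_basis (V V' : lmodType k) (J J' : finType) (e : J -> V) (e' : J' -> V') :
  is_basis e -> is_basis e' -> #|J| = #|J'| -> lmod_iso V V'.
Proof.
move=> /basis_coord[l [lE ld]] /basis_coord[l' [l'E l'd]] JJ'.
pose g a := enum_val (cast_ord JJ' (enum_rank a)).
pose g' a := enum_val (cast_ord (esym JJ') (enum_rank a)).
have gK : cancel g g' by move=> a; rewrite /g' enum_valK cast_ordK enum_rankK.
have g'K : cancel g' g by move=> a; rewrite /g enum_valK cast_ordKV enum_rankK.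
pose f x := \sum_a l a x *: e' (g a).
have f_lin : linear f.
  move=> t x y; rewrite scaler_sumr -big_split; apply: eq_bigr => a _.
  by rewrite linearP scalerDl scalerA.
pose fL : {linear V -> V'} := HB.pack f (GRing.isLinear.Build _ _ _ _ f f_lin).
exists fL; exists (fun y => \sum_a l' a y *: e (g' a)) => [x|y] /=.
  rewrite {2}(lE x) (reindex g) /=; last by exists g' => a _; [exact: gK | exact: g'K].
  apply: eq_bigr => a _; rewrite gK /f linear_sum (bigD1 a) //= linearZ /= l'd eqxx.
  rewrite big1 ?addr0 => [|b ba]; first by rewrite /GRing.scale /= mulr1.
  rewrite linearZ /= l'd (inj_eq (can_inj gK)) eq_sym (negPf ba).
  exact: scaler0.
rewrite {2}(l'E y) /f (reindex g') /=; last by exists g => a _; [exact: g'K | exact: gK].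
apply: eq_bigr => a _; rewrite g'K linear_sum (bigD1 a) //= linearZ /= ld eqxx.
rewrite big1 ?addr0 => [|b ba]; first by rewrite /GRing.scale /= mulr1.
rewrite linearZ /= ld (inj_eq (can_inj g'K)) eq_sym (negPf ba).
exact: scaler0.
Qed.

Lemma subquot_basis (U : lmodType k) (Z B : submodClosed U) (J : finType) (z : J -> U) :
  basis_mod (fun x => x \in Z) (fun x => x \in B) z ->
  exists e : J -> subquot Z B, is_basis e.
Proof.
case=> zZ sp fr; pose s a : submodule Z := exist _ (z a) (zZ a).
pose e a : subquot Z B := quotmod_pi _ (s a).
have eE mu : \sum_a mu a *: e a = quotmod_pi _ (\sum_a mu a *: s a).
  by rewrite linear_sum; apply: eq_bigr => a _; rewrite linearZ.
have sE mu : val (\sum_a mu a *: s a) = \sum_a mu a *: z a.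
  by rewrite raddf_sum.
exists e; apply: basisI => [x|mu].
  have [u ->] := quotmodW x; have [mu muB] := sp (val u) (valP u).
  exists mu; rewrite eE; apply/quotmodP; apply/prop_submodP.
  by rewrite raddfB /= sE.
rewrite eE => E0; have : quotmod_pi _ (\sum_a mu a *: s a) = quotmod_pi
  (prop_submod (subquot_rel_closed Z B)) 0 by rewrite linear0.
by move/quotmodP/prop_submodP; rewrite subr0 sE => /fr.
Qed.

Lemma dsum_basis (I : finType) (V : I -> lmodType k) (J : I -> finType)
    (e : forall i, J i -> V i) : (forall i, is_basis (@e i)) ->
  exists f : {i : I & J i} -> dsum V, is_basis f.
Proof.
move=> eB; pose f (s : {i : I & J i}) : dsum V :=
  [ffun i => dfwith (fun i => 0 : V i) (e (tag s) (tagged s)) i].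
have fE (mu : {i : I & J i} -> k) i :
    (\sum_s mu s *: f s) i = \sum_a mu (Tagged J a) *: e i a.
  rewrite (_ : (\sum_s mu s *: f s) i = \sum_s mu s *: f s i); last first.
    elim/big_rec2: _ => [|s x y _ <-]; first by rewrite ffunE.
    by rewrite !ffunE.
  pose F i' (a : J i') : V i := mu (Tagged J a) *: f (Tagged J a) i.
  rewrite (eq_bigr (fun s => F (tag s) (tagged s))); last by case.
  apply: etrans (esym (sig_big_dep xpredT (fun _ => xpredT) F)) _.
  rewrite (bigD1 i) //= [X in _ + X]big1 ?addr0 => [|i' i'i].
    by apply: eq_bigr => a _; rewrite /F ffunE dfwith_in.
  by apply: big1 => a _; rewrite /F ffunE dfwith_out // scaler0.
exists f; apply: basisI => [x|mu mu0 [i a]].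
  pose c i := projT1 (cid (basis_span (x i) (eB i))).
  have cE i : x i = \sum_a c i a *: e i a := projT2 (cid (basis_span (x i) (eB i))).
  exists (fun s => c (tag s) (tagged s)); apply/ffunP=> i.
  by rewrite fE cE.
have [_ _ fr] := eB i; apply: (fr (fun a => mu (Tagged J a))).
by rewrite -fE mu0 ffunE.
Qed.

(** * Bases of tensor products *)

Section TensorBasis.
Variables (U V : lmodType k) (J J' : finType) (e : J -> U) (e' : J' -> V).
Hypotheses (eB : is_basis e) (e'B : is_basis e').

Definition pure (u : U) (v : V) : tensor U V := quotmod_pi _ << (u, v) >>.

Lemma pure_linear_l a u u' v : pure (a *: u + u') v = a *: pure u v + pure u' v.
Proof.
rewrite /pure -linearP; apply/quotmodP/prop_submodP.
rewrite opprD addrA -[_ - _]addr0 -[X in X + 0]scale1r.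
by apply/bilinear_span_l/bilinear_span0.
Qed.

Lemma pure_linear_r a u v v' : pure u (a *: v + v') = a *: pure u v + pure u v'.
Proof.
rewrite /pure -linearP; apply/quotmodP/prop_submodP.
rewrite opprD addrA -[_ - _]addr0 -[X in X + 0]scale1r.
by apply/bilinear_span_r/bilinear_span0.
Qed.

Lemma pure_suml v (I : finType) (mu : I -> k) (u : I -> U) :
  pure (\sum_i mu i *: u i) v = \sum_i mu i *: pure (u i) v.
Proof.
have pure0 : pure 0 v = 0.
  by apply: (addrI (pure 0 v)); have := pure_linear_l 1 0 0 v; rewrite !scale1r !addr0 => <-.
elim/big_rec2: _ => [//|i x y _ <-]; exact: pure_linear_l.
Qed.

Lemma pure_sumr u (I : finType) (mu : I -> k) (v : I -> V) :
  pure u (\sum_i mu i *: v i) = \sum_i mu i *: pure u (v i).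
Proof.
have pure0 : pure u 0 = 0.
  by apply: (addrI (pure u 0)); have := pure_linear_r 1 u 0 0; rewrite !scale1r !addr0 => <-.
elim/big_rec2: _ => [//|i x y _ <-]; exact: pure_linear_r.
Qed.

Lemma bilinear_span_ker (phi : {linear {freeg (U * V)%type / k} -> k^o}) x :
  (forall a u u' v, phi << (a *: u + u', v) >> = a *: phi << (u, v) >> + phi << (u', v) >>) ->
  (forall a u v v', phi << (u, a *: v + v') >> = a *: phi << (u, v) >> + phi << (u, v') >>) ->
  bilinear_span x -> phi x = 0.
Proof.
move=> Hl Hr; elim=> [|a b u u' v y _ IH|a b u v v' y _ IH].
- exact: linear0.
- rewrite linearD linearZ /= IH addr0 2!(raddfB phi) /= Hl [phi (a *: _)]linearZ /=.
  by rewrite -addrA -opprD subrr scaler0.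
- rewrite linearD linearZ /= IH addr0 2!(raddfB phi) /= Hr [phi (a *: _)]linearZ /=.
  by rewrite -addrA -opprD subrr scaler0.
Qed.

(** The functional l (x) l' on the free module. [fglift] is used as an additive map, whose linearity
    is then checked on generators. *)
Lemma pure_functional (l : {linear U -> k^o}) (l' : {linear V -> k^o}) :
  exists phi : {linear {freeg (U * V)%type / k} -> k^o},
    forall u v, phi << (u, v) >> = l u * l' v.
Proof.
pose phi0 (z : U * V) : k^o := l z.1 * l' z.2.
pose g : {additive {freeg (U * V)%type / k} -> k^o} := HB.pack (fglift phi0)
  (GRing.isZmodMorphism.Build _ _ (fglift phi0) (lift_is_additive phi0)).
have gU c z : g << c *g z >> = c *: phi0 z by exact: liftU.
have g_lin : linear g.
  move=> a x y; rewrite raddfD; congr (_ + _).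
  have -> : g x = \sum_(z <- dom x) g << coeff z x *g z >>.
    by rewrite -raddf_sum freeg_sumE.
  have -> : g (a *: x) = \sum_(z <- dom x) g (a *: << coeff z x *g z >>).
    by rewrite -raddf_sum -scaler_sumr freeg_sumE.
  rewrite scaler_sumr; apply: eq_bigr => z _.
  have -> : a *: << coeff z x *g z >> = << a * coeff z x *g z >> :> {freeg (U * V)%type / k}.
    by apply/eqP/freeg_eqP => y'; rewrite coeffZ !coeffU mulrA.
  rewrite !gU; exact: esym (scalerA a (coeff z x) (phi0 z)).
pose phi : {linear {freeg (U * V)%type / k} -> k^o} :=
  HB.pack (g : _ -> _) (GRing.isLinear.Build _ _ _ _ (g : _ -> _) g_lin).
exists phi => u v; apply: etrans (gU 1 (u, v)) _.
exact: scale1r.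
Qed.

(** The functional built from [l i] and [l' j] vanishes on the bilinear relations and reads off the
    coefficient of index (i, j), which gives independence; spanning is the expansion of
    generators. *)
Lemma tensor_basis : is_basis (fun s : J * J' => pure (e s.1) (e' s.2)).
Proof.
have [l [lE ld]] := basis_coord eB; have [l' [l'E l'd]] := basis_coord e'B.
apply: basisI => [t|mu mu0 [i j]].
  have [x ->] := quotmodW t.
  suff H : forall z, exists mu, pure z.1 z.2 =
      \sum_(s : J * J') mu s *: pure (e s.1) (e' s.2).
    have /choice[mu muE] := H.
    exists (fun s => \sum_(z <- dom x) coeff z x * mu z s).
    rewrite -[X in X = _]/(quotmod_pi _ x) -{1}(freeg_sumE x) linear_sum.
    under [RHS]eq_bigr do rewrite scaler_suml.
    rewrite exchange_big; apply: eq_bigr => z _ /=.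
    under [RHS]eq_bigr do rewrite -scalerA.
    rewrite -scaler_sumr -muE /pure -linearZ /=; congr (quotmod_pi _ _).
    apply/eqP/freeg_eqP => y; rewrite coeffZ !coeffU mul1r.
    by case: z.
  move=> [u v] /=; exists (fun s => l s.1 u * l' s.2 v).
  rewrite {1}(lE u) {1}(l'E v) (pure_suml _ (fun a => l a u)).
  rewrite (eq_bigr (fun a => \sum_b (l a u * l' b v) *: pure (e a) (e' b))).
    by rewrite pair_big.
  move=> a _; rewrite (pure_sumr _ (fun b => l' b v)) scaler_sumr.
  by apply: eq_bigr => b _; rewrite scalerA.
have [phi phiU] : exists phi : {linear {freeg (U * V)%type / k} -> k^o},
    forall u v, phi << (u, v) >> = l i u * l' j v.
  exact: pure_functional.
pose x : {freeg (U * V)%type / k} := \sum_(s : J * J') mu s *: << (e s.1, e' s.2) >>.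
have : phi x = 0.
  apply: bilinear_span_ker => [a u u' v|a u v v'|].
  - by rewrite !phiU linearP /= mulrDl; congr (_ + _); rewrite -mulrA.
  - by rewrite !phiU linearP /= mulrDr; congr (_ + _); rewrite mulrCA.
  have : quotmod_pi (prop_submod (@bilinear_span_closed k U V)) x =
      quotmod_pi _ 0.
    rewrite linear0 -mu0 linear_sum; apply: eq_bigr => s _; exact: linearZ.
  by move/quotmodP; rewrite subr0 => /prop_submodP.
rewrite linear_sum (bigD1 (i, j)) //= linearZ /= phiU ld l'd !eqxx mulr1.
rewrite big1 => [|[i' j'] ne]; last first.
  rewrite linearZ /= phiU ld l'd -natrM mulnb.
  rewrite [_ && _](_ : _ = false); first exact: scaler0.
  apply: contraNF ne => /andP[/eqP-> /eqP->]; exact: eqxx.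
by rewrite addr0 => H; rewrite -[LHS]mulr1; exact: H.
Qed.

End TensorBasis.

End Bases.

Lemma basis_modE (k : fieldType) (U : lmodType k) (Z Z' B B' : U -> Prop)
    (J : finType) (z : J -> U) : (forall x, Z x <-> Z' x) ->
  (forall x, B x <-> B' x) -> basis_mod Z B z -> basis_mod Z' B' z.
Proof.
move=> ZZ' BB' [zZ sp fr]; split=> [a|x /ZZ' /sp[mu /BB']|mu /BB' /fr //].
  exact/ZZ'.
by exists mu.
Qed.

Lemma cohomology_basis (k : fieldType) n d (E : vbundle k n) (T : toric E d)
    (i0 : 'I_n) p (J : finType) (z : J -> {ffun {set 'I_n} -> 'rV[k]_(vrank E)}) :
  (d < n)%N ->
  basis_mod (cocycle (csB (weight_system T i0)) p.+1)
    (coboundary (csB (weight_system T i0)) p.+1) z ->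
  exists e : J -> cohomology E p, is_basis e.
Proof.
move=> dn zB; apply: subquot_basis (basis_modE _ _ (basis_mod_cohomology dn zB)).
  by move=> x; apply: (rwP (prop_submodP _ _)).
by move=> x; apply: (rwP (prop_submodP _ _)).
Qed.

(** Each tag is shifted by one, so the total j.+2 means degrees with sum [j]; the bound j < m
    ensures that j - p is an admissible tag for every p <= j. *)
Lemma card_degree_pairs (h1 h2 : nat -> nat) m j : (j < m)%N ->
  #|degree_pairs (fun s : {p : 'I_m & 'I_(h1 p)} => (tag s).+1)
      (fun s : {p : 'I_m & 'I_(h2 p)} => (tag s).+1) j.+2| =
  (\sum_(j1 < j.+1) h1 j1 * h2 (j - j1)%N)%N.
Proof.
move=> jm.
have tagged_sum (h : nat -> nat) (G : 'I_m -> nat) :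
    (\sum_(s : {p : 'I_m & 'I_(h p)}) G (tag s) = \sum_(p < m) h p * G p)%N.
  rewrite -(sig_big_dep xpredT (fun _ => xpredT) (fun (p : 'I_m) (_ : 'I_(h p)) => G p)).
  by apply: eq_bigr => p _; rewrite sum_nat_const card_ord.
pose g (p q : 'I_m) : nat := if (p.+1 + q.+1 == j.+2)%N then 1%N else 0%N.
rewrite -sum1dep_card big_mkcond /=.
rewrite -(pair_bigA _ (fun s t => g (tag s) (tag t))) /=.
under eq_bigr => s _ do rewrite (tagged_sum h2 (g (tag s))).
rewrite (tagged_sum h1 (fun p => \sum_(q < m) h2 q * g p q)%N) /g.
rewrite (big_ord_widen m (fun j1 => h1 j1 * h2 (j - j1))%N jm) [RHS]big_mkcond.
apply: eq_bigr => p _; case: ifP => [pj|/negbT].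
  have qm : (j - p < m)%N by apply: leq_ltn_trans jm; apply: leq_subr.
  rewrite (bigD1 (Ordinal qm)) //= addnS addSn subnKC // eqxx muln1.
  rewrite big1 ?addn0 // => q /eqP qj; case: eqP => [E|_]; last exact: muln0.
  case: qj; apply: val_inj => /=; move/eqP: E.
  by rewrite addnS addSn !eqSS => /eqP <-; rewrite addKn.
rewrite -leqNgt => jp; rewrite big1 ?muln0 // => q _.
by rewrite addnS addSn !eqSS gtn_eqF ?muln0 // (leq_trans jp) // leq_addr.
Qed.

(** * The Kunneth isomorphism for toric bundles *)

Section ToricKunneth.
Variables (k : fieldType) (n d1 d2 : nat) (E F : vbundle k n).
Variables (T1 : toric E d1) (T2 : toric F d2) (i0 : 'I_n).
Local Notation tb := (tensor_bundle E F).
Local Notation B1 := (weight_system T1 i0).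
Local Notation B2 := (weight_system T2 i0).
Local Notation B := (weight_system (tensor_toric T1 T2) i0).
Local Notation cochain := {ffun {set 'I_n} -> 'M[k]_(vrank E, vrank F)}.

Definition tens_rows (c : cochain) : {ffun {set 'I_n} -> 'rV[k]_(vrank tb)} :=
  [ffun I : {set 'I_n} => tens_row (c I)].

Definition tens_mxs (c : {ffun {set 'I_n} -> 'rV[k]_(vrank tb)}) : cochain :=
  [ffun I : {set 'I_n} => tens_mx (c I)].

Fact tens_rows_linear : linear tens_rows.
Proof.
by move=> a x y; apply/ffunP=> I; rewrite !ffunE linearP.
Qed.

HB.instance Definition _ := GRing.isLinear.Build k cochain
  {ffun {set 'I_n} -> 'rV[k]_(vrank tb)} _ tens_rows tens_rows_linear.

Lemma tens_mxsK : cancel tens_mxs tens_rows.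
Proof. by move=> c; apply/ffunP=> I; rewrite !ffunE tens_mxK. Qed.

Lemma tens_rowsK : cancel tens_rows tens_mxs.
Proof. by move=> c; apply/ffunP=> I; rewrite !ffunE tens_rowK. Qed.

Lemma tens_rows_cobd c : tens_rows (cobd c) = cobd (tens_rows c).
Proof. by apply/ffunP=> I; rewrite ffunE -cobd_map. Qed.

Lemma tens_rows_csB c I : csB B I (tens_rows c I) <-> tens_in B1 B2 I (c I).
Proof. by rewrite weight_zero_tensor ffunE tens_rowK. Qed.

Lemma tens_rows_eq0 c I : (tens_rows c I = 0) <-> (c I = 0).
Proof.
rewrite ffunE; split=> [H|->]; last exact: linear0.
by apply: (can_inj (@tens_rowK _ _ _)); rewrite H linear0.
Qed.

Lemma tens_rows_cocycle p c :
  cocycle (csB B) p (tens_rows c) <-> cocycle (tens_in B1 B2) p c.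
Proof.
split=> [[cB c0 dc]|[cB c0 dc]]; split=> [I|I /c0|].
- exact/tens_rows_csB.
- by move/tens_rows_eq0.
- by apply: (can_inj tens_rowsK); rewrite tens_rows_cobd dc linear0.
- exact/tens_rows_csB.
- by move/tens_rows_eq0.
- by rewrite -tens_rows_cobd dc linear0.
Qed.

Lemma tens_rows_coboundary p c :
  coboundary (csB B) p (tens_rows c) <-> coboundary (tens_in B1 B2) p c.
Proof.
split=> [[b [bB b0 bE]]|[b [bB b0 ->]]]; last first.
  exists (tens_rows b); split=> [I|I /b0|]; rewrite -?tens_rows_cobd //.
    exact/tens_rows_csB.
  by move/tens_rows_eq0.
exists (tens_mxs b); split=> [I|I /b0|].
- by apply/tens_rows_csB; rewrite tens_mxsK.
- by rewrite -{1}[b]tens_mxsK => /tens_rows_eq0.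
- by apply: (can_inj tens_rowsK); rewrite tens_rows_cobd tens_mxsK.
Qed.

Lemma basis_mod_tens_rows p (J : finType) (y : J -> cochain) :
  basis_mod (cocycle (tens_in B1 B2) p) (coboundary (tens_in B1 B2) p) y ->
  basis_mod (cocycle (csB B) p) (coboundary (csB B) p) (tens_rows \o y).
Proof.
have cbd := @coboundary_closed _ _ _ _ p (csB_closed B).
move=> yB; apply: (basis_mod_push (f := tens_rows) _ _ _ _ _ _ yB) => [||x|x|x xZ|x _].
- exact/cocycle_closed/tens_in_closed.
- exact: cbd.
- by move/tens_rows_cocycle.
- by move/tens_rows_coboundary.
- exists (tens_mxs x); first by apply/tens_rows_cocycle; rewrite tens_mxsK.
  by rewrite /= tens_mxsK subrr; case: cbd.
- by move/tens_rows_coboundary.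
Qed.

Hypothesis n_big : (d1 + d2 < n)%N.

(** The cross products of classes, carried through the middle complex, give a basis of the left
    side; the right side has a basis built from those of the two bundles. Both are counted by the
    same [h1] and [h2]. *)
Theorem toric_kunneth j :
  lmod_iso (cohomology tb j)
    (dsum (fun j1 : 'I_j.+1 => tensor (cohomology E j1) (cohomology F (j - j1)%N))).
Proof.
have [h1 [bas1 tf1]] := total_family_exists B1.
have [h2 [bas2 tf2]] := total_family_exists B2.
have d1n : (d1 < n)%N by apply: leq_ltn_trans n_big; apply: leq_addr.
have d2n : (d2 < n)%N by apply: leq_ltn_trans n_big; apply: leq_addl.
(* The bound must reach [n] to exhaust the cohomology and exceed [j] for [card_degree_pairs]. *)
have [z1 [l1 t1]] := tf1 (n + j.+1)%N (leq_addr _ _).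
have [z2 [l2 t2]] := tf2 (n + j.+1)%N (leq_addr _ _).
have [y yB] := basis_mod_mid_tens (basis_mod_prod_mid n_big (kunneth_basis t1 t2 j.+1)).
have [e eB] := cohomology_basis n_big (basis_mod_tens_rows yB).
have E1 p : exists e : 'I_(h1 p) -> cohomology E p, is_basis e.
  by have [z /(cohomology_basis d1n)] := bas1 p.
have E2 p : exists e : 'I_(h2 p) -> cohomology F p, is_basis e.
  by have [z /(cohomology_basis d2n)] := bas2 p.
pose e1 p := projT1 (cid (E1 p)); have e1B p : is_basis (e1 p) := projT2 (cid (E1 p)).
pose e2 p := projT1 (cid (E2 p)); have e2B p : is_basis (e2 p) := projT2 (cid (E2 p)).
have [f fB] := dsum_basis (fun j1 : 'I_j.+1 => tensor_basis (e1B j1) (e2B (j - j1)%N)).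
apply: lmod_iso_basis eB fB _.
rewrite card_sig card_degree_pairs ?leq_addl // card_tagged sumnE big_map big_enum.
by apply: eq_bigr => j1 _; rewrite card_prod !card_ord.
Qed.

End ToricKunneth.

Theorem theorem4p3 (k : closedFieldType) (n d d' : nat)
    (P : polyFunctor k d) (P' : polyFunctor k d') (hn : (d + d' < n)%N)
    (j : nat) :
  let Omega := omega k n in
  lmod_iso
    (cohomology (tensor_bundle (pf_bundle P Omega) (pf_bundle P' Omega)) j)
    (dsum (fun j1 : 'I_j.+1 =>
      tensor (cohomology (pf_bundle P Omega) j1)
             (cohomology (pf_bundle P' Omega) (j - j1)%N))).
Proof.
(* The inequality makes [n] positive, so the index 0 exists and serves as the reference chart. *)
exact: toric_kunneth (pf_toric n P) (pf_toric n P') (Ordinal (leq_ltn_trans (leq0n _) hn)) hn j.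
Qed.
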